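(* Let $p$ be a prime with $p\equiv 7\pmod{16}$, let $\epsilon$ be the fundamental unit of $\mathbb{Q}(\sqrt{p})$, let $\mathbf{N}$ and $\mathrm{Tr}$ denote the norm and trace from $\mathbb{Q}(\sqrt[4]{p})$ to $\mathbb{Q}(\sqrt{p})$, and let $\mathfrak q$ be the unique prime of $\mathbb{Q}(\sqrt{p})$ above $2$. (1) There exists a totally positive unit $\eta$ of $\mathbb{Q}(\sqrt[4]{p})$ such that $\mathbf{N}(\eta)=\epsilon$ and the unit group of the ring of integers of $\mathbb{Q}(\sqrt[4]{p})$ equals $\langle \eta,\epsilon,-1\rangle$. (2) For every unit $\eta'$ of $\mathbb{Q}(\sqrt[4]{p})$ with $\mathbf{N}(\eta')=\epsilon$, one has $v_{\mathfrak q}(\mathrm{Tr}(\eta'))=3$ and $\eta'\equiv -\mathrm{sgn}(\eta')\pmod{\sqrt[4]{p}}$.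
   Context: Here $\sqrt[4]{p}$ is the real positive fourth root. A unit $\eta'$ with $\mathbf{N}(\eta')=\epsilon$ is either totally positive or totally negative (its values under the two real embeddings of $\mathbb{Q}(\sqrt[4]{p})$ have the same sign), and $\mathrm{sgn}(\eta')\in\{\pm1\}$ denotes this common sign. $v_{\mathfrak q}$ is the $\mathfrak q$-adic valuation, and the congruence is in the ring of integers of $\mathbb{Q}(\sqrt[4]{p})$. *)

(* Defs.v *)
From HB Require Import structures.
From mathcomp Require Import all_boot all_order all_algebra all_field.

Set Implicit Arguments.
Unset Strict Implicit.
Unset Printing Implicit Defensive.

Import Order.TTheory GRing.Theory Num.Theory.
Local Open Scope ring_scope.

(* Number fields are subfields E of an ambient Galois number field L
   (a splittingFieldType rat): this is what the library's galNorm and galTrace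
   require. Elements of E are elements of L that belong to E. *)
Section NumberField.

Variable L : splittingFieldType rat.
Implicit Types (E : {subfield L}) (x y : L) (q : L -> Prop).

Definition ring_of_integers E x : Prop :=
  x \in E /\ integralOver (intr : int -> L) x.

Definition is_unit E x : Prop :=
  [/\ x != 0, ring_of_integers E x & ring_of_integers E x^-1].

Definition prime_ideal E q : Prop :=
  [/\ (forall x, q x -> ring_of_integers E x),
      [/\ q 0,
          forall x y, q x -> q y -> q (x + y)
        & forall a x, ring_of_integers E a -> q x -> q (a * x)],
      ~ q 1
    & forall x y, ring_of_integers E x -> ring_of_integers E y ->
        q (x * y) -> q x \/ q y].

Definition prime_ideal_above E (l : nat) q : Prop := prime_ideal E q /\ q l%:R.

(* q ^ n: linear combinations, with coefficients in the ring of integers,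
   of products of n elements of q; q ^ 0 is the whole ring of integers. *)
Definition ideal_pow E q (n : nat) x : Prop :=
  exists m : nat, exists a : 'I_m -> L, exists f : 'I_m -> 'I_n -> L,
    [/\ forall i, ring_of_integers E (a i),
        forall i j, q (f i j)
      & x = \sum_(i < m) a i * \prod_(j < n) f i j].

(* The q-adic valuation of an element x of the ring of integers of E is n.
   No n satisfies this when x = 0 or when x is not integral. *)
Definition valuation_eq E q x (n : nat) : Prop :=
  ideal_pow E q n x /\ ~ ideal_pow E q n.+1 x.

Definition congr_mod E (m x y : L) : Prop :=
  exists2 z, ring_of_integers E z & x - y = m * z.

(* An embedding of E in the real numbers is a morphism to algC (the algebraic
   complex numbers) whose values are real. *)
Definition real_embedding E (sigma : {rmorphism subvs_of E -> algC}) : Prop :=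
  forall z, sigma z \is Num.real.

Definition totally_positive E x : Prop :=
  forall sigma : {rmorphism subvs_of E -> algC},
    real_embedding sigma -> 0 < sigma (vsproj E x).

Definition totally_negative E x : Prop :=
  forall sigma : {rmorphism subvs_of E -> algC},
    real_embedding sigma -> sigma (vsproj E x) < 0.

(* x has the same sign s under all real embeddings of E. *)
Definition common_sign E x (s : int) : Prop :=
  (s = 1 /\ totally_positive E x) \/ (s = -1 /\ totally_negative E x).

(* E is a real quadratic field, regarded as a subfield of the real numbers
   through iota; its fundamental unit is the one greater than 1. *)
Definition fundamental_unit (iota : {rmorphism L -> algC}) E eps : Prop :=
  [/\ is_unit E eps,
      1 < iota eps
    & forall u, is_unit E u ->
        exists b : bool, exists n : int, u = (-1) ^+ b * eps ^ n].

End NumberField.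

(* Main.v *)
Require Import Defs.
From mathcomp Require Import all_boot all_order all_algebra all_fingroup all_field.
From mathcomp Require Import zify ring lra.
Import Order.TTheory GRing.Theory Num.Theory.
Local Open Scope ring_scope.

Set Implicit Arguments.
Unset Strict Implicit.

(* Write s = r^2 = sqrt p. The integers of k are the c + d s, those of K are the
   A + B r with A, B integers of k, and the norm to k of a unit of K is a power of
   eps. Factoring the Pell equation of eps gives 2 eps = pi^2 with pi = a + b s
   and a^2 - p b^2 = 2; in particular pi generates the prime above 2.

   (1) With sg the conjugation r |-> - r, the pigeonhole principle gives a unit u0
   for which |u / sg u| is minimal among the values greater than 1. It suffices
   that N(u0) is an odd power of eps, since eta is then u0 up to sign and a power
   of eps. If it is an even power, normalize N(u0) = 1 and u0 > 0; then
   u0 (2 + Tr u0) = (1 + u0)^2, and a study of the norm of 1 + Tr(u0) / 2 shows that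
   u0 = eps^j v^2 for a unit v, which contradicts minimality.

   (2) Let eta = A + B r with A = c + d s and N(eta) = eps. Reducing
   2 A^2 - 2 s B^2 = pi^2 modulo the norm of B and using (2 / n) shows that c and d
   are odd, so that Tr(eta) = 2 A has valuation 3. If eta > 0, then c, d > 0, and
   reducing the same equation modulo the norm of A gives, by quadratic
   reciprocity, (c / p) = -1. As c^2 = 1 mod p, it follows that c = -1 mod p. *)

(** Writing eps as pi^2 / 2 turns N(eta) = eps into a congruence between squares modulo any odd n
    modulo which sqrt p has an image. The moduli that occur are norms and gcds of coordinates,
    usually composite, hence a symbol defined directly for every odd modulus. The class 7 mod 16
    forces b = 1 or -1 and a = 3 or -3 mod 8, so that (a / p) = (-p / a) = (2 / a) = -1. This
    nonresidue is what rules out, in the descent of (1), that a unit of norm 1 be pi times a square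
    up to a rational factor. K has two real places and one complex place. At the complex place a
    relative norm is a sum of two squares, which is why norms of units are powers of eps without a
    sign. The map u |-> |u / sg u| is a homomorphism whose kernel on units is generated by eps and
    -1, so a unit with the least value above 1 generates the units modulo these two. *)

(** * The Gauss-Schering symbol *)

Section GaussSymbol.
Implicit Types (a b x y : int) (m n : nat).

Definition upper_half n x : bool := ((n./2)%:Z < (x %% n%:Z)%Z).

(* Gauss-Schering symbol: for odd [n] coprime to [a] the Jacobi symbol (a/n) is
   [(-1) ^+ jac a n]. *)
Definition jac a n : bool :=
  \big[addb/false]_(i < n./2) upper_half n (a * i.+1%:Z).

(** Absolute value of the residue of [x] mod [n] that is least in absolute value; [upper_half] tells
    when that residue is negative. *)
Definition fold_half n x : nat :=
  (if upper_half n x then n - absz (x %% n%:Z)%Z else absz (x %% n%:Z)%Z)%N.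

Lemma jac_mod a b n : (n%:Z %| a - b)%Z -> jac a n = jac b n.
Proof.
move=> /dvdzP[c ab]; apply: eq_bigr => i _; rewrite /upper_half.
have -> : a * i.+1%:Z = c * i.+1%:Z * n%:Z + b * i.+1%:Z.
  by have -> : a = c * n%:Z + b by [lia]; ring.
by rewrite modzMDl.
Qed.

Lemma fold_halfE n x : odd n ->
  exists q, x = (-1) ^+ upper_half n x * (fold_half n x)%:Z + q * n%:Z.
Proof.
move=> on; rewrite /fold_half; have n0 : n%:Z != 0 by case: n on.
have := divz_eq x n; set q := (x %/ n)%Z.
have := modz_ge0 x n0; have := ltz_mod x n0.
case: upper_half => h1 h2 h3.
  exists (q + 1); rewrite expr1; have : (absz (x %% n)%Z <= n)%N by lia.
  by move: (x %% n)%Z h1 h2 h3 => r ? ? ? ?; rewrite -subzn //; lia.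
by exists q; rewrite expr0; move: (x %% n)%Z h1 h2 h3 => r; lia.
Qed.

Lemma upper_half_mod n x y : (n%:Z %| x - y)%Z -> upper_half n x = upper_half n y.
Proof.
move=> /dvdzP[c ab]; rewrite /upper_half.
by have -> : x = c * n%:Z + y by [lia]; rewrite modzMDl.
Qed.

Lemma upper_half_opp n x : odd n -> ~~ (n%:Z %| x)%Z ->
  upper_half n (- x) = ~~ upper_half n x.
Proof.
move=> on xn; rewrite /upper_half.
have n0 : n%:Z != 0 by case: n on {xn}.
have r0 : (x %% n)%Z != 0 by apply: contra xn => /eqP e; apply/dvdz_mod0P.
have := modz_ge0 x n0; have := ltz_mod x n0 => h1 h2.
have -> : ((- x) %% n)%Z = n%:Z - (x %% n)%Z.
  rewrite [in LHS](divz_eq x n).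
  have -> : - ((x %/ n)%Z * n + (x %% n)%Z) = (- (x %/ n)%Z - 1) * n%:Z + (n%:Z - (x %% n)%Z).
    by ring.
  rewrite modzMDl modz_small //; move: (x %% n)%Z r0 h1 h2 => r; lia.
have := odd_double_half n; rewrite on.
by move: (x %% n)%Z r0 h1 h2 => r; lia.
Qed.

Lemma fold_half_bound n x : odd n -> ~~ (n%:Z %| x)%Z ->
  (0 < fold_half n x <= n./2)%N.
Proof.
move=> on xn; rewrite /fold_half.
have n0 : n%:Z != 0 by case: n on {xn}.
have r0 : (x %% n)%Z != 0 by apply: contra xn => /eqP e; apply/dvdz_mod0P.
have := modz_ge0 x n0; have := ltz_mod x n0 => h1 h2.
have := odd_double_half n; rewrite on.
case: ifP; rewrite /upper_half; move: (x %% n)%Z r0 h1 h2 => r; lia.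
Qed.

Lemma coprime_half n b (i : nat) : odd n -> coprimez b n -> (i < n./2)%N ->
  ~~ (n%:Z %| b * i.+1%:Z)%Z.
Proof.
move=> on bn ih; rewrite Gauss_dvdzr; last by rewrite coprimez_sym.
apply/negP => /dvdn_leq; have := odd_double_half n; rewrite on; lia.
Qed.

Section Reindex.
Variables (n : nat) (b : int).
Hypotheses (on : odd n) (bn : coprimez b n).

Lemma fold_ord_subproof (i : 'I_(n./2)) : ((fold_half n (b * i.+1%:Z)).-1 < n./2)%N.
Proof. have := fold_half_bound on (coprime_half on bn (ltn_ord i)); lia. Qed.

(** Gauss's permutation: up to sign, multiplication by [b] permutes 1, ..., n./2. The ordinals are
    these indices shifted down by one. *)
Definition fold_ord (i : 'I_(n./2)) := Ordinal (fold_ord_subproof i).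

Lemma fold_ordE i : (fold_ord i).+1 = fold_half n (b * i.+1%:Z).
Proof. have /= := fold_half_bound on (coprime_half on bn (ltn_ord i)); lia. Qed.

Lemma fold_ord_inj : injective fold_ord.
Proof.
move=> i j /(congr1 (fun k => (nat_of_ord k).+1)); rewrite !fold_ordE => e.
have [q hq] := fold_halfE (b * i.+1%:Z) on.
have [s hs] := fold_halfE (b * j.+1%:Z) on.
rewrite e in hq; move: hq hs; set f := (fold_half _ _)%:Z.
have dvd k : (n%:Z %| b * k)%Z -> (n%:Z %| k)%Z.
  by rewrite Gauss_dvdzr // coprimez_sym.
have := odd_double_half n; rewrite on => hn.
have hi := ltn_ord i; have hj := ltn_ord j.
have main : (n%:Z %| i.+1%:Z - j.+1%:Z)%Z || (n%:Z %| i.+1%:Z + j.+1%:Z)%Z ->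
    i = j.
  move=> h; apply: val_inj => /=; case/orP: h => h.
    apply/eqP; apply: contraTT h => ne; apply/negP => /dvdn_leq; lia.
  by exfalso; move: h => /dvdn_leq; lia.
case: upper_half; case: upper_half; rewrite ?expr1 ?expr0 => hq hs; apply: main;
  apply/orP.
- left; apply: dvd; apply/dvdzP; exists (q - s); rewrite mulrBr hq hs; ring.
- right; apply: dvd; apply/dvdzP; exists (q + s); rewrite mulrDr hq hs; ring.
- right; apply: dvd; apply/dvdzP; exists (q + s); rewrite mulrDr hq hs; ring.
- left; apply: dvd; apply/dvdzP; exists (q - s); rewrite mulrBr hq hs; ring.
Qed.

End Reindex.

(** The sign of a b i is the sign of b i times the sign of a |b i|, where |b i| is the folded
    residue; it runs over 1, ..., n./2 together with i. Primality of n plays no part in this. *)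
Lemma jacM a b n : odd n -> coprimez a n -> coprimez b n ->
  jac (a * b) n = jac a n (+) jac b n.
Proof.
move=> on an bn; rewrite /jac.
rewrite [X in X (+) _](reindex_inj (@fold_ord_inj n b on bn)) /= -big_split /=.
apply: eq_bigr => i _; rewrite (fold_ordE on bn).
set x := b * i.+1%:Z.
have [q hq] := fold_halfE x on.
have [/andP[f0 fh]] : (0 < fold_half n x <= n./2)%N /\ True.
  by split=> //; apply: fold_half_bound => //; apply: coprime_half.
move=> _; have nf : ~~ (n%:Z %| a * (fold_half n x)%:Z)%Z.
  by rewrite -(prednK f0); apply: coprime_half; lia.
have -> : upper_half n (a * b * i.+1%:Z)
   = upper_half n ((-1) ^+ upper_half n x * (a * (fold_half n x)%:Z)).
  apply: upper_half_mod; apply/dvdzP; exists (a * q).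
  rewrite -mulrA -/x {1}hq; ring.
case: (upper_half n x); rewrite ?expr0 ?mul1r ?addbF // expr1 mulN1r.
by rewrite upper_half_opp // addbT.
Qed.

Lemma jac_sqr a n : odd n -> coprimez a n -> jac (a * a) n = false.
Proof. by move=> on an; rewrite jacM // addbb. Qed.

Lemma jac1 n : odd n -> jac 1 n = false.
Proof. by move=> on; rewrite -[1]mulr1 jac_sqr // /coprimez gcd1z. Qed.

Lemma jacN1 n : odd n -> jac (-1) n = odd n./2.
Proof.
move=> on; have -> : odd n./2 = \big[addb/false]_(i < n./2) true.
  rewrite big_const_ord; elim: n./2 => //= k ->; by case: odd.
apply: eq_bigr => i _; rewrite mulN1r upper_half_opp //; last first.
  by rewrite -[i.+1%:Z]mul1r coprime_half // /coprimez gcd1z.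
rewrite /upper_half modz_small; have := ltn_ord i; have := odd_double_half n; lia.
Qed.

Lemma big_addb_odd (I : finType) (F : I -> nat) :
  \big[addb/false]_(i : I) odd (F i) = odd (\sum_(i : I) F i).
Proof. by rewrite (big_morph odd oddD (erefl (odd 0))). Qed.

Lemma sum_ord_leq (H q : nat) : (\sum_(j < H) (j.+1 <= q)%N = minn H q)%N.
Proof. elim: H => [|H IH]; rewrite ?big_ord0 ?big_ord_recr /= ?IH; lia. Qed.

(** With h = n./2 the products 2 i, i <= h, are already reduced mod n, and h - h./2 of them exceed
    h. *)
Lemma jac2 n : odd n -> jac 2 n = ~~ ((n %% 8 == 1) || (n %% 8 == 7))%N.
Proof.
move=> on; set h := n./2.
have -> : jac 2 n = odd (h - h./2)%N.
  have -> : (h - h./2 = \sum_(i < h) (h < 2 * i.+1)%N)%N.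
    have := sum_ord_leq h h./2.
    have : (\sum_(i < h) (h < 2 * i.+1) + \sum_(j < h) (j.+1 <= h./2) = h)%N.
      rewrite -big_split /= -[RHS]mul1n -[in RHS](card_ord h) mulnC -sum_nat_const.
      by apply: eq_bigr => i _; lia.
    lia.
  rewrite -big_addb_odd; apply: eq_bigr => i _; rewrite oddb /upper_half.
  case: i => i hi /=; rewrite -PoszM modz_nat ltz_nat modn_small //.
  by have := odd_double_half n; rewrite on; lia.
rewrite /h; lia.
Qed.

(** Eisenstein's form. As m and n are odd, dividing m i by n shows that i has the parity of quotient
    plus remainder, and the remainder has the parity of the folded residue plus its sign bit. Summed
    over i, the folded residues cancel the indices, which they permute. *)
Lemma jac_floor (m n : nat) : odd m -> odd n -> coprime m n ->
  jac m%:Z n = odd (\sum_(i < n./2) (m * i.+1) %/ n)%N.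
Proof.
move=> om on mn; have mn' : coprimez m%:Z n by [].
have : \big[addb/false]_(i < n./2) odd i.+1 =
   odd (\sum_(i < n./2) (m * i.+1) %/ n)%N (+) jac m n (+)
     \big[addb/false]_(i < n./2) odd i.+1.
  have -> : \big[addb/false]_(i < n./2) odd i.+1 =
      \big[addb/false]_(i < n./2) odd (fold_half n (m%:Z * i.+1%:Z)).
    rewrite (reindex_inj (@fold_ord_inj n m on mn')); apply: eq_bigr => i _.
    by rewrite -fold_ordE.
  rewrite -big_addb_odd -!big_split /=.
  have -> : \big[addb/false]_(i < n./2) odd (fold_half n (m%:Z * i.+1%:Z)) =
      \big[addb/false]_(i < n./2) odd i.+1.
    rewrite [RHS](reindex_inj (@fold_ord_inj n m on mn')); apply: eq_bigr => i _.
    by rewrite -fold_ordE.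
  apply: eq_bigr => i _.
  rewrite /fold_half /upper_half -!PoszM !modz_nat /=.
  have e := divn_eq (m * i.+1) n.
  have := ltn_pmod (m * i.+1) (odd_gt0 on).
  have := congr1 odd e; rewrite oddD !oddM om on /= andbT.
  case: ifP => h -> lt; last by rewrite addbF.
  by rewrite oddB ?(ltnW lt) // on; case: odd; case: odd.
by case: odd; case: jac; case: (\big[_/_]_(_ < _) _).
Qed.

Lemma floor_lattice (m n : nat) : odd m -> odd n ->
  (\sum_(i < n./2) (m * i.+1) %/ n =
   \sum_(i < n./2) \sum_(j < m./2) (n * j.+1 <= m * i.+1))%N.
Proof.
move=> om on; apply: eq_bigr => i _.
have := sum_ord_leq m./2 ((m * i.+1) %/ n); rewrite (minn_idPr _); last first.
  rewrite -ltnS ltn_divLR ?odd_gt0 //.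
  have := ltn_ord i; have := odd_double_half n; have := odd_double_half m; nia.
by move<-; apply: eq_bigr => j _; rewrite leq_divRL ?odd_gt0 // mulnC.
Qed.

(** The two floor sums count the lattice points of an n./2 by m./2 rectangle on either side of its
    diagonal line, which contains none of them by coprimality. *)
Lemma jac_reciprocity (m n : nat) : odd m -> odd n -> coprime m n ->
  jac m n (+) jac n m = odd m./2 && odd n./2.
Proof.
move=> om on mn; rewrite !jac_floor // 1?coprime_sym // -oddD -oddM.
rewrite !floor_lattice // [X in (_ + X)%N]exchange_big /= -big_split /=.
congr odd; rewrite mulnC -[RHS]/(n./2 * m./2)%N -[in RHS](card_ord n./2) -sum_nat_const.
apply: eq_bigr => i _; rewrite -big_split /= -[in RHS](card_ord m./2) -[RHS]muln1.
rewrite -sum_nat_const; apply: eq_bigr => j _.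
suff : (n * j.+1 != m * i.+1)%N by case: ltngtP.
apply/negP => /eqP e; have : (n %| m * i.+1)%N by rewrite -e dvdn_mulr.
rewrite Gauss_dvdr 1?coprime_sym // => /dvdn_leq.
have := ltn_ord i; have := odd_double_half n; lia.
Qed.

End GaussSymbol.

(** * The norm equation of eta over the integers *)

Lemma coprimez_bezout (x y u v : int) : u * x + v * y = 1 -> coprimez x y.
Proof. by move=> e; apply/coprimezP; exists (u, v). Qed.

(** Modulo the odd n, the inverse of 2 is - n./2, so that of x is - n./2 * y. *)
Lemma coprimez_dvd2 (n : nat) (x y : int) :
  odd n -> (n%:Z %| x * y - 2)%Z -> coprimez x n.
Proof.
move=> on /dvdzP[c e]; have := odd_double_half n; rewrite on => hn.
apply: (@coprimez_bezout _ _ (- (n./2%:Z * y)) (1 + n./2%:Z * c)).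
have hn' : n%:Z = 1 + 2 * n./2%:Z by lia.
have -> : - (n./2%:Z * y) * x = - (n./2%:Z * (x * y)) by ring.
have -> : x * y = c * n%:Z + 2 by lia.
by rewrite mulrDl mul1r {2}hn'; ring.
Qed.

Lemma coprimez_mod (n : nat) (x y : int) :
  (n%:Z %| x - y)%Z -> coprimez x n = coprimez y n.
Proof.
move=> /dvdzP[c e]; have -> : x = c * n%:Z + y by lia.
by rewrite ![coprimez _ n]coprimez_sym /coprimez gcdzMDl.
Qed.

Lemma jac_eq0 (n : nat) (a x y : int) : odd n -> coprimez y n ->
  (n%:Z %| a * (x * x) - y * y)%Z -> jac a n = false.
Proof.
move=> on yn d; have := coprimez_mod d; rewrite !coprimezMl yn /=.
move/andP => [an /andP[xn _]].
rewrite -(jac_sqr on yn) -(jac_mod d) jacM ?jac_sqr ?addbF //.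
by rewrite coprimezMl xn.
Qed.

Lemma coprimez_quad (p n x y : int) : coprimez x y ->
  (n %| x * x - p * (y * y))%Z -> coprimez y n.
Proof.
move=> xy /dvdzP[c e].
have : coprimez (x * x) y by rewrite coprimezMl xy.
case/coprimezP => -[u v] /= uv.
apply: (@coprimez_bezout _ _ (v + u * p * y) (u * c)).
rewrite -uv; have -> : x * x = c * n + p * (y * y) by lia.
ring.
Qed.

Lemma jac_opp (x : int) (n : nat) : odd n -> coprimez x n ->
  jac (- x) n = odd n./2 (+) jac x n.
Proof.
by move=> on xn; rewrite -mulN1r jacM ?jacN1 // coprimezE /= coprime1n.
Qed.

(* The ring morphism from Z[sqrt p] to Z/n killing [x + y * sqrt p], given by
   the image [t] of [sqrt p]. *)
Lemma quad_root (p n x y : int) : coprimez x y ->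
  (n %| x * x - p * (y * y))%Z ->
  exists2 t, (n %| x + y * t)%Z & (n %| t * t - p)%Z.
Proof.
move=> xy d; have yn := coprimez_quad xy d.
case/coprimezP: (yn) => -[u v] /= uv; exists (- x * u).
  apply/dvdzP; exists (x * v).
  have -> : x + y * (- x * u) = x * (1 - u * y) by ring.
  by rewrite -uv; ring.
have : (n %| (y * y) * (- x * u * (- x * u) - p))%Z.
  have -> : y * y * (- x * u * (- x * u) - p)
     = (x * x - p * (y * y)) * (u * y * (u * y)) + p * (y * y) * ((u * y) * (u * y) - 1) by ring.
  apply: rpredD; first exact: dvdz_mulr.
  apply: dvdz_mull; apply/dvdzP; exists (- v * (1 + u * y)).
  by have -> : u * y = 1 - v * n by [lia]; ring.
by rewrite Gauss_dvdzr // coprimez_sym coprimezMl yn.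
Qed.

Lemma sqr_mod16 (x : int) :
  [\/ (x %% 8 = 1 \/ x %% 8 = 7)%Z /\ (x * x %% 16 = 1)%Z,
      (x %% 8 = 3 \/ x %% 8 = 5)%Z /\ (x * x %% 16 = 9)%Z,
      (x %% 4 = 0)%Z /\ (x * x %% 16 = 0)%Z
    | (x %% 4 = 2)%Z /\ (x * x %% 16 = 4)%Z].
Proof.
have e := divz_eq x 8; set q := (x %/ 8)%Z in e *.
have : exists r : int, [/\ x = q * 8 + r, 0 <= r & r <= 7].
  by exists (x %% 8)%Z; have := modz_ge0 x (isT : 8 != 0 :> int);
   have := ltz_mod x (isT : 8 != 0 :> int); split; lia.
case=> r [{e}-> r0 r7].
have -> : (q * 8 + r) * (q * 8 + r) = (4 * (q * q) + q * r) * 16 + r * r by ring.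
rewrite modzMDl.
have : r \in [:: 0; 1; 2; 3; 4; 5; 6; 7 : int] by rewrite !inE; lia.
by rewrite !inE => /orP[|/orP[|/orP[|/orP[|/orP[|/orP[|/orP[]]]]]]] /eqP ->;
  [ constructor 3 | constructor 1 | constructor 4 | constructor 2
  | constructor 3 | constructor 2 | constructor 4 | constructor 1 ]; split => //; lia.
Qed.

Lemma odd_absz (x : int) : odd `|x|%N = ((x %% 2)%Z == 1).
Proof. lia. Qed.

Lemma sqr_mod2 (x : int) : exists k : int, x * x = 2 * k + x.
Proof.
have [k [->|->]] : exists k : int, x = 2 * k \/ x = 2 * k + 1.
- by exists (x %/ 2)%Z; lia.
- by exists (2 * (k * k) - k); ring.
- by exists (2 * (k * k) + k); ring.
Qed.

Lemma sqr_mod8 (x : int) :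
  [\/ (x * x %% 8 = 0)%Z, (x * x %% 8 = 1)%Z | (x * x %% 8 = 4)%Z].
Proof.
by case: (sqr_mod16 x) => -[_ h]; [constructor 2 | constructor 2 | constructor 1 | constructor 3]; lia.
Qed.

Lemma odd_mulz (x y : int) : ((x * y) %% 2 = 1)%Z -> (x %% 2 = 1)%Z /\ (y %% 2 = 1)%Z.
Proof.
have [k [->|->]] : exists k : int, x = 2 * k \/ x = 2 * k + 1.
- by exists (x %/ 2)%Z; lia.
- by rewrite -mulrA; lia.
have -> : (2 * k + 1) * y = 2 * (k * y) + y by ring.
lia.
Qed.

Lemma odd_mulz1 (x y : int) : (x %% 2 = 1)%Z -> (y %% 2 = 1)%Z -> ((x * y) %% 2 = 1)%Z.
Proof. by rewrite -modzMm => -> ->. Qed.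

Lemma odd_sqr_mod8 (x : int) : (x %% 2 = 1)%Z -> exists k : int, x * x = 8 * k + 1.
Proof.
move=> h; case: (sqr_mod16 x) => -[h1]; move: (x * x) => y h2; try lia.
  by exists (y %/ 8)%Z; clear -h2; lia.
by exists (y %/ 8)%Z; clear -h2; lia.
Qed.

Lemma sqr_mod16_odd (n : nat) : odd n ->
  (n%:Z * n%:Z %% 16)%Z = if jac 2 n then 9 else 1.
Proof.
move=> on; rewrite jac2 //; have n2 : (n%:Z %% 2 = 1)%Z by lia.
case: (sqr_mod16 n%:Z) => -[h1 ->]; [ | | by clear -n2 h1; lia | by clear -n2 h1; lia].
  by have -> : ((n %% 8 == 1) || (n %% 8 == 7))%N by [clear -h1; lia].
have -> : ((n %% 8 == 1) || (n %% 8 == 7))%N = false by [clear -h1; lia].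
by [].
Qed.

(** To be used with C and D the squares of odd c1 and d1, and s, s' the symbols of 2 over c1 and d1.
    In all cases n1 is 1 or 5 mod 8, so 1 mod 4: the sign of n1 decides the symbol of -1 over
    |n1|. *)
Lemma half_quad_aux (C D x n1 : int) (s s' : bool) :
  (C %% 16)%Z = (if s then 9 else 1) -> (D %% 16)%Z = (if s' then 9 else 1) ->
  C - (16 * x + 7 * D) = 2 * n1 ->
  [/\ odd `|n1|%N, odd `|n1|%N./2 = (n1 < 0) & jac 2 `|n1| = ~~ (s (+) s')].
Proof.
move=> hC hD e.
have : (n1 %% 8 = if s (+) s' then 1 else 5)%Z.
  by move: hC hD; case: s; case: s' => /= hC hD; clear -hC hD e; lia.
clear; case: (s (+) s') => h; have o : odd `|n1| by clear -h; lia.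
  by split=> //; [clear -h; lia | rewrite jac2 //; clear -h; lia].
by split=> //; [clear -h; lia | rewrite jac2 //; clear -h; lia].
Qed.

Lemma parity_aux (c d e f kc kd ke kf x y z w v u : int) :
  (u %% 2 = 1)%Z -> (v %% 2 = 0)%Z ->
  2 * kc + c + (16 * x + 7 * (2 * kd + d)) - 2 * y = v ->
  2 * z - (2 * ke + e) - (16 * w + 7 * (2 * kf + f)) = u ->
  ((c + d) %% 2 = 0)%Z /\ ((e + f) %% 2 = 1)%Z.
Proof. by move=> hu hv h1 h2; split; lia. Qed.

Lemma mod8_mul (g n : int) (m : nat) : m = `|n|%N ->
  ((m %% 8 == 1) || (m %% 8 == 7))%N ->
  ((8 * g + n) %% 8 = 1 \/ (8 * g + n) %% 8 = 7)%Z.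
Proof. by move=> ->; lia. Qed.

Lemma mod8_aux (x y z w v : int) :
  [\/ (x %% 8 = 0)%Z, (x %% 8 = 1)%Z | (x %% 8 = 4)%Z] ->
  [\/ (y %% 8 = 0)%Z, (y %% 8 = 1)%Z | (y %% 8 = 4)%Z] ->
  ((x - (16 * z + 7 * y)) %% 8 = 1 \/ (x - (16 * z + 7 * y)) %% 8 = 7)%Z ->
  8 * w - x - (16 * z + 7 * y) = v -> ~ (v %% 8 = 3 \/ v %% 8 = 5)%Z.
Proof. by case=> hx; case=> hy hxy hv; lia. Qed.

(** * Arithmetic of pi and of the coordinates of eta *)

Section Arith.
Variable p : nat.
Hypotheses (p_prime : prime p) (p_mod : (p %% 16 = 7)%N).

Let p_odd : odd p. Proof. by move: p_mod; lia. Qed.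

Let pE : exists q : int, p%:Z = 16 * q + 7.
Proof. exists (p %/ 16)%N%:Z; move: (divn_eq p 16); lia. Qed.

Section Pi.
Variables a b : int.
Hypothesis ab2 : a * a - p%:Z * (b * b) = 2.

Lemma pi_odd : odd `|a| /\ odd `|b|.
Proof.
have [q pq] := pE; move: ab2; rewrite pq.
have : (16 * q + 7) * (b * b) = 16 * (q * (b * b)) + 7 * (b * b) by ring.
rewrite !odd_absz => ->.
by case: (sqr_mod16 a) => -[? ?]; case: (sqr_mod16 b) => -[? ?]; lia.
Qed.

(** Modulo b, 2 is the square a^2, so b is 1 or -1 mod 8; then a^2 = 2 + 7 b^2 = 9 mod 16. *)
Lemma pi_mod16 : (b * b %% 16 = 1)%Z /\ (a * a %% 16 = 9)%Z.
Proof.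
have [oa ob] := pi_odd.
have d : (`|b|%N%:Z %| a * a - 2)%Z.
  have -> : a * a - 2 = p%:Z * b * b by move: ab2; lia.
  by apply: dvdz_mull; rewrite dvdzE.
have an := coprimez_dvd2 ob d.
have : jac 2 `|b| = false.
  apply: (@jac_eq0 _ _ 1 a) => //.
  by rewrite -opprB dvdzE abszN.
rewrite jac2 // => /negbFE hb.
have [q pq] := pE; move: ab2; rewrite pq.
have -> : (16 * q + 7) * (b * b) = 16 * (q * (b * b)) + 7 * (b * b) by ring.
move=> h; have b16 : (b * b %% 16)%Z = 1.
  case: (sqr_mod16 b) => -[h1 ->] //; clear -h1 hb; lia.
by split=> //; move: (a * a) (b * b) (q * (b * b)) h b16 => x y z; clear; lia.
Qed.

(** Modulo a, - p b^2 is 2, so (-p / a) = (2 / a) = -1, because a is 3 or -3 mod 8. Since p = 3 mod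
    4, reciprocity reads (a / p) = (-p / a). *)
Lemma jac_pi : 0 < a -> jac a p = true.
Proof.
move=> a0; have [oa ob] := pi_odd; have [bb aa] := pi_mod16.
case: a a0 oa aa ab2 => // m m0 om mm e.
rewrite /= in om.
have c2 : coprime m p.
  rewrite coprime_sym prime_coprime //; apply/negP => /dvdnP[k mk].
  have : (p%:Z %| 2)%Z.
    apply/dvdzP; exists (k%:Z * m%:Z - b * b).
    apply: etrans (esym e) _; rewrite {1}mk PoszM; ring.
  by rewrite dvdzE /= => /dvdn_leq; move: p_mod; lia.
have := jac_reciprocity om p_odd c2.
have : jac (- p%:Z) m = jac 2 m.
  have cb : coprimez b m.
    apply: (@coprimez_dvd2 _ _ (- p%:Z * b)) => //.
    by apply/dvdzP; exists (- m%:Z); rewrite -e; ring.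
  have cp : coprimez p%:Z m by rewrite coprimez_sym.
  have <- : jac (- p%:Z * (b * b)) m = jac (- p%:Z) m.
    by rewrite jacM ?jac_sqr ?addbF // ?coprimezMl ?cb // coprimezE abszN.
  by apply: jac_mod; apply/dvdzP; exists (- m%:Z); rewrite -e; ring.
rewrite jac_opp //; last by rewrite coprimez_sym.
rewrite jac2 //.
have : (m %% 8 = 3)%N \/ (m %% 8 = 5)%N.
  by case: (sqr_mod16 m) => -[? ?]; lia.
have : odd p./2 by move: p_mod; lia.
move=> op2 h; have -> : ~~ ((m %% 8 == 1) || (m %% 8 == 7))%N by lia.
rewrite op2 andbT => e1 e2; move: e1 e2.
by case: (odd m./2); case: (jac p m); case: (jac m p).
Qed.

Section Trace.
Variables c d e f : int.
(* With s = sqrt p, the coordinates of the equation N(eta) = eps for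
   eta = (c + d s) + (e + f s) r. *)
Hypothesis E1 : c * c + p%:Z * (d * d) - 2 * (p%:Z * (e * f)) = a * a - 1.
Hypothesis E2 : 2 * (c * d) - e * e - p%:Z * (f * f) = a * b.

Lemma parity_cdef : ((c + d) %% 2 = 0)%Z /\ ((e + f) %% 2 = 1)%Z.
Proof.
have [q pq] := pE; have [bb aa] := pi_mod16; have [oa ob] := pi_odd.
have hab : ((a * b) %% 2 = 1)%Z by apply: odd_mulz1; lia.
move: E1 E2; rewrite pq.
have -> : (16 * q + 7) * (d * d) = 16 * (q * (d * d)) + 7 * (d * d) by ring.
have -> : (16 * q + 7) * (f * f) = 16 * (q * (f * f)) + 7 * (f * f) by ring.
have [kc ->] := sqr_mod2 c; have [kd ->] := sqr_mod2 d.
have [ke ->] := sqr_mod2 e; have [kf ->] := sqr_mod2 f.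
move=> h1 h2; apply: (parity_aux hab _ h1 h2).
by move: (a * a) aa => x; clear; lia.
Qed.

Lemma gcdz_split (x y : int) : (x != 0) || (y != 0) ->
  exists g : nat, exists x1 y1, [/\ (0 < g)%N, x = g%:Z * x1, y = g%:Z * y1 & coprimez x1 y1].
Proof.
move=> xy; have g0 : gcdz x y != 0 by rewrite gcdz_eq0 negb_and.
exists `|gcdz x y|%N, (x %/ gcdz x y)%Z, (y %/ gcdz x y)%Z.
have gE : `|gcdz x y|%N%:Z = gcdz x y by rewrite gez0_abs.
rewrite gE; split.
- by rewrite absz_gt0.
- by rewrite mulrC divzK // dvdz_gcdl.
- by rewrite mulrC divzK // dvdz_gcdr.
rewrite /coprimez -(inj_eq (mulfI g0)) mulr1 -{1}gE.
rewrite -[X in X * _]/(`|gcdz x y|%N%:Z) -{1}gE mulz_gcdr gE.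
by rewrite ![gcdz x y * _]mulrC !divzK ?dvdz_gcdl ?dvdz_gcdr.
Qed.

(** The equation 2 A^2 - pi^2 = 2 s B^2 with t in place of s. The correction is a multiple of t^2 -
    p, so the equation survives modulo every n for which t is a square root of p. *)
Lemma quad_eval t : 2 * ((c + d * t) * (c + d * t)) - (a + b * t) * (a + b * t)
  = (t * t - p%:Z) * (2 * (d * d) - b * b - 4 * (e * f) - 2 * (f * f) * t)
    + 2 * t * ((e + f * t) * (e + f * t)).
Proof.
have E2t : t * (2 * (c * d) - e * e - p%:Z * (f * f)) = t * (a * b) by rewrite E2.
have := E1; have := ab2; lia.
Qed.

Lemma pi_eval_coprime (n : nat) (t : int) : odd n -> (n%:Z %| t * t - p%:Z)%Z ->
  coprimez (a + b * t) n.
Proof.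
move=> on tp; apply: (@coprimez_dvd2 _ _ (a - b * t)) => //.
have -> : (a + b * t) * (a - b * t) - 2 = (t * t - p%:Z) * (- (b * b)) by move: ab2; lia.
exact: dvdz_mulr.
Qed.

(** Write B = g B1 with the coordinates of B1 coprime, and let n be the absolute norm of B1. The
    morphism to Z/n that kills B1 leaves 2 A^2 = pi^2 with pi invertible, so (2 / n) = 1. The factor
    g^2 is 1 mod 8. *)
Lemma normB_mod8 : let n := e * e - p%:Z * (f * f) in (n %% 8 = 1 \/ n %% 8 = 7)%Z.
Proof.
have [_ ef] := parity_cdef.
have ef0 : (e != 0) || (f != 0) by lia.
have [g [e1 [f1 [g0 eE fE cop]]]] := gcdz_split ef0.
pose n1 := e1 * e1 - p%:Z * (f1 * f1); pose n := `|n1|%N.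
have E : e * e - p%:Z * (f * f) = g%:Z * g%:Z * n1 by rewrite eE fE /n1; ring.
have [q pq] := pE.
have oE : ((g%:Z * g%:Z * n1) %% 2 = 1)%Z.
  rewrite -E pq.
  have -> : (16 * q + 7) * (f * f) = 16 * (q * (f * f)) + 7 * (f * f) by ring.
  by case: (sqr_mod16 e) => -[? ?]; case: (sqr_mod16 f) => -[? ?]; lia.
have [/odd_mulz[og _] on1] := odd_mulz oE.
have on : odd n by rewrite /n odd_absz on1.
have dn : (n%:Z %| n1)%Z by rewrite dvdzE.
have [t te tp] := quad_root cop dn.
have j2 : jac 2 n = false.
  apply: (@jac_eq0 _ _ (c + d * t) (a + b * t)) => //; first exact: pi_eval_coprime.
  rewrite quad_eval; apply: rpredD; first exact: dvdz_mulr.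
  apply: dvdz_mull; apply: dvdz_mull.
  have -> : e + f * t = g%:Z * (e1 + f1 * t) by rewrite eE fE; ring.
  exact: dvdz_mull.
move: j2; rewrite jac2 // => /negbFE j2 /=; rewrite E.
have [k ->] : exists k, g%:Z * g%:Z = 8 * k + 1.
  exact: odd_sqr_mod8.
have -> : (8 * k + 1) * n1 = 8 * (k * n1) + n1 by ring.
exact: (mod8_mul _ (erefl n) j2).
Qed.

(** If c and d were even, 2 c d would vanish mod 8 and [E2] would make e^2 + p f^2 equal to - a b,
    which is 3 or -3 mod 8. But e^2 - p f^2 is 1 or -1 mod 8, so the even one of e and f is
    divisible by 4, and e^2 + p f^2 is 1 or -1 as well. *)
Lemma cd_odd : (c %% 2 = 1)%Z /\ (d %% 2 = 1)%Z.
Proof.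
have [cd ef] := parity_cdef; have n8 := normB_mod8.
have [q pq] := pE; have [bb aa] := pi_mod16.
case: (boolP ((c %% 2)%Z == 1)) => [|c0]; first lia.
have [c1 cE] : exists k, c = 2 * k by exists (c %/ 2)%Z; lia.
have [d1 dE] : exists k, d = 2 * k by exists (d %/ 2)%Z; lia.
exfalso; move: n8 E2; rewrite /= pq cE dE.
have -> : (16 * q + 7) * (f * f) = 16 * (q * (f * f)) + 7 * (f * f) by ring.
have -> : 2 * (2 * c1 * (2 * d1)) = 8 * (c1 * d1) by ring.
have : (a * b %% 8 = 3 \/ a * b %% 8 = 5)%Z.
  have ha : (a %% 8 = 3 \/ a %% 8 = 5)%Z by case: (sqr_mod16 a) => -[? ?]; lia.
  have hb : (b %% 8 = 1 \/ b %% 8 = 7)%Z by case: (sqr_mod16 b) => -[? ?]; lia.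
  by rewrite -modzMm; case: hb => ->; case: ha => ->; [left|right|right|left].
by move=> hab n8 h; apply: (mod8_aux (sqr_mod8 e) (sqr_mod8 f) n8 h).
Qed.

Lemma c_sqr_mod_p : (p%:Z %| c * c - 1)%Z.
Proof.
apply/dvdzP; exists (b * b - d * d + 2 * (e * f)).
by move: E1 ab2; lia.
Qed.

Lemma jac_c : 0 < c -> 0 < d -> jac c p = true.
Proof.
move=> c0 d0; have [oc od] := cd_odd.
have cd0 : (c != 0) || (d != 0) by lia.
have [g [c1 [d1 [g0 cE dE cop]]]] := gcdz_split cd0.
have c10 : 0 < c1 by rewrite cE in c0; rewrite -(pmulr_rgt0 _ (_ : 0 < g%:Z)).
have d10 : 0 < d1 by rewrite dE in d0; rewrite -(pmulr_rgt0 _ (_ : 0 < g%:Z)).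
case: c1 c10 cE cop => // c1 c10 cE cop.
case: d1 d10 dE cop => // d1 d10 dE cop.
have [og oc1] : odd g /\ odd c1 by move: oc; rewrite cE => /odd_mulz; lia.
have od1 : odd d1 by move: od; rewrite dE => /odd_mulz; lia.
have [q pq] := pE.
have ccp : coprimez c p.
  apply: (@coprimez_bezout _ _ c (- (b * b - d * d + 2 * (e * f)))).
  by move: E1 ab2; lia.
have /andP[gp c1p] : coprimez g%:Z p && coprimez c1%:Z p by rewrite -coprimezMl -cE.
(* Modulo g, which divides A, N(eta) is - s B^2. Its norm to Q is 1, so 1 = - p (e^2 - p f^2)^2 mod
   g and (-p / g) = 1; reciprocity turns this into (g / p) = 1. *)
have jgp : jac g%:Z p = false.
  have : jac (- p%:Z) g = false.
    apply: (@jac_eq0 _ _ (e * e - p%:Z * (f * f)) 1) => //; first exact: coprime1n.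
    apply/dvdzP.
    pose X := c * c + p%:Z * (d * d) - 2 * (p%:Z * (e * f)).
    pose Y := 2 * (c * d) - e * e - p%:Z * (f * f).
    have XY : X * X - p%:Z * (Y * Y) = 1.
      rewrite /X /Y E1 E2.
      have -> : (a * a - 1) * (a * a - 1) - p%:Z * (a * b * (a * b)) =
        a * a * (a * a - p%:Z * (b * b)) - 2 * (a * a) + 1 by ring.
      by rewrite ab2; ring.
    exists (- ((c1%:Z * c + p%:Z * (d1%:Z * d)) * (X - 2 * (p%:Z * (e * f)))
        - p%:Z * (2 * (c1%:Z * d)) * (Y - e * e - p%:Z * (f * f)))).
    rewrite -{1}XY /X /Y cE dE; ring.
  have gp' : coprime g p by [].
  have pg : coprimez p%:Z g by rewrite coprimez_sym.
  rewrite jac_opp // => h; have := jac_reciprocity og p_odd gp'.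
  have -> : odd p./2 by move: p_mod; lia.
  by move: h; case: odd; case: (jac p g); case: (jac g p).
(* The norm of A / g is even, but half of it is odd and can serve as a modulus. *)
have [n1 n1E] : exists n1, c1%:Z * c1%:Z - p%:Z * (d1%:Z * d1%:Z) = 2 * n1.
  have [k1 ->] : exists k, c1%:Z * c1%:Z = 8 * k + 1 by apply: odd_sqr_mod8; clear -oc1; lia.
  have [k2 ->] : exists k, d1%:Z * d1%:Z = 8 * k + 1 by apply: odd_sqr_mod8; clear -od1; lia.
  by exists (4 * k1 - 4 * p%:Z * k2 - 8 * q - 3); rewrite pq; ring.
pose n := `|n1|%N.
have [on on2 n8] : [/\ odd n, odd n./2 = (n1 < 0) & jac 2 n = ~~ (jac 2 c1 (+) jac 2 d1)].
  move: n1E; rewrite pq.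
  have -> : (16 * q + 7) * (d1%:Z * d1%:Z) = 16 * (q * (d1%:Z * d1%:Z)) + 7 * (d1%:Z * d1%:Z) by ring.
  exact: half_quad_aux (sqr_mod16_odd oc1) (sqr_mod16_odd od1).
have dn : (n%:Z %| c1%:Z * c1%:Z - p%:Z * (d1%:Z * d1%:Z))%Z.
  by rewrite n1E; apply: dvdz_mull; rewrite dvdzE.
have d1n := coprimez_quad cop dn.
have cop' : coprimez (p%:Z * (d1%:Z * d1%:Z)) c1.
  by rewrite coprimezMl [coprimez p _]coprimez_sym c1p coprimezMl coprimez_sym cop.
have c1n : coprimez c1%:Z n.
  case/dvdzP: dn => k hk; case/coprimezP: cop' => -[u v] /= uv.
  apply: (@coprimez_bezout _ _ (v + u * c1%:Z) (- u * k)).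
  rewrite -uv; have -> : p%:Z * (d1%:Z * d1%:Z) = c1%:Z * c1%:Z - k * n%:Z by lia.
  ring.
have [t tc tp] := quad_root cop dn.
(* The morphism s |-> t kills A mod n and leaves - 2 t B^2 = pi^2. Multiplied by d1^2, with d1 t = -
   c1, this is 2 c1 d1 B^2 = (d1 pi)^2. *)
have j0 : jac (2 * (c1%:Z * d1%:Z)) n = false.
  apply: (@jac_eq0 _ _ (e + f * t) (d1%:Z * (a + b * t))) => //.
    by rewrite coprimezMl d1n pi_eval_coprime.
  have -> : 2 * (c1%:Z * d1%:Z) * ((e + f * t) * (e + f * t)) -
     d1%:Z * (a + b * t) * (d1%:Z * (a + b * t)) =
     (c1%:Z + d1%:Z * t) * (2 * d1%:Z * ((e + f * t) * (e + f * t)) - d1%:Z * d1%:Z * 2 * g%:Z * (c + d * t))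
     + d1%:Z * d1%:Z * ((t * t - p%:Z) * (2 * (d * d) - b * b - 4 * (e * f) - 2 * (f * f) * t)).
    have -> : d1%:Z * (a + b * t) * (d1%:Z * (a + b * t)) =
      d1%:Z * d1%:Z * (2 * ((c + d * t) * (c + d * t)) - ((t * t - p%:Z) * (2 * (d * d) - b * b - 4 * (e * f) - 2 * (f * f) * t)
    + 2 * t * ((e + f * t) * (e + f * t)))).
      by rewrite -quad_eval; ring.
    rewrite cE dE; ring.
  by apply: rpredD; [apply: dvdz_mulr | apply: dvdz_mull; apply: dvdz_mulr].
have c2 m : odd m -> coprimez 2 m by move=> om; rewrite coprimezE /= coprime2n.
have rc : coprime c1 n by []; have rd : coprime d1 n by [].
have nc1 : coprimez n%:Z c1 by rewrite coprimez_sym.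
have nd1 : coprimez n%:Z d1 by rewrite coprimez_sym.
have pc1 : coprimez p%:Z c1 by rewrite coprimez_sym.
have d1c1 : coprimez d1%:Z c1 by rewrite coprimez_sym.
have jcp : jac c p = jac c1 p by rewrite cE jacM // jgp.
have op2 : odd p./2 by move: p_mod; clear; lia.
(* 2 n1 is - p d1^2 mod c1 and c1^2 mod d1; this evaluates 2 n over c1 here and over d1 next, with a
   correction for the sign of n1. *)
have jcd : jac 2 c1 (+) jac n c1 = odd c1./2 && (0 <= n1) (+) jac p c1.
  rewrite -jacM ?c2 //.
  have -> : jac p c1 = jac (p%:Z * (d1%:Z * d1%:Z)) c1.
    by rewrite jacM ?coprimezMl ?d1c1 // jac_sqr ?addbF.
  case: (lerP 0 n1) => h; rewrite ?andbT ?andbF.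
    rewrite -jac_opp //; apply: jac_mod; rewrite /n gez0_abs // -n1E.
    by apply/dvdzP; exists c1%:Z; ring.
  rewrite addFb; apply: jac_mod; rewrite /n ltz0_abs // mulrN -n1E.
  by apply/dvdzP; exists (- c1%:Z); ring.
have jdd : jac 2 d1 (+) jac n d1 = odd d1./2 && (n1 < 0).
  rewrite -jacM ?c2 // -[RHS]addbF -(jac_sqr od1 (_ : coprimez c1%:Z d1)) //.
  case: (lerP 0 n1) => h; rewrite ?andbT ?andbF.
    rewrite addFb; apply: jac_mod; rewrite /n gez0_abs // -n1E.
    by apply/dvdzP; exists (- (p%:Z * d1%:Z)); ring.
  rewrite -jac_opp //; last by rewrite coprimezMl cop.
  apply: jac_mod; rewrite /n ltz0_abs // mulrN -n1E.
  by apply/dvdzP; exists (p%:Z * d1%:Z); ring.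
(* Reciprocity for (c1, n), (d1, n) and (c1, p) closes the system; what remains is a Boolean
   check. *)
move: j0; rewrite jacM ?coprimezMl ?c1n ?c2 // jacM // n8 jcp.
move: (jac_reciprocity oc1 on rc) (jac_reciprocity od1 on rd) (jac_reciprocity oc1 p_odd c1p) jcd jdd.
rewrite op2 on2 ltNge; case: (0 <= n1); case: (jac 2 c1); case: (jac 2 d1); rewrite /= ?andbT ?andbF;
case: (odd c1./2); case: (odd d1./2); case: (jac c1 n); case: (jac n c1);
case: (jac d1 n); case: (jac n d1); case: (jac p c1); by case: (jac c1 p).
Qed.

End Trace.
End Pi.
End Arith.

(** * Units of relative norm 1 *)

Section SquarePart.
Local Open Scope nat_scope.

Lemma muln_sqr_lt l n k : 1 < l -> 0 < n -> l * l * n < k.+1 -> n < k.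
Proof.
move=> l1 n0 h; have : 2 * n <= l * l * n by rewrite leq_mul2r; nia.
by lia.
Qed.

(** The last clause lets the primes of the squarefree part be located from the parity of valuations
    of n. *)
Lemma sqfree_part n : 0 < n -> exists s m, [/\ n = s * (m * m), 0 < m,
  forall l, prime l -> ~~ (l * l %| s) & forall l, prime l -> l %| s -> odd (logn l n)].
Proof.
have [k] := ubnP n; elim: k n => // k IH n nk n0.
have [/hasP[l _ /andP[pl /dvdnP[q nq]]]|h] := boolP (has (fun l => prime l && (l * l %| n)) (iota 0 n.+1)).
  have l1 := prime_gt1 pl.
  have q0 : 0 < q by case: q nq => // nq; rewrite nq in n0.
  have [|//|s [m [qs m0 sf od]]] := IH q;
    first by rewrite -ltnS (leq_trans _ nk) // ltnS nq ltn_Pmulr //; clear -l1; nia.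
  exists s, (m * l); split => //; [by rewrite nq {1}qs; ring | by nia |].
  move=> l' pl' /(od _ pl'); rewrite nq !lognM ?muln_gt0 ?q0 ?prime_gt0 //.
  by rewrite addnn oddD odd_double addbF.
have sf l : prime l -> ~~ (l * l %| n).
  move=> pl; apply: contra h => d; apply/hasP; exists l; last by rewrite pl.
  rewrite mem_iota /= ltnS; have := dvdn_leq n0 d; have := prime_gt1 pl; nia.
exists n, 1; split => // [|l pl d]; first by rewrite !muln1.
have : 1 <= logn l n by rewrite -pfactor_dvdn // expn1.
have : ~~ (2 <= logn l n) by rewrite -pfactor_dvdn // sf.
by case: (logn l n) => [|[|]].
Qed.

Lemma sqfree_in1 q s : 0 < s -> prime q -> (forall l, prime l -> ~~ (l * l %| s)) ->
  (forall l, prime l -> l %| s -> l = q) -> s = 1 \/ s = q.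
Proof.
move=> s0 pq sf h; case: (ltngtP s 1) => [||->]; [lia | move=> s1 | by left].
right; have := h _ (pdiv_prime s1) (pdiv_dvd s) => e.
have /dvdnP[k sk] : q %| s by rewrite -e pdiv_dvd.
case: (ltngtP k 1) => k1; [lia | | by rewrite sk k1 mul1n].
have := sf q pq; rewrite sk dvdn_pmul2r ?prime_gt0 //.
have := h _ (pdiv_prime k1) => <- //; first by rewrite pdiv_dvd.
by rewrite sk dvdn_mulr // pdiv_dvd.
Qed.

Lemma sqfree_in2 q s : 0 < s -> prime q -> (forall l, prime l -> ~~ (l * l %| s)) ->
  (forall l, prime l -> l %| s -> l = 2 \/ l = q) -> s \in [:: 1; 2; q; 2 * q].
Proof.
move=> s0 pq sf h; have [/dvdnP[k sk]|s2] := boolP (2 %| s).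
  have : k = 1 \/ k = q.
    apply: sqfree_in1 => //; first by lia.
      by move=> l pl; apply: contra (sf l pl) => d; rewrite sk dvdn_mulr.
    move=> l pl d; have [|e|//] := h _ pl; first by rewrite sk dvdn_mulr.
    by have := sf 2 isT; rewrite sk dvdn_pmul2r // -e d.
  by rewrite !inE sk mulnC => -[->|->]; rewrite eqxx ?orbT.
have : s = 1 \/ s = q.
  apply: sqfree_in1 => // l pl d; have [e|//] := h _ pl d.
  by rewrite -e d in s2.
by rewrite !inE => -[->|->]; rewrite eqxx ?orbT.
Qed.

Lemma coprime_prime_sq q X Y y : prime q -> 0 < y -> coprime X Y ->
  X * Y = q * (y * y) -> exists2 m, 0 < m & X = m * m \/ X = q * (m * m).
Proof.
move=> pq y0 XY e; have e0 : 0 < X * Y by rewrite e !muln_gt0 prime_gt0 // y0.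
have /andP[X0 Y0] : (0 < X) && (0 < Y) by rewrite -muln_gt0.
have [s [m [Xs m0 sf od]]] := sqfree_part X0.
have s0 : 0 < s by case: s Xs {sf od} => // Xs; rewrite Xs in X0.
exists m => //; have : s = 1 \/ s = q.
  apply: sqfree_in1 => // l pl d; have := od l pl d.
  have lX : l %| X by rewrite Xs dvdn_mulr.
  have lY : logn l Y = 0.
    apply: logn_coprime; rewrite prime_coprime //; apply/negP => lY.
    have : l %| gcdn X Y by rewrite dvdn_gcd lX.
    by rewrite (eqP XY) => /dvdn_leq; have := prime_gt1 pl; lia.
  have := congr1 (logn l) e; rewrite lognM // lY addn0 => ->.
  rewrite !lognM ?muln_gt0 ?y0 ?prime_gt0 //.
  by rewrite oddD addnn odd_double addbF logn_prime //; case: eqP.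
by case=> es; [left | right]; rewrite {1}Xs es ?mul1n.
Qed.

End SquarePart.

(** * Valuations of norms from Q(sqrt p) *)

Section Valuation.
Variable l : nat.
Hypothesis l_prime : prime l.
(** At 0 the value is 0 rather than infinity, hence the nonvanishing hypotheses below. *)
Definition valz (x : int) : nat := logn l `|x|%N.
Local Notation v := valz.

Let l_gt1 : (1 < l)%N := prime_gt1 l_prime.

Lemma dvdz_pow_val (k : nat) (x : int) : x != 0 ->
  ((l ^ k)%N%:Z %| x)%Z = (k <= v x)%N.
Proof. by move=> x0; rewrite /valz dvdzE /= pfactor_dvdn // absz_gt0. Qed.

Lemma val_congr (k : nat) (x y : int) : ((l ^ k)%N%:Z %| x - y)%Z -> x != 0 ->
  (v x < k)%N -> y != 0 /\ v y = v x.
Proof.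
move=> d x0 vk; have hk j : (j <= k)%N -> ((l ^ j)%N%:Z %| x)%Z = ((l ^ j)%N%:Z %| y)%Z.
  move=> jk; have dj : ((l ^ j)%N%:Z %| x - y)%Z.
    by apply: dvdz_trans d; rewrite dvdzE /= dvdn_exp2l.
  by rewrite -{1}[x](subrK y) rpredDl.
have y0 : y != 0.
  apply: contraTneq vk => y0; rewrite -leqNgt -dvdz_pow_val // hk // y0.
  exact: dvdz0.
split=> //; apply/eqP; rewrite eqn_leq -!dvdz_pow_val // -hk ?(ltnW vk) //.
rewrite [X in _ && X]dvdz_pow_val // leqnn andbT dvdz_pow_val //.
rewrite leqNgt; apply/negP => h.
by have := hk (v x).+1 vk; rewrite !dvdz_pow_val // ltnn h.
Qed.

Lemma val_mul (x y : int) : x != 0 -> y != 0 -> v (x * y) = (v x + v y)%N.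
Proof. by move=> x0 y0; rewrite /valz abszM lognM ?absz_gt0. Qed.

Lemma val0 (x : int) : ~~ (l%:Z %| x)%Z -> v x = 0%N.
Proof. by rewrite dvdzE /valz => h; apply: logn_coprime; rewrite prime_coprime. Qed.

Lemma Euclid_dvdz (x y : int) : (l%:Z %| x * y)%Z = (l%:Z %| x)%Z || (l%:Z %| y)%Z.
Proof. by rewrite !dvdzE abszM Euclid_dvdM. Qed.

Lemma prime_coprimez (x : int) : coprimez x l = ~~ (l%:Z %| x)%Z.
Proof. by rewrite coprimez_sym coprimezE prime_coprime // dvdzE. Qed.

(** Newton's step t - (t^2 - p) / (2 t). An inverse of 2 t modulo l alone is enough, since only one
    more power of l is gained at a time. *)
Lemma hensel_sqrt (p t0 : int) (k : nat) : ~~ (l%:Z %| 2 * t0)%Z ->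
  (l%:Z %| t0 * t0 - p)%Z ->
  exists2 t, ~~ (l%:Z %| 2 * t)%Z & ((l ^ k.+1)%N%:Z %| t * t - p)%Z.
Proof.
move=> h0 d0; elim: k => [|k [t ht]]; first by exists t0; rewrite ?expn1.
case/dvdzP => m hm; have := ht; rewrite -prime_coprimez => /coprimezP[[u w]] /= uw.
set q := ((l ^ k.+1)%N)%:Z in hm.
exists (t - m * q * u).
  have lq : (l%:Z %| q)%Z by rewrite /q expnS PoszM dvdz_mulr.
  have -> : 2 * (t - m * q * u) = 2 * t + q * (- 2 * m * u) by ring.
  by rewrite rpredDr // dvdz_mulr.
have -> : (t - m * q * u) * (t - m * q * u) - p = t * t - p - m * q * (u * (2 * t)) + q * q * (m * m * u * u) by ring.
have qE : ((l ^ k.+2)%N)%:Z = l%:Z * q by rewrite /q expnS PoszM.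
have lq : (l%:Z %| q)%Z by rewrite /q expnS PoszM dvdz_mulr.
rewrite hm qE; have -> : u * (2 * t) = 1 - w * l%:Z by apply: (addIr (w * l%:Z)); rewrite uw subrK.
apply: rpredD.
  by apply/dvdzP; exists (m * w); ring.
by apply: dvdz_mulr; apply: dvdz_mul.
Qed.

(** If l divides x^2 - p y^2 it divides y, as otherwise x / y would be a square root of p mod l.
    Then it divides x too, and l^2 can be divided out: a descent on the size of the norm. *)
Lemma val_nonsplit (p x y : int) : (forall t, ~~ (l%:Z %| t * t - p)%Z) ->
  ~~ odd (v (x * x - p * (y * y))).
Proof.
move=> ns; have [k] := ubnP `|(x * x - p * (y * y))%R|%N.
elim: k x y => // k IH x y; set N := x * x - p * (y * y) => Nk.
have [->|N0] := eqVneq N 0; first by rewrite /valz logn0.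
have [d|/val0 -> //] := boolP (l%:Z %| N)%Z.
have ly : (l%:Z %| y)%Z.
  apply/negPn/negP; rewrite -prime_coprimez => /coprimezP[[u w]] /= uw.
  have := ns (x * u); rewrite (_ : _ - p = u * u * N + p * (1 + u * y) * (- w) * l%:Z).
    by rewrite rpredD // ?dvdz_mull.
  have -> : p * (1 + u * y) * - w * l%:Z = p * (1 + u * y) * (u * y - (u * y + w * l%:Z)) by ring.
  by rewrite uw /N; ring.
have lx : (l%:Z %| x)%Z.
  have : (l%:Z %| x * x)%Z.
    have -> : x * x = N + p * y * y by rewrite /N; ring.
    by rewrite rpredD // dvdz_mull.
  by rewrite Euclid_dvdz orbb.
case/dvdzP: lx => x1 xE; case/dvdzP: ly => y1 yE.
have NE : N = l%:Z * l%:Z * (x1 * x1 - p * (y1 * y1)) by rewrite /N xE yE; ring.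
have N1 : x1 * x1 - p * (y1 * y1) != 0 by apply: contraNneq N0 => h; rewrite NE h mulr0.
have l0 : l%:Z != 0 by rewrite -lt0n; lia.
rewrite NE !val_mul ?mulf_neq0 // oddD addnn odd_double addFb; apply: IH.
move: Nk N1; rewrite NE !abszM /= -absz_gt0.
by move=> Nk N1; apply: (muln_sqr_lt l_gt1 N1 Nk).
Qed.

End Valuation.

(** * The Pell equation and the norm of 1 + Tr(u) / 2 *)

Section Arith2.
Variable p : nat.
Hypotheses (p_prime : prime p) (p_mod : (p %% 16 = 7)%N).

Let p_odd : odd p. Proof. by move: p_mod; lia. Qed.
Let p_gt0 : 0 < p%:Z. Proof. by move: p_mod; lia. Qed.

(** -1 and -2 are nonresidues mod p, so p divides y and m, then k, and everything can be divided by
    p: infinite descent on |m|. *)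
Lemma no_neg_sqr (s : nat) (m k y : int) : (s == 1)%N || (s == 2)%N ->
  p%:Z * (k * k) = y * y + s%:Z * (m * m) -> m = 0.
Proof.
move=> hs; have js : jac (- s%:Z) p = true.
  have c : coprimez s%:Z p.
    by case/orP: hs => /eqP ->; rewrite coprimezE /= ?coprime1n ?coprime2n.
  rewrite jac_opp //; have -> : odd p./2 by move: p_mod; clear; lia.
  case/orP: hs => /eqP ->; rewrite ?jac1 // jac2 //; move: p_mod; clear; lia.
have ps : ~~ (p%:Z %| s%:Z)%Z.
  by rewrite dvdzE /=; apply/negP => /dvdn_leq; case/orP: hs => /eqP ->; move: p_mod; clear; lia.
have dvd x z : (p%:Z %| x * x + s%:Z * (z * z))%Z -> (p%:Z %| x)%Z && (p%:Z %| z)%Z.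
  move=> d; have px : (p%:Z %| x)%Z.
    apply/negPn/negP; rewrite -prime_coprimez // => xp.
    have := @jac_eq0 p (- s%:Z) z x p_odd xp; rewrite js => h.
    have /h // : (p%:Z %| - s%:Z * (z * z) - x * x)%Z.
    by rewrite mulNr -opprD dvdzE abszN addrC -dvdzE.
  have : (p%:Z %| s%:Z * (z * z))%Z.
    have -> : s%:Z * (z * z) = x * x + s%:Z * (z * z) - x * x by ring.
    by rewrite rpredB // dvdz_mulr.
  by rewrite !Euclid_dvdz // orbb (negbTE ps) px.
have [n] := ubnP `|m|%N; elim: n m k y => // n IH m k y mn e.
have /andP[/dvdzP[y1 yE] /dvdzP[m1 mE]] : (p%:Z %| y)%Z && (p%:Z %| m)%Z.
  by apply: dvd; rewrite -e dvdz_mulr.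
have p0 : p%:Z != 0 by rewrite gt_eqF.
have e1 : k * k = p%:Z * (y1 * y1 + s%:Z * (m1 * m1)).
  by apply: (mulfI p0); rewrite e yE mE; ring.
have : (p%:Z %| k * k)%Z by rewrite e1 dvdz_mulr.
rewrite Euclid_dvdz // orbb => /dvdzP[k1 kE].
have e2 : p%:Z * (k1 * k1) = y1 * y1 + s%:Z * (m1 * m1).
  by apply: (mulfI p0); rewrite -e1 kE; ring.
have [m0|m0] := eqVneq m1 0; first by rewrite mE m0 mul0r.
suff h : m1 = 0 by rewrite h eqxx in m0.
apply: (IH m1 k1 y1 _ e2).
rewrite -absz_gt0 in m0; apply: leq_trans (_ : `|m| <= _)%N; last by rewrite -ltnS.
by rewrite mE abszM /= ltn_Pmulr // prime_gt1.
Qed.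

(** The second alternative says that x + y s is the square of m + n s. For x even, x + 1 and x - 1
    are coprime with product p y^2; for x odd, the same holds for their halves, with y / 2. One
    factor is a square and the other p times a square; the wrong distributions fail mod 8, by size,
    or because p would divide the difference. *)
Lemma pell_factor (x y : nat) : (0 < y)%N -> (x * x = p * (y * y) + 1)%N ->
  (exists a b : nat, [/\ (0 < a)%N, (0 < b)%N, (a * a = p * (b * b) + 2)%N, (x.+1 = a * a)%N & y = (a * b)%N]) \/
  (exists m n : nat, [/\ (0 < n)%N, (m * m = p * (n * n) + 1)%N, x = (m * m + p * (n * n))%N & y = (2 * (m * n))%N]).
Proof.
move=> y0 e; have [q pq] : exists q, p = (16 * q + 7)%N.
  by exists (p %/ 16)%N; move: (divn_eq p 16); rewrite p_mod mulnC.
have sq8 (z : nat) : exists k, [\/ z * z = 8 * k, z * z = 8 * k + 1 | z * z = 8 * k + 4]%N.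
  have [k [->|->|->|->]] : exists k, [\/ z = 4 * k, z = 4 * k + 1, z = 4 * k + 2 | z = 4 * k + 3]%N.
  - exists (z %/ 4)%N; have : (z %% 4 < 4)%N by rewrite ltn_pmod.
    have := divn_eq z 4; move: (z %% 4)%N (z %/ 4)%N => [|[|[|[|//]]]] w zw _;
    [constructor 1|constructor 2|constructor 3|constructor 4]; lia.
  - by exists (2 * (k * k))%N; constructor 1; ring.
  - by exists (2 * (k * k) + k)%N; constructor 2; ring.
  - by exists (2 * (k * k) + 2 * k)%N; constructor 3; ring.
  - by exists (2 * (k * k) + 3 * k + 1)%N; constructor 2; ring.
have x1 : (1 < x)%N by nia.
have [ox|ex] := boolP (odd x); last first.
  left.
  have fac : (x.+1 * x.-1 = p * (y * y))%N by rewrite -{1}(prednK (ltnW x1)); nia.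
  have cop : coprime x.+1 x.-1.
    apply: (@coprimez_bezout x.+1%:Z x.-1%:Z (- (x.-1)./2%:Z) ((x.-1)./2.+1%:Z)).
    have := odd_double_half x.-1.
    have -> : odd x.-1 by lia.
    have : x.-1.+1 = x by lia.
    move: (x.-1./2) => h; lia.
  have [m m0 hm] := coprime_prime_sq p_prime y0 cop fac.
  have fac' : (x.-1 * x.+1 = p * (y * y))%N by rewrite mulnC.
  have [n n0 hn] : exists2 m, (0 < m)%N & (x.-1 = m * m \/ x.-1 = p * (m * m))%N.
    by apply: coprime_prime_sq p_prime y0 _ fac'; rewrite coprime_sym.
  have [k1 hk1] := sq8 m; have [k2 hk2] := sq8 n.
  case: hm => hm; case: hn => hn.
  - exfalso; move: hk1 hk2; rewrite -hm -hn => hk1 hk2.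
    by clear -x1 hk1 hk2; case: hk1 => ?; case: hk2 => ?; lia.
  - exists m, n; split => //; [clear -hm hn x1; lia|].
    have : (p * (y * y) = p * ((m * n) * (m * n)))%N by rewrite -fac hm hn; ring.
    move/eqP; rewrite eqn_pmul2l ?prime_gt0 // !mulnn eqn_exp2r // => /eqP //.
  - exfalso; move: hm; rewrite pq => hm.
    have {}hm : (x.+1 = 16 * (q * (m * m)) + 7 * (m * m))%N by rewrite hm; ring.
    clear -hm hn hk1 hk2 x1; case: hk1 => ?; case: hk2 => ?; lia.
  - exfalso; have : (p %| x.+1 - x.-1)%N by rewrite dvdn_sub // ?hm ?hn dvdn_mulr.
    have -> : (x.+1 - x.-1 = 2)%N by clear -x1; lia.
    by move/dvdn_leq; clear -pq; lia.
right; have [X xX] : exists X, (x = 2 * X + 1)%N by exists (x %/ 2)%N; clear -ox; lia.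
have [Y yY] : exists Y, (y = 2 * Y)%N.
  exists (y %/ 2)%N; have [|oy] := boolP (odd y); last by clear -oy; lia.
  have [k hk] := sq8 x; have [k' hk'] := sq8 y => oy; exfalso; move: e; rewrite pq.
  have -> : ((16 * q + 7) * (y * y) = 16 * (q * (y * y)) + 7 * (y * y))%N by ring.
  have : odd (x * x) by rewrite oddM ox.
  have : odd (y * y) by rewrite oddM oy.
  by case: hk => ->; case: hk' => ->; clear; lia.
have Y0 : (0 < Y)%N by clear -y0 yY; lia.
have X0 : (0 < X)%N by clear -x1 xX; lia.
have fac : (X.+1 * X = p * (Y * Y))%N.
  move: e; rewrite xX yY.
  have -> : (p * (2 * Y * (2 * Y)) = 4 * (p * (Y * Y)))%N by ring.
  by clear; lia.
have cop : coprime X.+1 X by rewrite coprime_sym coprimenS.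
have [m m0 hm] := coprime_prime_sq p_prime Y0 cop fac.
have fac' : (X * X.+1 = p * (Y * Y))%N by rewrite mulnC.
have [n n0 hn] : exists2 m, (0 < m)%N & (X = m * m \/ X = p * (m * m))%N.
  by apply: coprime_prime_sq p_prime Y0 _ fac'; rewrite coprimenS.
have [k1 hk1] := sq8 m; have [k2 hk2] := sq8 n.
case: hm => hm; case: hn => hn.
- exfalso; have nm : (n < m)%N by rewrite -ltn_sqr -!mulnn -hm -hn.
  have : (n.+1 * n.+1 <= m * m)%N by rewrite leq_mul.
  by rewrite -hm hn; clear -n0; lia.
- exists m, n; split => //; [clear -hm hn; lia | clear -hm hn xX; lia |].
  have : (p * (Y * Y) = p * ((m * n) * (m * n)))%N by rewrite -fac hm hn; ring.
  move/eqP; rewrite eqn_pmul2l ?prime_gt0 // !mulnn eqn_exp2r // => /eqP <- //.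
- exfalso; move: hm; rewrite pq => hm.
  have {}hm : (X.+1 = 16 * (q * (m * m)) + 7 * (m * m))%N by rewrite hm; ring.
  clear -hm hn hk1 hk2; case: hk1 => ?; case: hk2 => ?; lia.
- exfalso; have : (p %| X.+1 - X)%N by rewrite dvdn_sub // ?hm ?hn dvdn_mulr.
  by rewrite subSnn => /dvdn_leq; clear -pq; lia.
Qed.

Section NormOneUnit.
Variables c d e f : int.
(* The coordinates of N(u) = 1; [P] is then the norm of 1 + Tr(u) / 2. *)
Hypothesis E1 : c * c + p%:Z * (d * d) - 2 * (p%:Z * (e * f)) = 1.
Hypothesis E2 : 2 * (c * d) - e * e - p%:Z * (f * f) = 0.
Let P := (c + 1) * (c + 1) - p%:Z * (d * d).

(** For theta = 1 + A, A^2 - s B^2 = 1 becomes theta (theta - 2) = s B^2; here t replaces s, up to a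
    multiple of t^2 - p. *)
Lemma theta_eval t : (c + 1 + d * t) * (c - 1 + d * t) - t * ((e + f * t) * (e + f * t))
  = (t * t - p%:Z) * (d * d - 2 * (e * f) - f * f * t).
Proof.
have E2t : t * (2 * (c * d) - e * e - p%:Z * (f * f)) = t * 0 by rewrite E2.
by have := E1; lia.
Qed.

(** t approximates an l-adic square root of p, that is, a prime above a split l. If l divides theta,
    it does not divide theta - 2, so theta has the valuation of t B^2, which is even. *)
Lemma theta_val_even (l k : nat) (t : int) : prime l -> l != 2%N ->
  ~~ (l%:Z %| t)%Z -> ((l ^ k)%N%:Z %| t * t - p%:Z)%Z ->
  c + 1 + d * t != 0 -> (valz l (c + 1 + d * t)%R < k)%N ->
  ~~ odd (valz l (c + 1 + d * t)).
Proof.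
move=> pl l2 lt ltp; set x := c + 1 + d * t => x0 xk.
have [lx|/val0 -> //] := boolP (l%:Z %| x)%Z.
have yE : c - 1 + d * t = x - 2 by rewrite /x; ring.
have ly : ~~ (l%:Z %| x - 2)%Z.
  rewrite rpredBl //; rewrite dvdzE /= (dvdn_prime2 pl) //.
have y0 : x - 2 != 0 by apply: contraNneq ly => ->; apply: dvdz0.
have [] := @val_congr l pl k (x * (x - 2)) (t * ((e + f * t) * (e + f * t))).
- by rewrite -yE theta_eval dvdz_mulr.
- by rewrite mulf_neq0.
- by rewrite val_mul // (val0 pl ly) addn0.
rewrite !mulf_eq0 !negb_or => /andP[t0 /andP[B0 _]].
rewrite !val_mul ?mulf_neq0 // (val0 pl ly) addn0 (val0 pl lt) add0n => <-.
by rewrite addnn odd_double.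
Qed.

(** At a prime l other than 2 and p the valuation of P is even: by [val_nonsplit] if l is inert, and
    as the sum of two even valuations if l splits. So the squarefree part divides 2 p, and
    [no_neg_sqr] removes p. *)
Lemma theta_norm : 0 < P -> exists2 s : nat, (s == 1)%N || (s == 2)%N &
  exists2 m : int, 0 < m & P = s%:Z * (m * m).
Proof.
move=> P0; have P0' : P != 0 by rewrite gt_eqF.
have even l : prime l -> l != 2%N -> l != p -> ~~ odd (valz l P).
  move=> pl l2 lp.
  have [/existsP[t0 ht0]|ns] := boolP [exists t : 'I_l, (l%:Z %| t%:Z * t%:Z - p%:Z)%Z]; last first.
    apply: val_nonsplit => // t; apply: contra ns => dt; apply/existsP.
    have l0 : l%:Z != 0 by rewrite -lt0n prime_gt0.
    have tl : (absz (t %% l)%Z < l)%N.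
      by rewrite -ltz_nat gez0_abs ?modz_ge0 // ltz_pmod // ltz_nat prime_gt0.
    exists (Ordinal tl) => /=; rewrite gez0_abs ?modz_ge0 //.
    have tE := divz_eq t l; set r := (t %% l)%Z in tE *.
    have -> : r * r - p%:Z = t * t - p%:Z - (t + r) * (t %/ l)%Z * l%:Z.
      by have -> : t * t = t * (r + (t %/ l)%Z * l%:Z) by [rewrite addrC -tE]; lia.
    by rewrite rpredB // dvdz_mull.
  have lt0 : ~~ (l%:Z %| 2 * t0%:Z)%Z.
    rewrite Euclid_dvdz // negb_or dvdzE /= dvdn_prime2 // l2 /=.
    apply/negP => lt; move: ht0; rewrite rpredBl ?dvdz_mulr // dvdzE /= dvdn_prime2 //.
    by rewrite (negbTE lp).
  (* One digit more than the valuation of P, so that P and the product of its two approximate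
     factors have the same valuation. *)
  have [t] := hensel_sqrt pl (valz l P) lt0 ht0.
  rewrite Euclid_dvdz // negb_or => /andP[_ lt] dt.
  have lNt : ~~ (l%:Z %| - t)%Z by rewrite dvdzE abszN -dvdzE.
  have dNt : ((l ^ (valz l P).+1)%N%:Z %| - t * - t - p%:Z)%Z by rewrite mulrNN.
  have [] := @val_congr l pl (valz l P).+1 P ((c + 1 + d * t) * (c + 1 + d * - t)) => //.
    rewrite (_ : _ - _ = (t * t - p%:Z) * (d * d)) ?dvdz_mulr // /P; ring.
  rewrite mulf_eq0 negb_or => /andP[x0 y0]; rewrite val_mul // => vE; rewrite -vE oddD.
  have hx := theta_val_even pl l2 lt dt x0; have hy := theta_val_even pl l2 lNt dNt y0.
  by rewrite (negbTE (hx _)) ?(negbTE (hy _)) // -vE ltnS ?leq_addl ?leq_addr.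
have Pn0 : (0 < `|P|)%N by rewrite absz_gt0.
have [s [m [PE m0 sf od]]] := sqfree_part Pn0.
have s0 : (0 < s)%N by case: s PE {sf od} => // /eqP; rewrite absz_eq0 (negbTE P0').
have : s \in [:: 1; 2; p; 2 * p]%N.
  apply: sqfree_in2 => // l pl ls; have := od l pl ls.
  case: (eqVneq l 2%N) => [->|l2]; first by left.
  case: (eqVneq l p) => [->|lp]; first by right.
  by rewrite -[logn _ _]/(valz l P) (negbTE (even _ pl l2 lp)).
have PE' : P = s%:Z * (m%:Z * m%:Z) by rewrite -!PoszM -PE gez0_abs // ltW.
(* If P = s' p m^2, then p divides c + 1 = k p, and p k^2 = d^2 + s' m^2 with m nonzero. *)
have nop s' : (s' == 1)%N || (s' == 2)%N -> s <> (s' * p)%N.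
  move=> hs' sE; have e1 : (c + 1) * (c + 1) = p%:Z * (d * d + s'%:Z * (m%:Z * m%:Z)).
    have : P = s'%:Z * p%:Z * (m%:Z * m%:Z) by rewrite PE' sE PoszM.
    by rewrite /P; lia.
  have : (p%:Z %| (c + 1) * (c + 1))%Z by rewrite e1 dvdz_mulr.
  rewrite Euclid_dvdz // orbb => /dvdzP[k kE].
  have : p%:Z * (k * k) = d * d + s'%:Z * (m%:Z * m%:Z).
    by apply: (mulfI (_ : p%:Z != 0)); [rewrite gt_eqF | rewrite -e1 kE; ring].
  by move/(no_neg_sqr hs'); lia.
rewrite !inE => /or4P[/eqP|/eqP|/eqP|/eqP] sE.
- by exists 1%N => //; exists m%:Z; rewrite // PE' sE.
- by exists 2%N => //; exists m%:Z; rewrite // PE' sE.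
- by case: (@nop 1%N); rewrite ?mul1n.
- by case: (@nop 2%N).
Qed.

End NormOneUnit.
End Arith2.

(** * Rings of integers *)

Section Quadratic.
Variables (L : splittingFieldType rat) (F : {subfield L}) (s : L).
Hypotheses (sF : s ^+ 2 \in F) (sNF : s \notin F).
Local Notation E := <<F; s>>%AS.

Let s0 : s != 0. Proof. by apply: contraNneq sNF => ->; apply: rpred0. Qed.

Let sNs : - s != s.
Proof.
rewrite -subr_eq0 -opprD oppr_eq0 -mulr2n -mulr_natl mulf_eq0 negb_or s0 andbT.
have /pcharf0P -> // : [pchar L] =i pred0.
by move=> q; rewrite (fmorph_pchar (in_alg L)) pchar_num.
Qed.

Let polyE : 'X^2 - (s ^+ 2)%:P = ('X - s%:P) * ('X - (- s)%:P) :> {poly L}.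
Proof. by rewrite polyCN opprK rmorphXn subr_sqr. Qed.

Lemma minPoly_sqrt : minPoly F s = 'X^2 - (s ^+ 2)%:P.
Proof.
have PF : 'X^2 - (s ^+ 2)%:P \is a polyOver F.
  by rewrite rpredB ?rpredX ?polyOverX ?polyOverC.
have Ps : root ('X^2 - (s ^+ 2)%:P) s by rewrite polyE rootM root_XsubC eqxx.
have dv := minPoly_dvdp PF Ps.
have szP : size ('X^2 - (s ^+ 2)%:P : {poly L}) = 3 by rewrite size_XnsubC.
have P0 : 'X^2 - (s ^+ 2)%:P != 0 :> {poly L} by rewrite -size_poly_eq0 szP.
have szm : size (minPoly F s) = 3.
  have := dvdp_leq P0 dv; rewrite szP size_minPoly.
  have : adjoin_degree F s != 1%N by rewrite adjoin_deg_eq1.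
  have : (0 < adjoin_degree F s)%N by [].
  by case: (adjoin_degree F s) => [|[|[|//]]].
apply/eqP; rewrite -eqp_monic ?monic_minPoly ?monicXnsubC //.
by rewrite -(dvdp_size_eqp dv) szm szP.
Qed.

Lemma quad_decomp x : x \in E -> exists a b, [/\ a \in F, b \in F & x = a + b * s].
Proof.
move=> /Fadjoin_poly_eq <-; set P := Fadjoin_poly F s x.
have := size_minPoly F s; rewrite minPoly_sqrt size_XnsubC // => -[deg].
have szP : (size P <= 2)%N by rewrite deg size_Fadjoin_poly.
have /polyOverP PF := Fadjoin_polyOver F s x.
exists P`_0, P`_1; split; rewrite ?PF //.
by rewrite (horner_coef_wide _ szP) !big_ord_recl big_ord0 /= expr0 expr1 mulr1 addr0.
Qed.

Lemma quad_gal : exists sg : gal_of E,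
  [/\ sg \in 'Gal(E / F)%g, sg s = - s,
      forall x, galNorm F E x = x * sg x & forall x, galTrace F E x = x + sg x].
Proof.
have FE : (F <= E)%VS by apply: subv_adjoin.
have nE : normalField F E.
  apply/splitting_normalField => //; exists ('X^2 - (s ^+ 2)%:P).
    by rewrite rpredB ?rpredX ?polyOverX ?polyOverC.
  exists [:: s; - s]; first by rewrite !big_cons big_nil mulr1 polyE eqpxx.
  apply/eqP; rewrite eqEsubv; apply/andP; split.
    apply/Fadjoin_seqP; split => // y; rewrite !inE => /orP[] /eqP ->;
    by rewrite ?rpredN memv_adjoin.
  by apply/FadjoinP; split; [apply: subv_adjoin_seq | apply: seqv_sub_adjoin; rewrite inE eqxx].
have [|sg sgG sgs] := normalField_root_minPoly FE nE (memv_adjoin F s) (b := - s).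
  by rewrite minPoly_sqrt polyE rootM !root_XsubC eqxx orbT.
exists sg; have sg1 : sg != 1%g by apply: contraNneq sNs => e; rewrite -sgs e gal_id.
have GE : 'Gal(E / F)%g = [set (1%g : gal_of E); sg].
  apply/setP => g; rewrite !inE; apply/idP/orP => [gG|[]/eqP -> //].
  have : (g s) ^+ 2 = s ^+ 2 by rewrite -rmorphXn /= (fixed_gal FE gG).
  move/eqP; rewrite eqf_sqr => /orP[] /eqP h; [left|right].
    by rewrite (gal_adjoin_eq gG (group1 _)) gal_id h.
  by rewrite (gal_adjoin_eq gG sgG) sgs h.
split=> // x; rewrite /galNorm /galTrace GE big_setU1 ?inE ?[1%g == _]eq_sym //=;
by rewrite big_set1 gal_id.
Qed.

End Quadratic.

(** * Integers and units of k and K *)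

Section Fields.
Variable p : nat.
Hypotheses (p_prime : prime p) (p_mod : (p %% 16 = 7)%N).
Variables (L : splittingFieldType rat) (iota : {rmorphism L -> algC}) (r : L).
Hypothesis r4 : r ^+ 4 = p%:R.

Local Notation w := (r ^+ 2).
Local Notation kf := <<1; r ^+ 2>>%AS.
Local Notation Kf := <<1; r>>%AS.
Local Notation integral := (integralOver (intr : int -> L)).

Definition sqrt_int (c d : int) : L := c%:~R + d%:~R * w.
Definition root_int (c d e f : int) : L := sqrt_int c d + sqrt_int e f * r.

Lemma rat_iota x : x \in (1%AS : {subfield L}) -> iota x \in Crat.
Proof.
case/vlineP => q ->.
by rewrite -[iota _]/((iota \o in_alg L) q) (fmorph_eq_rat (iota \o in_alg L)) Crat_rat.
Qed.

Lemma rat_integral_int x : x \in (1%AS : {subfield L}) -> integral x -> exists n : int, x = n%:~R.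
Proof.
move=> /rat_iota xQ [P Pm Px].
have : iota x \in Aint.
  apply: (@root_monic_Aint (map_poly intr P)); rewrite ?monic_map //.
    have <- : map_poly iota (map_poly intr P) = map_poly intr P.
      by rewrite -map_poly_comp; apply: eq_map_poly => n /=; rewrite rmorph_int.
    by rewrite fmorph_root.
  by apply/polyOverP => i; rewrite coef_map /= rpred_int.
move/(Cint_rat_Aint xQ)/intrP => [n xn]; exists n; apply: (fmorph_inj iota).
by rewrite xn rmorph_int.
Qed.

Lemma w_sqr : w ^+ 2 = p%:R. Proof. by rewrite -exprM. Qed.

Lemma integral_int (n : int) : integral n%:~R.
Proof. exact: integral_id. Qed.

Lemma integral_r : integral r.
Proof.
exists ('X^4 - p%:Z%:P); first by rewrite monicXnsubC.
by rewrite /root rmorphB /= map_polyXn map_polyC /= !hornerE r4 subrr.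
Qed.

Lemma intL_inj : injective (intr : int -> L).
Proof.
by move=> m n /(congr1 iota); rewrite !rmorph_int => /intr_inj.
Qed.

Lemma intL_eq0 (m : int) : (m%:~R == 0 :> L) = (m == 0).
Proof. by rewrite -(inj_eq intL_inj). Qed.

Lemma w_irrational : w \notin (1%AS : {subfield L}).
Proof.
apply/negP => w1; have [n nw] : exists n : int, w = n%:~R.
  by apply: rat_integral_int => //; apply: integral_mul; apply: integral_r.
have : (n * n)%:~R = p%:Z%:~R :> L by rewrite rmorphM /= -nw -expr2 w_sqr.
move/intL_inj => nn; have e : (`|n| * `|n| = p)%N by rewrite -abszM nn.
have : (`|n| %| p)%N by rewrite -e dvdn_mulr.
case/primeP: p_prime => p1 /[apply] /orP[] /eqP h; move: e p1; rewrite h; first by move=> <-.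
by clear; nia.
Qed.

Let wk : w \in kf. Proof. exact: memv_adjoin. Qed.

(** Squaring r = a + b w gives (1 - 2 a b) w = a^2 + p b^2. As w is irrational, 2 a b = 1, and then
    the right-hand side is a vanishing sum of squares of rationals, which forces a = 0. *)
Lemma r_notin_k : r \notin kf.
Proof.
apply/negP => rk; have [|a [b [aQ bQ rE]]] := quad_decomp _ w_irrational rk.
  by rewrite w_sqr rpred_nat.
have e : (1 - a * b *+ 2) * w = a ^+ 2 + b ^+ 2 * p%:R.
  have : r ^+ 2 = (a + b * w) ^+ 2 by rewrite -rE.
  move=> h; rewrite mulrBl mul1r {1}h -w_sqr; ring.
have [ab|ab] := eqVneq (1 - a * b *+ 2) 0; last first.
  move/negP: w_irrational; case; rewrite -[w](mulKf ab) e.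
  by rewrite rpredM ?rpredV ?rpredB ?rpredMn ?rpredM ?rpredD ?rpredM ?rpredX ?rpred_nat ?rpred1.
have aR := rat_iota aQ; have bR := rat_iota bQ.
have a2 : 0 <= iota a ^+ 2 by apply: real_exprn_even_ge0 => //; apply: Creal_Crat.
have b2 : 0 <= iota b ^+ 2 by apply: real_exprn_even_ge0 => //; apply: Creal_Crat.
move/eqP: e; rewrite ab mul0r eq_sym -(fmorph_eq0 iota) rmorphD /= rmorphXn /= [X in _ + X]rmorphM /= rmorphXn rmorph_nat.
rewrite (paddr_eq0 a2 (mulr_ge0 b2 (ler0n _ p))) => /andP[+ _].
rewrite expf_eq0 /= fmorph_eq0 => /eqP a0.
by move/eqP: ab; rewrite a0 mul0r mul0rn subr0 oner_eq0.
Qed.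

Let wK : w \in Kf. Proof. by rewrite rpredX // memv_adjoin. Qed.

Lemma subkK : (kf <= Kf)%VS.
Proof. by apply/FadjoinP; split => //; apply: sub1v. Qed.

Lemma adjoin_rE : <<kf; r>>%AS = Kf :> {vspace L}.
Proof.
apply/eqP; rewrite eqEsubv; apply/andP; split.
  by apply/FadjoinP; split; rewrite ?subkK ?memv_adjoin.
by apply/FadjoinP; split; rewrite ?memv_adjoin ?sub1v.
Qed.

Lemma gal_Kk : exists sg : gal_of Kf,
  [/\ sg \in 'Gal(Kf / kf)%g, sg r = - r,
      forall x, galNorm kf Kf x = x * sg x & forall x, galTrace kf Kf x = x + sg x].
Proof.
have := quad_gal wk r_notin_k.
by have -> : <<kf; r>>%AS = Kf by apply: val_inj; exact: adjoin_rE.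
Qed.

Lemma gal_integral (E : {subfield L}) (sg : gal_of E) x : integral x -> integral (sg x).
Proof.
move=> ix; have := integral_rmorph (gal_repr sg) ix.
case=> P Pm Px; exists P => //; apply: etrans Px; congr root.
by apply: eq_map_poly => n /=; rewrite rmorph_int.
Qed.

Lemma zk_int c d : sqrt_int c d \in kf /\ integral (sqrt_int c d).
Proof.
split; first (rewrite rpredD //; first exact: rpred_int; rewrite rpredM //; exact: rpred_int).
apply: integral_add; first exact: integral_int.
by apply: integral_mul; [apply: integral_int | apply: integral_mul; apply: integral_r].
Qed.

Lemma zk_eq0 c d : sqrt_int c d = 0 -> c = 0 /\ d = 0.
Proof.
rewrite /sqrt_int => e; have [d0|d0] := eqVneq d 0.
  by move: e; rewrite d0 mul0r addr0 => /eqP; rewrite intL_eq0 => /eqP ->.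
case/negP: w_irrational; have d0' : d%:~R != 0 :> L by rewrite intL_eq0.
have -> : w = - (c%:~R / d%:~R).
  by apply: (mulfI d0'); rewrite mulrN [_ * (_ / _)]mulrC divfK //; apply/eqP; rewrite -addr_eq0 addrC e.
by rewrite rpredN rpred_div ?rpred_int.
Qed.

Lemma zk_inj c d c' d' : sqrt_int c d = sqrt_int c' d' -> c = c' /\ d = d'.
Proof.
move=> e; have [] : c - c' = 0 /\ d - d' = 0.
  apply: zk_eq0; have -> : sqrt_int (c - c') (d - d') = sqrt_int c d - sqrt_int c' d' by rewrite /sqrt_int; ring.
  by rewrite e subrr.
by move=> /subr0_eq -> /subr0_eq ->.
Qed.

Lemma k_coordinates x : x \in kf -> exists a b,
  [/\ a \in (1%AS : {subfield L}), b \in (1%AS : {subfield L}) & x = a + b * w].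
Proof.
move=> xk; have [|a [b [aQ bQ xE]]] := quad_decomp _ w_irrational xk.
  by rewrite w_sqr rpred_nat.
by exists a, b.
Qed.

(** For x = a + b w, the trace, the norm and w (x - sg x) show that 2 a and 2 b are integers m and t
    with p t^2 = m^2 - 4 n; as p = 3 mod 4, both are even. *)
Lemma integers_k x : ring_of_integers kf x <-> exists c d, x = sqrt_int c d.
Proof.
split=> [[xk xi]|[c [d ->]]]; last exact: zk_int.
have [a [b [aQ bQ xE]]] := k_coordinates xk.
have w2 : w ^+ 2 \in (1%AS : {subfield L}) by rewrite w_sqr rpred_nat.
have [sg [sgG sgw _ _]] := quad_gal w2 w_irrational.
have fixQ y : y \in (1%AS : {subfield L}) -> sg y = y by apply: (fixed_gal (sub1v _) sgG).
have sx : sg x = a - b * w by rewrite xE rmorphD rmorphM /= sgw !fixQ // mulrN.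
have si : integral (sg x) by apply: gal_integral.
have [m hm] : exists m : int, 2 * a = m%:~R.
  apply: rat_integral_int; first by rewrite rpredM ?rpred_nat.
  by have -> : 2 * a = x + sg x by [rewrite sx xE; ring]; apply: integral_add.
have [n hn] : exists n : int, a ^+ 2 - p%:R * b ^+ 2 = n%:~R.
  apply: rat_integral_int; first by rewrite rpredB ?rpredM ?rpredX ?rpred_nat.
  have -> : a ^+ 2 - p%:R * b ^+ 2 = x * sg x by rewrite sx xE -w_sqr; ring.
  exact: integral_mul.
have [v hv] : exists v : int, 2 * p%:R * b = v%:~R.
  apply: rat_integral_int; first by rewrite !rpredM ?rpred_nat.
  have -> : 2 * p%:R * b = r * r * (x - sg x) by rewrite sx xE -w_sqr; ring.
  by apply: integral_mul; [apply: integral_mul; apply: integral_r | apply: integral_sub].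
have e1 : v * v = p%:Z * (m * m - 4 * n).
  apply: intL_inj; rewrite !(rmorphM, rmorphB) /= -hv -hm -hn.
  by rewrite -[p%:Z%:~R]/(p%:R); ring.
have : (p%:Z %| v * v)%Z by rewrite e1 dvdz_mulr.
rewrite Euclid_dvdz // orbb => /dvdzP[t tE].
have p0 : p%:Z != 0 by rewrite -lt0n prime_gt0.
have p0' : p%:R != 0 :> L by rewrite -[p%:R]/(p%:Z%:~R) intL_eq0.
have e2 : p%:Z * (t * t) = m * m - 4 * n by apply: (mulfI p0); rewrite -e1 tE; ring.
have [q pq] : exists q : int, p%:Z = 16 * q + 7.
  by exists (p %/ 16)%N%:Z; move: (divn_eq p 16) p_mod; clear; lia.
have hb : 2 * b = t%:~R.
  by apply: (mulfI p0'); rewrite mulrCA mulrA hv tE rmorphM /= mulrC.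
have [[m1 mE] [t1 tE1]] : (exists m1, m = 2 * m1) /\ (exists t1, t = 2 * t1).
  move: e2; rewrite pq; have -> : (16 * q + 7) * (t * t) = 16 * (q * (t * t)) + 7 * (t * t) by ring.
  move=> e2; have [mm tt] : (m %% 2)%Z = 0 /\ (t %% 2)%Z = 0.
    by clear -e2; case: (sqr_mod16 m) => -[? ?]; case: (sqr_mod16 t) => -[? ?]; lia.
  by split; [exists (m %/ 2)%Z | exists (t %/ 2)%Z]; clear -mm tt; lia.
have two0 : 2 != 0 :> L by rewrite -[2]/((2 : int)%:~R) intL_eq0.
exists m1, t1; rewrite xE /sqrt_int; congr (_ + _ * _); apply: (mulfI two0).
  by rewrite hm mE rmorphM.
by rewrite hb tE1 rmorphM.
Qed.

(** [normX] and [normY] are the coordinates X, Y of the relative norm X + Y s of (c + d s) + (e + f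
    s) r. *)
Definition normX (c d e f : int) : int := c * c + p%:Z * (d * d) - 2 * (p%:Z * (e * f)).
Definition normY (c d e f : int) : int := 2 * (c * d) - e * e - p%:Z * (f * f).

(** This removes the denominator 2 in [integers_K]: twice an integer of K has norm divisible by
    4. *)
Lemma even_coords (c d e f m n : int) :
  normX c d e f = 4 * m -> normY c d e f = 4 * n ->
  [/\ exists x, c = 2 * x, exists x, d = 2 * x, exists x, e = 2 * x & exists x, f = 2 * x].
Proof.
have [q pq] : exists q : int, p%:Z = 16 * q + 7.
  by exists (p %/ 16)%N%:Z; move: (divn_eq p 16) p_mod; clear; lia.
rewrite /normX /normY pq.
have par (x : int) : exists y : int, x = 2 * y \/ x = 2 * y + 1 by exists (x %/ 2)%Z; clear; lia.
have [c1 [->|->]] := par c; have [d1 [->|->]] := par d;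
have [e1 [->|->]] := par e; have [f1 [->|->]] := par f => h1 h2;
  try (exfalso; clear -h1 h2; lia).
by split; [exists c1|exists d1|exists e1|exists f1].
Qed.

Lemma zkM c d e f : sqrt_int c d * sqrt_int e f = sqrt_int (c * e + p%:Z * (d * f)) (c * f + d * e).
Proof. rewrite /sqrt_int. ring: r4. Qed.

Lemma zK_eq0 c d e f : root_int c d e f = 0 -> [/\ c = 0, d = 0, e = 0 & f = 0].
Proof.
move=> h; have [B0|B0] := eqVneq (sqrt_int e f) 0.
  by move: h; rewrite /root_int B0 mul0r addr0 => /zk_eq0[-> ->]; case: (zk_eq0 B0) => -> ->.
case/negP: r_notin_k; have rE : r = - (sqrt_int c d / sqrt_int e f).
  apply: (mulfI B0); rewrite mulrN [_ * (_ / _)]mulrC divfK //.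
  by apply/eqP; rewrite -addr_eq0 addrC -/(root_int c d e f) h.
have : - (sqrt_int c d / sqrt_int e f) \in kf by rewrite rpredN rpred_div //; apply: (proj1 (zk_int _ _)).
by rewrite -rE.
Qed.

Lemma zK_inj c d e f c' d' e' f' : root_int c d e f = root_int c' d' e' f' ->
  [/\ c = c', d = d', e = e' & f = f'].
Proof.
move=> h; have [] := @zK_eq0 (c - c') (d - d') (e - e') (f - f').
  have -> : root_int (c - c') (d - d') (e - e') (f - f') = root_int c d e f - root_int c' d' e' f'.
    by rewrite /root_int /sqrt_int; ring.
  by rewrite h subrr.
by move=> /subr0_eq -> /subr0_eq -> /subr0_eq -> /subr0_eq ->.
Qed.

Lemma zK_zk c d : sqrt_int c d = root_int c d 0 0.
Proof. rewrite /root_int /sqrt_int; ring. Qed.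

Lemma zK_normE c d e f : root_int c d e f * root_int c d (- e) (- f) = sqrt_int (normX c d e f) (normY c d e f).
Proof. rewrite /root_int /sqrt_int /normX /normY. ring: r4. Qed.

Lemma zK_integer c d e f : ring_of_integers Kf (root_int c d e f).
Proof.
have kK := subvP subkK.
split; first by rewrite rpredD ?rpredM ?memv_adjoin ?kK //; apply: (proj1 (zk_int _ _)).
apply: integral_add; first exact: (proj2 (zk_int _ _)).
by apply: integral_mul; [apply: (proj2 (zk_int _ _)) | apply: integral_r].
Qed.

Section Conj.
Variable sg : gal_of Kf.
Hypotheses (sgG : sg \in 'Gal(Kf / kf)%g) (sgr : sg r = - r).

Lemma sg_k x : x \in kf -> sg x = x.
Proof. exact: (fixed_gal subkK sgG). Qed.

Lemma sg_zK c d e f : sg (root_int c d e f) = root_int c d (- e) (- f).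
Proof.
rewrite /root_int rmorphD rmorphM /= sgr !sg_k; try exact: (proj1 (zk_int _ _)).
by rewrite /sqrt_int; ring.
Qed.

Lemma integers_K x : ring_of_integers Kf x <-> exists c d e f, x = root_int c d e f.
Proof.
split=> [[xK xi]|[c [d [e [f ->]]]]]; last exact: zK_integer.
have [|A [B [Ak Bk xE]]] := quad_decomp wk r_notin_k (_ : x \in <<kf; r>>%AS).
  by rewrite -[_ \in _]/(x \in (<<kf; r>>%AS : {vspace L})) adjoin_rE.
have sx : sg x = A - B * r by rewrite xE rmorphD rmorphM /= sgr !sg_k // mulrN.
have si : integral (sg x) by apply: gal_integral.
have [c [d hA]] : exists c d, 2 * A = sqrt_int c d.
  apply/integers_k; split; first by rewrite rpredM ?rpred_nat.
  by have -> : 2 * A = x + sg x by [rewrite sx xE; ring]; apply: integral_add.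
have [m [n hN]] : exists m n, A ^+ 2 - B ^+ 2 * w = sqrt_int m n.
  apply/integers_k; split; first exact: (rpredB (rpredX 2 Ak) (rpredM (rpredX 2 Bk) wk)).
  have -> : A ^+ 2 - B ^+ 2 * w = x * sg x by rewrite sx xE; ring.
  exact: integral_mul.
have [v1 [v2 hV]] : exists v1 v2, 2 * B * w = sqrt_int v1 v2.
  apply/integers_k; split; first exact: (rpredM (rpredM (rpred_nat _ 2) Bk) wk).
  have -> : 2 * B * w = r * (x - sg x) by rewrite sx xE; ring.
  by apply: integral_mul; [apply: integral_r | apply: integral_sub].
have e1 : sqrt_int v1 v2 * sqrt_int v1 v2 = sqrt_int 0 1 * (sqrt_int c d * sqrt_int c d - sqrt_int 4 0 * sqrt_int m n).
  by rewrite -hV -hA -hN /sqrt_int; ring.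
have e1' : sqrt_int (v1 * v1 + p%:Z * (v2 * v2)) (v1 * v2 + v2 * v1) =
    sqrt_int (p%:Z * (2 * (c * d) - 4 * n)) (c * c + p%:Z * (d * d) - 4 * m).
  rewrite -zkM e1 /sqrt_int; ring: r4.
case: (zk_inj e1') => e2 e3.
have : (p%:Z %| v1 * v1)%Z.
  by apply/dvdzP; exists (2 * (c * d) - 4 * n - v2 * v2); clear -e2; lia.
rewrite Euclid_dvdz // orbb => /dvdzP[f fE].
have p0 : p%:Z != 0 by rewrite -lt0n prime_gt0.
have w0 : w != 0 by apply: contraNneq w_irrational => ->; apply: rpred0.
have hB : 2 * B = sqrt_int v2 f.
  by apply: (mulIf w0); rewrite hV fE /sqrt_int; ring: r4.
have [] := @even_coords c d v2 f m n.
- by move: e3; rewrite /normX fE; clear; lia.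
- rewrite /normY; suff : p%:Z * (p%:Z * (f * f) + v2 * v2) = p%:Z * (2 * (c * d) - 4 * n).
    by move/(mulfI p0); clear; lia.
  by rewrite -e2 fE; ring.
move=> [c1 cE] [d1 dE] [e1'' eE] [f1 f1E].
exists c1, d1, e1'', f1; have two0 : 2 != 0 :> L by rewrite -[2]/((2 : int)%:~R) intL_eq0.
apply: (mulfI two0); rewrite xE mulrDr mulrA hA hB cE dE eE f1E /root_int /sqrt_int; ring.
Qed.

(** The norm of a unit to Q is 1 or -1, and X^2 - p Y^2 = X^2 + Y^2 is never -1 mod 8. *)
Lemma unit_zK u : is_unit Kf u ->
  exists c d e f, u = root_int c d e f /\
    normX c d e f * normX c d e f - p%:Z * (normY c d e f * normY c d e f) = 1.
Proof.
case=> u0 /integers_K[c [d [e [f uE]]]] /integers_K[c' [d' [e' [f' vE]]]].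
exists c, d, e, f; split => //.
pose X := normX c d e f; pose Y := normY c d e f.
pose X' := normX c' d' e' f'; pose Y' := normY c' d' e' f'.
have : sqrt_int X Y * sqrt_int X' Y' = sqrt_int 1 0.
  rewrite -!zK_normE -!sg_zK -uE -vE.
  have -> : u * sg u * (u^-1 * sg u^-1) = (u * u^-1) * sg (u * u^-1) by rewrite rmorphM; ring.
  by rewrite mulfV // rmorph1 /sqrt_int; ring.
rewrite zkM => /zk_inj[h1 h2].
have : (X * X - p%:Z * (Y * Y)) * (X' * X' - p%:Z * (Y' * Y')) = 1.
  have -> : (X * X - p%:Z * (Y * Y)) * (X' * X' - p%:Z * (Y' * Y')) =
    (X * X' + p%:Z * (Y * Y')) * (X * X' + p%:Z * (Y * Y')) - p%:Z * ((X * Y' + Y * X') * (X * Y' + Y * X')) by ring.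
  by rewrite h1 h2; ring.
have [q pq] : exists q : int, p%:Z = 16 * q + 7.
  by exists (p %/ 16)%N%:Z; move: (divn_eq p 16) p_mod; clear; lia.
move=> h; have : X * X - p%:Z * (Y * Y) = 1 \/ X * X - p%:Z * (Y * Y) = -1.
  move: h; set s := X * X - _; set t := X' * X' - _ => /(congr1 absz).
  by rewrite abszM => /eqP; rewrite muln_eq1 => /andP[/eqP h _]; clear -h; lia.
case=> // h'; exfalso; move: h'; rewrite pq.
have -> : (16 * q + 7) * (Y * Y) = 16 * (q * (Y * Y)) + 7 * (Y * Y) by ring.
by clear; case: (sqr_mod8 X) => ?; case: (sqr_mod8 Y) => ?; lia.
Qed.

Lemma zK_unit c d e f :
  normX c d e f * normX c d e f - p%:Z * (normY c d e f * normY c d e f) = 1 ->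
  is_unit Kf (root_int c d e f).
Proof.
move=> h; set X := normX c d e f in h; set Y := normY c d e f in h.
have inv : root_int c d e f * (root_int c d (- e) (- f) * sqrt_int X (- Y)) = 1.
  rewrite mulrA zK_normE -/X -/Y zkM.
  have -> : X * X + p%:Z * (Y * - Y) = 1 by rewrite -h; ring.
  by rewrite /sqrt_int; ring.
have u0 : root_int c d e f != 0 by apply: contra_eq_neq inv => ->; rewrite mul0r eq_sym oner_eq0.
split=> //; first exact: zK_integer.
have -> : (root_int c d e f)^-1 = root_int c d (- e) (- f) * sqrt_int X (- Y).
  by apply: (mulfI u0); rewrite inv mulfV.
have [h1 h2] := zK_integer c d (- e) (- f); have [h3 h4] := zk_int X (- Y).
by split; [rewrite rpredM // (subvP subkK) | apply: integral_mul].
Qed.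

End Conj.

End Fields.

(** * Dirichlet's pigeonhole argument *)

(** As h is unbounded on P, a list of elements in distinct classes can be extended by an element
    whose h exceeds all the others. Once the list would outgrow T, a class repeats, with a strict
    inequality between the two values of h. *)
Lemma pigeonhole_chain (R : realFieldType) (A : eqType) (T : finType) (P : A -> Prop)
  (cl : A -> T) (h : A -> R) : (forall x, exists2 a, P a & x < h a) ->
  exists a b, [/\ P a, P b, cl a = cl b & h b < h a].
Proof.
move=> ex; suff main n : (exists a b, [/\ P a, P b, cl a = cl b & h b < h a]) \/
    exists s, exists x, [/\ size s = n, uniq (map cl s), forall a, a \in s -> P a & forall a, a \in s -> h a <= x].
  case: (main #|T|.+1) => // -[s [x [sz un _ _]]].
  have := card_uniqP un; rewrite size_map sz => e.
  by have := max_card (mem (map cl s)); rewrite e ltnn.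
elim: n => [|n [|[s [x [sz un sP sx]]]]]; first by right; exists [::], 0.
  by left.
have [a aP xa] := ex x.
have [/mapP[b bs ab]|ns] := boolP (cl a \in map cl s).
  by left; exists a, b; split; [| apply: sP | | apply: le_lt_trans (sx _ bs) xa].
right; exists (a :: s), (h a); split; rewrite /= ?sz ?ns //.
  by move=> b; rewrite inE => /orP[/eqP -> //|/sP].
by move=> b; rewrite inE => /orP[/eqP -> //|/sx bx]; apply: le_trans bx (ltW xa).
Qed.

Lemma seq_min (R : realFieldType) (A : eqType) (h : A -> R) (s : seq A) a :
  a \in s -> exists2 b, b \in s & forall c, c \in s -> h b <= h c.
Proof.
elim: s a => // x s IH a _; case: s IH => [_|y s IH].
  by exists x => [|c]; rewrite ?mem_head // inE => /eqP ->.
have [b bs bm] := IH y (mem_head _ _).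
case: (lerP (h x) (h b)) => xb.
  exists x => [|c]; rewrite ?mem_head // inE => /orP[/eqP -> //|/bm]; exact: le_trans.
exists b => [|c]; first by rewrite inE bs orbT.
by rewrite inE => /orP[/eqP ->|/bm //]; apply: ltW.
Qed.

(** * Elements of bounded norm and large ratio *)

Section Real.
Variables (p : nat) (R : archiRealFieldType) (rho : R).
Hypotheses (p_prime : prime p) (rho1 : 1 < rho) (rho4 : rho ^+ 4 = p%:R).
Local Notation X := (normX p).
Local Notation Y := (normY p).

Definition root_eval (c d e f : int) : R :=
  c%:~R + d%:~R * rho ^+ 2 + (e%:~R + f%:~R * rho ^+ 2) * rho.

Lemma ev_norm c d e f :
  root_eval c d e f * root_eval c d (- e) (- f) = (X c d e f)%:~R + (Y c d e f)%:~R * rho ^+ 2.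
Proof. rewrite /root_eval /normX /normY; ring: rho4. Qed.

(** The relative norm under s |-> - rho^2. There r goes to a purely imaginary number, whence a sum
    of squares; its nonnegativity controls the signs of all norms. *)
Lemma norm_conj c d e f : (X c d e f)%:~R - (Y c d e f)%:~R * rho ^+ 2 =
  (c%:~R - d%:~R * rho ^+ 2) ^+ 2 + rho ^+ 2 * (e%:~R - f%:~R * rho ^+ 2) ^+ 2.
Proof. rewrite /normX /normY; ring: rho4. Qed.

Lemma sqr_irrational (x y : int) : x * x = p%:Z * (y * y) -> x = 0 /\ y = 0.
Proof.
have p0 : p%:Z != 0 by rewrite -lt0n prime_gt0.
move=> e; have [y0|y0] := eqVneq y 0.
  by split=> //; move/eqP: e; rewrite y0 !mulr0 mulf_eq0 orbb => /eqP.
have x0 : x != 0.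
  by apply: contra_eq_neq e => ->; rewrite mul0r eq_sym !mulf_neq0.
have := congr1 (valz p) e; rewrite !val_mul ?mulf_neq0 //.
move/(congr1 odd); rewrite !oddD !addbb addbF /valz /=.
by rewrite logn_prime // eqxx.
Qed.

Lemma norm_neq0 c d e f :
  X c d e f * X c d e f - p%:Z * (Y c d e f * Y c d e f) = 0 ->
  [/\ c = 0, d = 0, e = 0 & f = 0].
Proof.
move/subr0_eq/sqr_irrational => [X0 Y0].
have := norm_conj c d e f; rewrite X0 Y0 mulr0z mul0r subr0 => /esym/eqP.
have r0 : 0 < rho ^+ 2 by rewrite exprn_gt0 // (lt_trans _ rho1).
rewrite (paddr_eq0 (sqr_ge0 _) (mulr_ge0 (ltW r0) (sqr_ge0 _))) [X in _ && X]mulf_eq0 (gt_eqF r0) /=.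
rewrite !sqrf_eq0.
have z x y : x%:~R - y%:~R * rho ^+ 2 == 0 -> x = 0 /\ y = 0.
  rewrite subr_eq0 => /eqP h; apply: sqr_irrational; apply: (@intr_inj R).
  rewrite !rmorphM /= h -[p%:Z%:~R]/(p%:R); ring: rho4.
by move=> /andP[/z[-> ->] /z[-> ->]].
Qed.

Definition rho_sum : R := 1 + rho + rho ^+ 2 + rho ^+ 3.

(** Dirichlet's box principle: (H + 1)^4 quadruples have values in an interval of length H
    [rho_sum], and H^4 + 1 bins of width [rho_sum] / H^3 are fewer. *)
Lemma small_conj (H : nat) : (0 < H)%N -> exists c d e f : int,
  [/\ [/\ `|c| <= H%:Z, `|d| <= H%:Z, `|e| <= H%:Z & `|f| <= H%:Z],
      ~ [/\ c = 0, d = 0, e = 0 & f = 0] &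
      `|root_eval c d (- e) (- f)| * H%:R ^+ 3 < rho_sum].
Proof.
move=> H0; have rho0 : 0 < rho by apply: lt_trans rho1.
have S0 : 0 < rho_sum by rewrite /rho_sum !addr_gt0 ?exprn_gt0.
have HR : 0 < H%:R :> R by rewrite ltr0n.
pose T := ('I_H.+1 * 'I_H.+1 * 'I_H.+1 * 'I_H.+1)%type.
(* The last two digits are counted down from H: values stay nonnegative, and in a difference e and f
   appear with the minus sign of the conjugate. *)
pose v (t : T) : R := (t.1.1.1)%:R + (t.1.1.2)%:R * rho ^+ 2 + (H%:R - (t.1.2)%:R) * rho + (H%:R - (t.2)%:R) * rho ^+ 3.
pose y t := v t * H%:R ^+ 3 / rho_sum.
have yb t : 0 <= y t <= (H ^ 4)%:R.
  have iH (i : 'I_H.+1) : 0 <= i%:R :> R /\ i%:R <= H%:R :> R.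
    by rewrite ler0n ler_nat -ltnS ltn_ord.
  have [a0 a1] := iH t.1.1.1; have [b0 b1] := iH t.1.1.2.
  have [c0 c1] := iH t.1.2; have [d0 d1] := iH t.2.
  have r2 : 0 <= rho ^+ 2 by rewrite exprn_ge0 // ltW.
  have r3 : 0 <= rho ^+ 3 by rewrite exprn_ge0 // ltW.
  have n1 := mulr_ge0 b0 r2.
  have n2 : 0 <= (H%:R - t.1.2%:R) * rho by rewrite mulr_ge0 ?subr_ge0 // ltW.
  have n3 : 0 <= (H%:R - t.2%:R) * rho ^+ 3 by rewrite mulr_ge0 ?subr_ge0.
  have m1 : 0 <= (H%:R - t.1.1.2%:R) * rho ^+ 2 by rewrite mulr_ge0 ?subr_ge0.
  have m2 := mulr_ge0 c0 (ltW rho0); have m3 := mulr_ge0 d0 r3.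
  have v0 : 0 <= v t by rewrite /v; lra.
  have v1 : v t <= H%:R * rho_sum by rewrite /v /rho_sum; lra.
  rewrite /y divr_ge0 ?mulr_ge0 ?exprn_ge0 ?(ltW HR) ?(ltW S0) //=.
  rewrite ler_pdivrMr // natrX.
  have -> : H%:R ^+ 4 * rho_sum = H%:R * rho_sum * H%:R ^+ 3 by ring.
  by rewrite ler_pM2r ?exprn_gt0.
pose bin t : 'I_(H ^ 4).+1 := inord (Num.truncn (y t)).
have binE t : bin t = Num.truncn (y t) :> nat.
  rewrite inordK // ltnS; have /andP[y0 y1] := yb t.
  have /andP[h _] := truncn_itv y0.
  by rewrite -(ler_nat R); apply: le_trans y1.
have : ~~ injectiveb bin.
  apply/negP => /injectiveP/leq_card; rewrite !card_prod !card_ord.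
  have : (0 < H)%N by []. 
  rewrite !expnS expn0; clear; nia.
case/injectivePn => t [t' tt' e].
have yy : `|y t - y t'| < 1.
  have /andP[y0 _] := yb t; have /andP[y0' _] := yb t'.
  have := truncn_itv y0; have := truncn_itv y0'.
  rewrite -!binE e -natr1 => /andP[? ?] /andP[? ?].
  by rewrite ltr_norml; apply/andP; split; lra.
exists ((t.1.1.1)%:Z - (t'.1.1.1)%:Z), ((t.1.1.2)%:Z - (t'.1.1.2)%:Z),
  ((t.1.2)%:Z - (t'.1.2)%:Z), ((t.2)%:Z - (t'.2)%:Z); split.
- have iH (i j : 'I_H.+1) : `|i%:Z - j%:Z| <= H%:Z.
    by have := ltn_ord i; have := ltn_ord j; lia.
  by split; apply: iH.
- case=> /subr0_eq[h1] /subr0_eq[h2] /subr0_eq[h3] /subr0_eq[h4].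
  case/eqP: tt'; move: t t' h1 h2 h3 h4 {e yy} => [[[t1 t2] t3] t4] [[[s1 s2] s3] s4] /=.
  by move=> /val_inj -> /val_inj -> /val_inj -> /val_inj ->.
have -> : root_eval ((t.1.1.1)%:Z - (t'.1.1.1)%:Z) ((t.1.1.2)%:Z - (t'.1.1.2)%:Z)
  (- ((t.1.2)%:Z - (t'.1.2)%:Z)) (- ((t.2)%:Z - (t'.2)%:Z)) = v t - v t'.
  rewrite /root_eval /v; ring.
have : `|v t - v t'| * H%:R ^+ 3 = `|y t - y t'| * rho_sum.
  rewrite -[H%:R ^+ 3]ger0_norm ?exprn_ge0 ?ltW // -normrM -[rho_sum in RHS]ger0_norm ?ltW //.
  by rewrite -normrM /y; congr (`| _ |); field; rewrite gt_eqF.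
by move=> ->; rewrite -[ltRHS]mul1r ltr_pM2r.
Qed.

Lemma ev_bound (H : nat) c d e f :
  `|c| <= H%:Z -> `|d| <= H%:Z -> `|e| <= H%:Z -> `|f| <= H%:Z ->
  `|root_eval c d e f| <= rho_sum * H%:R /\
  (X c d e f)%:~R - (Y c d e f)%:~R * rho ^+ 2 <= rho_sum ^+ 3 * H%:R ^+ 2.
Proof.
have bd (x : int) : `|x| <= H%:Z -> `|x%:~R : R| <= H%:R.
  by move=> h; rewrite -intr_norm -[H%:R]/(H%:Z%:~R) ler_int.
have r0 : 0 < rho by apply: lt_trans rho1.
have S0 : 0 < rho_sum by rewrite /rho_sum !addr_gt0 ?exprn_gt0.
move=> /bd hc /bd hd /bd he /bd hf; split.
  have -> : root_eval c d e f = c%:~R + e%:~R * rho + d%:~R * rho ^+ 2 + f%:~R * rho ^+ 3.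
    by rewrite /root_eval; ring.
  have -> : rho_sum * H%:R = H%:R + H%:R * rho + H%:R * rho ^+ 2 + H%:R * rho ^+ 3.
    by rewrite /rho_sum; ring.
  have tri (x : int) (y : R) : `|x%:~R : R| <= H%:R -> 0 <= y -> `|x%:~R * y| <= H%:R * y.
    by move=> hx y0; rewrite normrM (ger0_norm y0) ler_wpM2r.
  apply: le_trans (ler_normD _ _) _; apply: lerD; last by apply: tri => //; rewrite ?exprn_ge0 ?ltW.
  apply: le_trans (ler_normD _ _) _; apply: lerD; last by apply: tri => //; rewrite ?exprn_ge0 ?ltW.
  by apply: le_trans (ler_normD _ _) _; apply: lerD => //; apply: tri => //; apply: ltW.
rewrite norm_conj.
have half (x y : int) : `|x%:~R : R| <= H%:R -> `|y%:~R : R| <= H%:R ->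
    (x%:~R - y%:~R * rho ^+ 2) ^+ 2 <= (rho_sum * H%:R) ^+ 2.
  move=> hx hy; rewrite -[(_ - _) ^+ 2]real_normK ?num_real //.
  have SH0 : 0 <= rho_sum * H%:R by rewrite mulr_ge0 ?ler0n // ltW.
  rewrite ler_pXn2r ?nnegrE //.
  apply: le_trans (ler_normB _ _) _; apply: (@le_trans _ _ (H%:R + H%:R * rho ^+ 2)).
    have r2 : 0 <= rho ^+ 2 by apply: sqr_ge0.
    by apply: lerD => //; rewrite normrM (ger0_norm r2) ler_wpM2r.
  rewrite /rho_sum !mulrDl mul1r mulrC; have := mulr_ge0 (ltW r0) (ler0n R H).
  have := mulr_ge0 (exprn_ge0 3 (ltW r0)) (ler0n R H); lra.
have -> : rho_sum ^+ 3 * H%:R ^+ 2 = (rho_sum * H%:R) ^+ 2 + rho ^+ 2 * (rho_sum * H%:R) ^+ 2 +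
   (rho + rho ^+ 3) * (rho_sum * H%:R) ^+ 2 by rewrite {1}/rho_sum; rewrite /rho_sum; ring.
have p2 : 0 < rho ^+ 2 by rewrite exprn_gt0.
have h1 := half _ _ hc hd; have h2 := half _ _ he hf.
have h3 : rho ^+ 2 * (e%:~R - f%:~R * rho ^+ 2) ^+ 2 <= rho ^+ 2 * (rho_sum * H%:R) ^+ 2.
  by rewrite ler_pM2l.
have h4 : 0 <= (rho + rho ^+ 3) * (rho_sum * H%:R) ^+ 2.
  by rewrite mulr_ge0 ?sqr_ge0 // addr_ge0 ?exprn_ge0 ?ltW.
lra.
Qed.

Lemma norm_intr c d e f :
  (X c d e f * X c d e f - p%:Z * (Y c d e f * Y c d e f))%:~R =
  root_eval c d e f * root_eval c d (- e) (- f) *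
    ((X c d e f)%:~R - (Y c d e f)%:~R * rho ^+ 2) :> R.
Proof. rewrite ev_norm; ring: rho4. Qed.

(** With S = [rho_sum], the factors of N are at most S H, S / H^3 and S^3 H^2, so |N| <= S^5
    whatever H is. If the ratio were at most x, then 1 <= |N| <= |x| S^5 / H^4, which fails for H
    above |x| S^5. *)
Lemma exists_large_ratio : exists C : nat, forall x : R, exists c d e f : int,
  let N := X c d e f * X c d e f - p%:Z * (Y c d e f * Y c d e f) in
  [/\ N != 0, `|N| <= C%:Z & x * `|root_eval c d (- e) (- f)| < `|root_eval c d e f|].
Proof.
have r0 : 0 < rho by apply: lt_trans rho1.
have S0 : 0 < rho_sum by rewrite /rho_sum !addr_gt0 ?exprn_gt0.
have S50 : 0 <= rho_sum ^+ 5 by rewrite exprn_ge0 // ltW.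
exists (Num.Def.archi_bound (rho_sum ^+ 5)) => x.
pose y := `|x| * rho_sum ^+ 5.
have y0 : 0 <= y by rewrite mulr_ge0.
pose H := (Num.Def.archi_bound y).+1.
have yH : y < H%:R by apply: lt_le_trans (archi_boundP y0) _; rewrite ler_nat leqnSn.
have H0 : 0 < H%:R :> R by rewrite ltr0n.
have [//|c [d [e [f [[hc hd he hf] nz sm]]]]] := @small_conj H.
exists c, d, e, f; set N := _ - _ => /=.
have N0 : N != 0 by apply/eqP => /norm_neq0.
have [be bn] := ev_bound hc hd he hf.
have nv0 : 0 <= (X c d e f)%:~R - (Y c d e f)%:~R * rho ^+ 2.
  by rewrite norm_conj addr_ge0 ?sqr_ge0 // mulr_ge0 ?sqr_ge0.
have NR : `|N|%:~R = `|root_eval c d e f| * `|root_eval c d (- e) (- f)| *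
    ((X c d e f)%:~R - (Y c d e f)%:~R * rho ^+ 2) :> R.
  by rewrite intr_norm norm_intr 2!normrM [`|_ - _|]ger0_norm.
have N1 : 1 <= `|N|%:~R :> R by rewrite ler1z -gtz0_ge1 normr_gt0.
move: NR be bn sm nv0; set u := `|root_eval c d e f|; set v := `|root_eval c d _ _|.
set n := (X in u * v * X); set h := H%:R => NR be bn sm nv0.
have v0 : 0 <= v by apply: normr_ge0.
have u0 : 0 <= u by apply: normr_ge0.
have h1 : 1 <= h by rewrite /h ler1n.
split=> //.
  rewrite -(ler_int R); apply: le_trans (ltW (archi_boundP S50)); rewrite NR.
  have e1 : u * v * n * h ^+ 3 <= rho_sum ^+ 5 * h ^+ 3.
    have -> : u * v * n * h ^+ 3 = u * n * (v * h ^+ 3) by ring.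
    have -> : rho_sum ^+ 5 * h ^+ 3 = (rho_sum * h) * (rho_sum ^+ 3 * h ^+ 2) * rho_sum by ring.
    apply: ler_pM (ltW sm); rewrite ?mulr_ge0 ?exprn_ge0 ?(ltW H0) //.
    exact: ler_pM.
  by rewrite -(ler_pM2r (exprn_gt0 3 H0)).
rewrite ltNge; apply/negP => h2.
have vh : v * h ^+ 3 <= rho_sum by apply: ltW.
have : u * v * n * h ^+ 6 <= y * h ^+ 2.
  have -> : y * h ^+ 2 = `|x| * rho_sum * rho_sum * (rho_sum ^+ 3 * h ^+ 2) by rewrite /y; ring.
  have -> : u * v * n * h ^+ 6 = (u * h ^+ 3) * (v * h ^+ 3) * n by ring.
  have h30 : 0 <= h ^+ 3 by rewrite exprn_ge0 // ltW.
  have uh : u * h ^+ 3 <= `|x| * rho_sum.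
    apply: (@le_trans _ _ (`|x| * (v * h ^+ 3))).
      rewrite mulrA ler_wpM2r //; apply: le_trans h2 _.
      by rewrite ler_wpM2r // ler_norm.
    by rewrite ler_wpM2l.
  by apply: ler_pM => //; rewrite ?mulr_ge0 //; apply: ler_pM => //; rewrite ?mulr_ge0.
rewrite -NR => h3.
have : h ^+ 6 <= y * h ^+ 2.
  by apply: le_trans h3; rewrite ler_peMl // exprn_ge0 // ltW.
have -> : h ^+ 6 = h ^+ 4 * h ^+ 2 by ring.
rewrite ler_pM2r ?exprn_gt0 // leNgt => /negP; apply.
apply: lt_le_trans yH _; rewrite -[leLHS]expr1; exact: ler_weXn2l.
Qed.

(** All conjugates are bounded: the complex norm is the inverse of the relative norm n, hence at
    most 1, and u v = n <= E with |v| <= |u| <= M |v| bounds v^2 by E and u^2 by M E. The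
    coordinates are linear combinations of u, v and the two real numbers a, b at the complex
    place. *)
Lemma coord_bound (E M : R) c d e f : 1 <= E -> 1 <= M ->
  X c d e f * X c d e f - p%:Z * (Y c d e f * Y c d e f) = 1 ->
  1 <= (X c d e f)%:~R + (Y c d e f)%:~R * rho ^+ 2 <= E ->
  `|root_eval c d (- e) (- f)| <= `|root_eval c d e f| <= M * `|root_eval c d (- e) (- f)| ->
  let B := 3 + E + M * E in
  [/\ `|c%:~R : R| <= B, `|d%:~R : R| <= B, `|e%:~R : R| <= B & `|f%:~R : R| <= B].
Proof.
move=> E1 M1 N1 /andP[n1 nE] /andP[uv vM] B.
have r0 : 0 < rho by apply: lt_trans rho1.
have NR := congr1 (fun z : int => z%:~R : R) N1.
rewrite norm_intr ev_norm norm_conj in NR.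
have n0 := lt_le_trans ltr01 n1.
set n := (X c d e f)%:~R + _ in n1 nE NR n0.
set a := c%:~R - d%:~R * rho ^+ 2 in NR *; set b := e%:~R - f%:~R * rho ^+ 2 in NR *.
have sq (x : R) : x ^+ 2 <= 1 -> `|x| <= 1 by move=> h; rewrite -(@expr_le1 _ 2) // real_normK ?num_real.
have ab : a ^+ 2 + rho ^+ 2 * b ^+ 2 <= 1.
  have s0 : 0 <= a ^+ 2 + rho ^+ 2 * b ^+ 2 by rewrite addr_ge0 ?sqr_ge0 // mulr_ge0 ?sqr_ge0.
  by rewrite -[leRHS]NR ler_peMl.
have a1 : `|a| <= 1.
  apply: sq; apply: le_trans ab; rewrite lerDl mulr_ge0 ?sqr_ge0 //.
have rho21 : 1 <= rho ^+ 2 by rewrite exprn_ege1 // ltW.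
have b1 : `|b| <= 1.
  apply: sq; apply: le_trans ab; apply: (@le_trans _ _ (rho ^+ 2 * b ^+ 2)).
    by rewrite ler_peMl // sqr_ge0.
  by rewrite lerDr sqr_ge0.
set u := root_eval c d e f in uv vM; set v := root_eval c d (- e) (- f) in uv vM.
have uvn : u * v = n by rewrite /u /v ev_norm.
have uvn' : `|u| * `|v| = n by rewrite -normrM uvn ger0_norm // ltW.
have sq' (x y : R) : 0 <= x -> 0 <= y -> x ^+ 2 <= y -> x <= 1 + y.
  by move=> x0 y0 xy; rewrite leNgt; apply/negP => h; nra.
have E0 : 0 <= E by apply: le_trans E1.
have M0 : 0 <= M by apply: le_trans M1.
have v1 : `|v| <= 1 + E.
  apply: (sq' _ _ (normr_ge0 _) E0).
  by apply: le_trans nE; rewrite -uvn' expr2 ler_wpM2r.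
have u1 : `|u| <= 1 + M * E.
  apply: (sq' _ _ (normr_ge0 _) (mulr_ge0 M0 E0)).
  apply: (@le_trans _ _ (M * n)); last by rewrite ler_wpM2l.
  by rewrite -uvn' expr2 mulrCA ler_wpM2l.
have ME := mulr_ge0 M0 E0.
move: a1; rewrite ler_norml => /andP[a1 a2].
move: b1; rewrite ler_norml => /andP[b1 b2].
move: v1; rewrite ler_norml => /andP[v1 v2].
move: u1; rewrite ler_norml => /andP[u1 u2].
have cE : 2 * c%:~R = (u + v) / 2 + a by rewrite /u /v /root_eval /a; field.
have dE : 2 * d%:~R * rho ^+ 2 = (u + v) / 2 - a by rewrite /u /v /root_eval /a; field.
have eE : 2 * e%:~R * rho = (u - v) / 2 + b * rho by rewrite /u /v /root_eval /b; field.
have fE : 2 * f%:~R * rho ^+ 3 = (u - v) / 2 - b * rho by rewrite /u /v /root_eval /b; field.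
have B0 : 0 <= B by rewrite /B; lra.
have shrink (x y : R) : 1 <= y -> `|x * y| <= B -> `|x| <= B.
  move=> y1; rewrite normrM [`|y|]ger0_norm ?(le_trans _ y1) // => h.
  by apply: le_trans h; rewrite ler_peMr.
have eE' : 2 * e%:~R - b = (u - v) / 2 / rho by rewrite -[LHS](mulfK (lt0r_neq0 r0)) mulrBl eE; field; rewrite gt_eqF.
have fE' : 2 * f%:~R * rho ^+ 2 + b = (u - v) / 2 / rho.
  rewrite -[LHS](mulfK (lt0r_neq0 r0)) mulrDl.
  by have -> : 2 * f%:~R * rho ^+ 2 * rho = 2 * f%:~R * rho ^+ 3 by [ring]; rewrite fE; field; rewrite gt_eqF.
have q1 : `|(u - v) / 2 / rho| <= `|(u - v) / 2|.
  by rewrite normrM ler_piMr // normfV invf_le1 ger0_norm ?ltW.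
have q2 : `|(u - v) / 2| <= (2 + E + M * E) / 2 by rewrite ler_norml; apply/andP; split; lra.
have := le_trans q1 q2; rewrite ler_norml => /andP[q3 q4].
split.
- by rewrite ?ler_norml /B; apply/andP; split; lra.
- by apply: (shrink _ (rho ^+ 2)) => //; rewrite ?ler_norml /B; apply/andP; split; lra.
- by rewrite ?ler_norml /B; apply/andP; split; lra.
- by apply: (shrink _ (rho ^+ 2)) => //; rewrite ?ler_norml /B; apply/andP; split; lra.
Qed.

End Real.

(** * The units of K *)

Section Integers.
Variables (L : splittingFieldType rat) (E : {subfield L}).

Lemma integersM x y : ring_of_integers E x -> ring_of_integers E y -> ring_of_integers E (x * y).
Proof. by case=> xE xi [yE yi]; split; [apply: rpredM | apply: integral_mul]. Qed.

Lemma integersD x y : ring_of_integers E x -> ring_of_integers E y -> ring_of_integers E (x + y).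
Proof. by case=> xE xi [yE yi]; split; [apply: rpredD | apply: integral_add]. Qed.

Lemma integersN x : ring_of_integers E x -> ring_of_integers E (- x).
Proof. by case=> xE xi; split; [rewrite rpredN | apply: integral_opp]. Qed.

Lemma integers1 : ring_of_integers E 1.
Proof. by split; [apply: rpred1 | apply: integral1]. Qed.

Lemma integers_sqrt x : x \in E -> ring_of_integers E (x ^+ 2) -> ring_of_integers E x.
Proof.
move=> xE [_ xi]; split => //.
apply: (@integral_root_monic _ _ _ _ ('X^2 - (x ^+ 2)%:P)); first exact: monicXnsubC.
  by rewrite /root !hornerE subrr.
apply/integral_poly => i; rewrite coefB coefXn coefC.
by apply: integral_sub; [case: eqP => _; [apply: integral1 | apply: integral0]
  | case: eqP => _ //; apply: integral0].
Qed.

Lemma unit1 : is_unit E 1.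
Proof. by split; rewrite ?oner_eq0 ?invr1 //; apply: integers1. Qed.

Lemma unitM x y : is_unit E x -> is_unit E y -> is_unit E (x * y).
Proof.
case=> x0 xi xi' [y0 yi yi']; split; rewrite ?mulf_neq0 ?invfM //; exact: integersM.
Qed.

Lemma unitV x : is_unit E x -> is_unit E x^-1.
Proof. by case=> x0 xi xi'; split; rewrite ?invr_eq0 ?invrK. Qed.

Lemma unitN x : is_unit E x -> is_unit E (- x).
Proof. by case=> x0 xi xi'; split; rewrite ?oppr_eq0 ?invrN //; apply: integersN. Qed.

Lemma unitX x (n : nat) : is_unit E x -> is_unit E (x ^+ n).
Proof. by move=> ux; elim: n => [|n IH]; rewrite ?expr0 ?exprS; [apply: unit1 | apply: unitM]. Qed.

Lemma unitXz x (n : int) : is_unit E x -> is_unit E (x ^ n).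
Proof. by move=> ux; case: n => n; [apply: unitX | rewrite NegzE -exprnN; apply/unitV/unitX]. Qed.

Lemma unit_sqrt x : x \in E -> is_unit E (x ^+ 2) -> is_unit E x.
Proof.
move=> xE [x0 xi xi']; split; first by move: x0; rewrite expf_eq0.
  exact: integers_sqrt.
by apply: integers_sqrt; rewrite ?rpredV // exprVn.
Qed.

End Integers.

Lemma sqr_le1_ge (F : realFieldType) (z y : F) : 0 <= y -> 1 = z ^+ 2 + y -> -1 <= z.
Proof. by move=> y0 e; rewrite leNgt; apply/negP => h; nra. Qed.

Lemma bernoulli (F : realFieldType) (x : F) n : 1 <= x -> 1 + n%:R * (x - 1) <= x ^+ n.
Proof.
move=> x1; elim: n => [|n IH]; first by rewrite mul0r addr0 expr0.
rewrite exprS; apply: le_trans (ler_wpM2l (le_trans ler01 x1) IH).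
rewrite -natr1 -subr_ge0; have -> : x * (1 + n%:R * (x - 1)) - (1 + (n%:R + 1) * (x - 1)) =
  n%:R * (x - 1) ^+ 2 by ring.
by rewrite mulr_ge0 ?sqr_ge0 ?ler0n.
Qed.

Lemma mean_gt1 (F : realFieldType) (u v m : F) :
  0 < u -> 0 < v -> 1 < u * v -> 2 * m = u + v -> 1 < m.
Proof.
move=> u0 v0 uv mE; rewrite ltNge; apply/negP => m1.
have uv2 : u + v <= 2 by lra.
have : (u + v) * (u + v) <= 2 * 2 by rewrite ler_pM // addr_ge0 // ltW.
by have := sqr_ge0 (u - v); rewrite expr2; lra.
Qed.

(** * The unit group of K, its norms and its congruences *)

Section Main.
Variable p : nat.
Hypotheses (p_prime : prime p) (p_mod : (p %% 16 = 7)%N).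
Variables (L : splittingFieldType rat) (iota : {rmorphism L -> algC}) (r : L).
Hypotheses (r4 : r ^+ 4 = p%:R) (r_pos : 0 < iota r).
Local Notation w := (r ^+ 2).
Local Notation kf := <<1; r ^+ 2>>%AS.
Local Notation Kf := <<1; r>>%AS.
Local Notation zk := (sqrt_int r).
Local Notation zK := (root_int r).
Local Notation X := (normX p).
Local Notation Y := (normY p).

Definition rho : algR := in_algR (gtr0_real r_pos).
Local Notation ev := (root_eval rho).

Lemma rho_gt0 : 0 < rho. Proof. exact: r_pos. Qed.

Lemma rho4 : rho ^+ 4 = p%:R.
Proof. by apply: val_inj; rewrite [LHS]rmorphXn [RHS]rmorph_nat /= -rmorphXn r4 rmorph_nat. Qed.

Lemma rho_gt1 : 1 < rho.
Proof.
rewrite ltNge; apply/negP => h; have : rho ^+ 4 <= 1 by rewrite exprn_ile1 // ltW // rho_gt0.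
by rewrite rho4 lern1 leqNgt prime_gt1.
Qed.

Lemma w_k : w \in kf. Proof. exact: memv_adjoin. Qed.

Lemma kK x : x \in kf -> x \in Kf.
Proof. exact: (subvP (subkK r)). Qed.

Lemma iota_real x : x \in Kf -> iota x \is Num.real.
Proof.
move=> /Fadjoin_polyP[P /polyOverP PQ ->]; rewrite horner_coef rmorph_sum rpred_sum // => i _.
rewrite rmorphM /= rmorphXn rpredM //; last by rewrite rpredX // gtr0_real.
exact: Creal_Crat (rat_iota iota (PQ _)).
Qed.

(** The default 0 is taken where [iota x] is not real, which never happens on [Kf]; hence the
    membership hypotheses of the morphism lemmas. *)
Definition re (x : L) : algR := insubd 0 (iota x).

Lemma val_re x : x \in Kf -> algRval (re x) = iota x.
Proof. by move=> /iota_real xR; rewrite /re -[LHS]/(val _) val_insubd xR. Qed.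

Lemma re_inj x y : x \in Kf -> y \in Kf -> re x = re y -> x = y.
Proof. by move=> xK yK /(congr1 algRval); rewrite !val_re // => /fmorph_inj. Qed.

Lemma reM x y : x \in Kf -> y \in Kf -> re (x * y) = re x * re y.
Proof. by move=> xK yK; apply: val_inj; rewrite /= !val_re ?rpredM // rmorphM. Qed.

Lemma reD x y : x \in Kf -> y \in Kf -> re (x + y) = re x + re y.
Proof. by move=> xK yK; apply: val_inj; rewrite /= !val_re ?rpredD // rmorphD. Qed.

Lemma reN x : x \in Kf -> re (- x) = - re x.
Proof. by move=> xK; apply: val_inj; rewrite /= !val_re ?rpredN // rmorphN. Qed.

Lemma re1 : re 1 = 1.
Proof. by apply: val_inj; rewrite /= val_re ?rpred1 // rmorph1. Qed.

Lemma reV x : x \in Kf -> re x^-1 = (re x)^-1.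
Proof.
move=> xK; have [->|x0] := eqVneq x 0.
  have re0 : re 0 = 0 by apply: val_inj; rewrite /= val_re ?rpred0 // rmorph0.
  by rewrite !invr0 re0 invr0.
have h : re x * re x^-1 = 1 by rewrite -reM ?rpredV // mulfV // re1.
have rx0 : re x != 0 by apply: contra_eq_neq h => ->; rewrite mul0r eq_sym oner_eq0.
by apply: (mulfI rx0); rewrite h mulfV.
Qed.

Lemma reX x n : x \in Kf -> re (x ^+ n) = re x ^+ n.
Proof. by move=> xK; elim: n => [|n IH]; rewrite ?expr0 ?re1 // !exprS reM ?IH ?rpredX. Qed.

Lemma reXz x n : x \in Kf -> re (x ^ n) = re x ^ n.
Proof.
by move=> xK; case: n => n; rewrite ?NegzE -?exprnP -?exprnN ?reX // reV ?reX ?rpredX.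
Qed.

Lemma re_zK c d e f : re (zK c d e f) = ev c d e f.
Proof.
apply: val_inj; rewrite /= val_re; last exact: (proj1 (zK_integer r4 c d e f)).
have vi (n : int) : n%:~R = algRval n%:~R by rewrite rmorph_int.
rewrite /root_int /sqrt_int /root_eval !(rmorphD, rmorphM, rmorphXn, rmorph_int) /=.
by congr (_ + _ * _ + (_ + _ * _) * _); apply: vi.
Qed.

Lemma re_zk c d : re (zk c d) = c%:~R + d%:~R * rho ^+ 2.
Proof. by rewrite zK_zk re_zK /root_eval !mulr0z mul0r add0r mul0r addr0. Qed.

Lemma zk_K c d : zk c d \in Kf.
Proof. exact: kK (proj1 (zk_int r4 c d)). Qed.

Lemma zK_K c d e f : zK c d e f \in Kf.
Proof. exact: (proj1 (zK_integer r4 c d e f)). Qed.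

Lemma unit_mem (E : {subfield L}) u : is_unit E u -> u \in E.
Proof. by case=> _ []. Qed.

Lemma re_neq0 x : x \in Kf -> x != 0 -> re x != 0.
Proof.
move=> xK; apply: contra_neq => h; apply: re_inj; rewrite ?rpred0 // h.
by apply: val_inj; rewrite /= val_re ?rpred0 // rmorph0.
Qed.

Lemma unit_kK u : is_unit kf u -> is_unit Kf u.
Proof. by case=> u0 [uk ui] [uk' ui']; split => //; split => //; apply: kK. Qed.

Lemma unit_Kk u : is_unit Kf u -> u \in kf -> is_unit kf u.
Proof. by case=> u0 [uk ui] [uk' ui'] h; split => //; split; rewrite ?rpredV. Qed.

Lemma zk_unit (x y : int) : x * x - p%:Z * (y * y) = 1 -> is_unit kf (zk x y).
Proof.
move=> h; have e : zk x y * zk x (- y) = 1.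
  rewrite (zkM r4) (_ : _ + _ = 1); last by rewrite -h; ring.
  by rewrite /sqrt_int; ring.
have z0 : zk x y != 0 by apply: contra_eq_neq e => ->; rewrite mul0r eq_sym oner_eq0.
split=> //; first exact: (zk_int r4).
have -> : (zk x y)^-1 = zk x (- y) by apply: (mulfI z0); rewrite e mulfV.
exact: (zk_int r4).
Qed.

Lemma pell_sign (x y : int) : x * x - p%:Z * (y * y) <> -1.
Proof.
have [q pq] : exists q : int, p%:Z = 16 * q + 7.
  by exists (p %/ 16)%N%:Z; move: (divn_eq p 16) p_mod; clear; lia.
rewrite pq; have -> : (16 * q + 7) * (y * y) = 16 * (q * (y * y)) + 7 * (y * y) by ring.
by case: (sqr_mod8 x) => ?; case: (sqr_mod8 y) => ?; lia.
Qed.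

Variable sg : gal_of Kf.
Hypotheses (sgG : sg \in 'Gal(Kf / kf)%g) (sgr : sg r = - r).

Section Eps.
Variable eps : L.
Hypothesis eps_fund : fundamental_unit iota kf eps.

Lemma eps_unit : is_unit kf eps. Proof. by case: eps_fund. Qed.
Lemma eps_K : eps \in Kf. Proof. exact: kK (unit_mem eps_unit). Qed.
Lemma eps0 : eps != 0. Proof. by case: eps_unit. Qed.
Lemma re_eps : 1 < re eps.
Proof. by case: eps_fund => _ h _; rewrite -[_ < _]/(1 < algRval (re eps)) val_re ?eps_K. Qed.
Lemma re_eps_gt0 : 0 < re eps. Proof. exact: lt_trans re_eps. Qed.

Lemma eps_exp_inj : injective (fun n : int => eps ^ n).
Proof.
move=> m n /= /(congr1 re); rewrite !reXz ?eps_K //; apply: ieexprIz; rewrite ?re_eps_gt0 //.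
by rewrite gt_eqF // re_eps.
Qed.

Lemma eps_coord : exists x y : nat, [/\ eps = zk x%:Z y%:Z, (0 < y)%N & (x * x = p * (y * y) + 1)%N].
Proof.
have [c [d epsE]] := proj1 (integers_k p_prime p_mod iota r4 eps) (let: And3 _ h _ := eps_unit in h).
have [c' [d' [e [f [epsE' hN]]]]] := unit_zK p_prime p_mod iota r4 sgG sgr (unit_kK eps_unit).
have : zK c d 0 0 = zK c' d' e f by rewrite -zK_zk -epsE.
case/(zK_inj p_prime iota r4) => cE dE eE fE.
have h1 : (c * c - p%:Z * (d * d)) * (c * c - p%:Z * (d * d)) = 1.
  by rewrite -hN /normX /normY -cE -dE -eE -fE; ring.
have h2 : c * c - p%:Z * (d * d) = 1.
  have := @pell_sign c d; move: (c * c - _) h1 => z; clear; nia.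
have := re_eps; rewrite epsE re_zk => hu.
have hv : (c%:~R + d%:~R * rho ^+ 2) * (c%:~R - d%:~R * rho ^+ 2) = 1 :> algR.
  transitivity ((c * c - p%:Z * (d * d))%:~R : algR); last by rewrite h2.
  ring: rho4.
set u := _ + _ in hu hv; set v := _ - _ in hv.
have v0 : 0 < v by rewrite -(pmulr_rgt0 _ (lt_trans ltr01 hu)) hv.
have v1 : v < 1.
  by rewrite -(ltr_pM2l (lt_trans ltr01 hu)) hv mulr1.
have c0 : 0 < c by rewrite -(ltr0z algR); rewrite /u /v in hu v0 *; lra.
have d0 : 0 < d.
  rewrite -(ltr0z algR) -(pmulr_lgt0 _ (_ : 0 < rho ^+ 2)) ?exprn_gt0 ?rho_gt0 //.
  by rewrite /u /v in hu v1 *; lra.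
case: c c0 epsE h2 {cE h1 hu hv u v v0 v1} => // c _ epsE h2.
case: d d0 epsE h2 {dE} => // d d0 epsE h2.
by exists c, d; split => //; clear -h2; lia.
Qed.

(** In the second case of [pell_factor], eps would be the square of a unit of k, so 1 = 2 j for the
    exponents. *)
Lemma eps_pi : exists a b : nat, [/\ (0 < a)%N, (0 < b)%N,
  a%:Z * a%:Z - p%:Z * (b%:Z * b%:Z) = 2 &
  eps = zk (a%:Z * a%:Z - 1) (a%:Z * b%:Z)].
Proof.
have [x [y [epsE y0 xy]]] := eps_coord.
case: (pell_factor p_prime p_mod y0 xy) => [[a [b [a0 b0 ab xE yE]]]|[m [n [n0 mn xE yE]]]].
  exists a, b; split=> //; first by clear -ab; lia.
  by rewrite epsE yE; congr (sqrt_int _ _ _); clear -xE; lia.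
have uv : is_unit kf (zk m%:Z n%:Z) by apply: zk_unit; clear -mn; lia.
have epsE' : eps = zk m%:Z n%:Z ^+ 2.
  by rewrite epsE xE yE expr2 (zkM r4); congr (sqrt_int _ _ _); clear; lia.
case: eps_fund => _ _ /(_ _ uv) [bb [j vE]].
have : eps ^ (1 : int) = eps ^ (j * 2).
  by rewrite -exprz_exp expr1z [LHS]epsE' vE exprMn sqrr_sign mul1r.
move/eps_exp_inj; clear; lia.
Qed.

Lemma sg_K x : x \in Kf -> sg x \in Kf.
Proof. exact: memv_gal. Qed.

(** The sign is positive: the image of the norm under s |-> - rho^2 is nonnegative, and its product
    with the real value of the norm is 1. *)
Lemma unit_norm u : is_unit Kf u -> exists n : int, u * sg u = eps ^ n.
Proof.
move=> uu; have [c [d [e [f [uE h]]]]] := unit_zK p_prime p_mod iota r4 sgG sgr uu.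
have NE : u * sg u = zk (X c d e f) (Y c d e f) by rewrite uE (sg_zK r4 sgG sgr) (zK_normE r4).
have uk : is_unit kf (u * sg u) by rewrite NE; apply: zk_unit.
case: eps_fund => _ _ /(_ _ uk) [b [n nE]]; exists n; rewrite nE.
have : 0 < re (u * sg u).
  rewrite NE re_zk.
  have hR : ((X c d e f)%:~R + (Y c d e f)%:~R * rho ^+ 2) *
     ((X c d e f)%:~R - (Y c d e f)%:~R * rho ^+ 2) = 1 :> algR.
    transitivity ((X c d e f * X c d e f - p%:Z * (Y c d e f * Y c d e f))%:~R : algR); last by rewrite h.
    ring: rho4.
  have : 0 <= (X c d e f)%:~R - (Y c d e f)%:~R * rho ^+ 2.
    by rewrite (norm_conj rho4) addr_ge0 ?sqr_ge0 // mulr_ge0 ?sqr_ge0.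
  move: hR; set s := _ + _; set t := _ - _ => st t0.
  by rewrite ltNge; apply/negP => s0; have := mulr_le0_ge0 s0 t0; rewrite st ler10.
rewrite nE; case: b {nE} => /=; last by rewrite expr0 mul1r.
rewrite expr1 mulN1r reN ?reXz ?eps_K //; last by case: n => n; rewrite ?NegzE -?exprnP -?exprnN ?rpredV rpredX ?eps_K.
by rewrite oppr_gt0 ltNge exprz_ge0 // ltW // re_eps_gt0.
Qed.

(** Multiplicative and trivial on k; a multiplicative stand-in for the relative regulator. *)
Definition ratio (x : L) : algR := `|re x| / `|re (sg x)|.

Lemma ratioM x y : x \in Kf -> y \in Kf -> ratio (x * y) = ratio x * ratio y.
Proof.
move=> xK yK; rewrite /ratio rmorphM reM // [re (sg _ * _)]reM ?sg_K // !normrM.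
by rewrite invfM mulrACA.
Qed.

Lemma ratioV x : x \in Kf -> ratio x^-1 = (ratio x)^-1.
Proof.
move=> xK; rewrite /ratio fmorphV reV // [re (sg _)^-1]reV ?sg_K // !normfV.
by rewrite invfM.
Qed.

Lemma ratioX x n : x \in Kf -> ratio (x ^+ n) = ratio x ^+ n.
Proof.
move=> xK; elim: n => [|n IH].
  by rewrite !expr0 /ratio rmorph1 re1 normr1 divr1.
by rewrite !exprS ratioM ?IH ?rpredX.
Qed.

Lemma ratioN x : x \in Kf -> ratio (- x) = ratio x.
Proof. by move=> xK; rewrite /ratio rmorphN reN // [re (- _)]reN ?sg_K // !normrN. Qed.

Lemma ratio_k x : x \in kf -> x != 0 -> ratio x = 1.
Proof.
move=> xk x0; rewrite /ratio (sg_k sgG xk) divff // normr_eq0 re_neq0 //.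
exact: kK.
Qed.

Lemma ratio_gt0 x : x \in Kf -> x != 0 -> 0 < ratio x.
Proof.
move=> xK x0; rewrite /ratio divr_gt0 // normr_gt0 re_neq0 ?sg_K //.
by rewrite fmorph_eq0.
Qed.

Lemma ratio_zK c d e f : ratio (zK c d e f) = `|ev c d e f| / `|ev c d (- e) (- f)|.
Proof. by rewrite /ratio (sg_zK r4 sgG sgr) !re_zK. Qed.

Let normq (q : int * int * int * int) : int := let: (c, d, e, f) := q in
  X c d e f * X c d e f - p%:Z * (Y c d e f * Y c d e f).
Let zq (q : int * int * int * int) : L := let: (c, d, e, f) := q in zK c d e f.

Let zq_norm q : exists2 z, ring_of_integers Kf z & zq q * z = (normq q)%:~R.
Proof.
case: q => [[[c d] e] f] /=; exists (zK c d (- e) (- f) * zk (X c d e f) (- Y c d e f)).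
  by apply: integersM; [apply: (zK_integer r4) | rewrite zK_zk; apply: (zK_integer r4)].
by rewrite [LHS]mulrA (zK_normE r4) (zkM r4) /sqrt_int; ring.
Qed.

Let congq (D : nat) (q q' : int * int * int * int) : Prop :=
  let: (c, d, e, f) := q in let: (c', d', e', f') := q' in
  [/\ (D%:Z %| c - c')%Z, (D%:Z %| d - d')%Z, (D%:Z %| e - e')%Z & (D%:Z %| f - f')%Z].

(** [zq q'] divides its norm, which divides D, which divides [zq q - zq q']. *)
Let zq_div q q' D : (0 < D)%N -> normq q' != 0 -> normq q = normq q' -> (`|normq q'| %| D)%N ->
  congq D q q' -> ring_of_integers Kf (zq q / zq q').
Proof.
move=> D0 n0 nn nD h.
have [z zi zE] := zq_norm q'.
have nL0 : (normq q')%:~R != 0 :> L by rewrite (intL_eq0 iota).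
have q0 : zq q' != 0 by apply: contraNneq nL0 => e; rewrite -zE e mul0r.
have [y yi yE] : exists2 y, ring_of_integers Kf y & zq q - zq q' = (normq q')%:~R * y.
  case: q q' nn h n0 nD {zE nL0 q0} => [[[c d] e] f] [[[c' d'] e'] f'] nn.
  set n := normq _ => -[h1 h2 h3 h4] n0 nD.
  have dv x : (D%:Z %| x)%Z -> exists m, x = n * m.
    move=> Dx; have : (n %| x)%Z by apply: dvdz_trans Dx; rewrite dvdzE.
    by case/dvdzP => m ->; exists m; rewrite mulrC.
  have [m1 e1] := dv _ h1; have [m2 e2] := dv _ h2.
  have [m3 e3] := dv _ h3; have [m4 e4] := dv _ h4.
  exists (zK m1 m2 m3 m4); first exact: (zK_integer r4).
  have -> : zq (c, d, e, f) - zq (c', d', e', f') = zK (c - c') (d - d') (e - e') (f - f').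
    by rewrite /zq /root_int /sqrt_int; ring.
  by rewrite e1 e2 e3 e4 /root_int /sqrt_int; ring.
have -> : zq q / zq q' = 1 + y * z.
  apply: (mulIf q0); rewrite divfK // mulrDl mul1r -mulrA [z * _]mulrC zE.
  by rewrite mulrC -yE addrC subrK.
by apply: integersD; [apply: integers1 | apply: integersM].
Qed.

Lemma exists_unit_ratio : exists2 u, is_unit Kf u & 1 < ratio u.
Proof.
have [C hC] := exists_large_ratio p_prime rho_gt1 rho4.
(* Divisible by every possible nonzero norm, these being at most C in absolute value. The class of q
   records its coordinates mod D and its norm, shifted by C to be a natural number. *)
pose D := C`!.
pose T := ('I_D.+1 * 'I_D.+1 * 'I_D.+1 * 'I_D.+1 * 'I_(2 * C).+1)%type.
pose res (x : int) : 'I_D.+1 := inord `|(x %% D%:Z)%Z|%N.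
pose cl (q : int * int * int * int) : T := let: (c, d, e, f) := q in
  (res c, res d, res e, res f, inord `|(normq q + C%:Z)%R|%N).
pose P q := normq q != 0 /\ `|normq q| <= C%:Z.
have D0 : (0 < D)%N by rewrite fact_gt0.
have D0' : D%:Z != 0 by rewrite -lt0n.
have resE x y : res x = res y -> (D%:Z %| x - y)%Z.
  have rb z : (`|(z %% D%:Z)%Z| < D.+1)%N.
    rewrite ltnS -lez_nat gez0_abs ?modz_ge0 //; apply: ltW.
    by rewrite ltz_pmod // ltz_nat.
  move/(congr1 (fun i : 'I_D.+1 => nat_of_ord i)); rewrite !inordK // => h.
  by rewrite -eqz_mod_dvd; move/(congr1 Posz): h; rewrite !gez0_abs ?modz_ge0 // => /eqP.
have [|q [q' [[q0 qC] [q0' qC'] clE h]]] := @pigeonhole_chain _ _ T P cl (fun q => ratio (zq q)).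
  move=> x; have [c [d [e [f [N0 NC h]]]]] := hC `|x|.
  exists (c, d, e, f) => //=; rewrite ratio_zK.
  have v0 : 0 < `|ev c d (- e) (- f)|.
    rewrite normr_gt0 -re_zK re_neq0 ?zK_K //.
    apply: contraNneq N0 => /(zK_eq0 p_prime iota r4)[-> -> /eqP + /eqP].
    by rewrite !oppr_eq0 => /eqP -> /eqP ->; apply/eqP; rewrite /normX /normY; ring.
  rewrite ltr_pdivlMr //; apply: le_lt_trans h.
  by rewrite ler_pM2r // ler_norm.
have nn : normq q = normq q'.
  have : (inord `|(normq q + C%:Z)%R|%N : 'I_(2 * C).+1) = inord `|(normq q' + C%:Z)%R|%N.
    by case: q q' clE {q0 qC q0' qC' h} => [[[c d] e] f] [[[c' d'] e'] f'] /= [_ _ _ _ ].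
  move/(congr1 (fun i : 'I_(2 * C).+1 => nat_of_ord i)).
  rewrite !inordK; move: qC qC'; move: (normq q) (normq q') => m n; clear; lia.
have nD : (`|normq q'| %| D)%N.
  apply: dvdn_fact; move: q0' qC'; move: (normq q') => n; clear; lia.
have cc : congq D q q'.
  case: q q' clE {q0 qC q0' qC' h nn nD} => [[[c d] e] f] [[[c' d'] e'] f'] /=.
  by case=> /resE ? /resE ? /resE ? /resE ? _.
have cc' : congq D q' q.
  have sw x y : (D%:Z %| x - y)%Z -> (D%:Z %| y - x)%Z by rewrite -opprB rpredN.
  case: q q' cc {clE q0 qC q0' qC' h nn nD} => [[[c d] e] f] [[[c' d'] e'] f'] /=.
  by case=> /sw ? /sw ? /sw ? /sw ?.
have zq0 x : normq x != 0 -> zq x != 0.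
  move=> n0; have [z _ zE] := zq_norm x.
  by apply: contraNneq n0 => e; rewrite -(intL_eq0 iota) -zE e mul0r.
have zqK x : zq x \in Kf by case: x => [[[c d] e] f]; apply: zK_K.
exists (zq q / zq q').
  split; first by rewrite mulf_neq0 ?invr_eq0 ?zq0.
    exact: zq_div D0 q0' nn nD cc.
  by rewrite invf_div; apply: (zq_div D0 q0 (esym nn) _ cc'); rewrite nn.
by rewrite ratioM ?rpredV // ratioV // ltr_pdivlMr ?mul1r // ratio_gt0 ?zq0.
Qed.

Lemma eps_exp_unit n : is_unit kf (eps ^ n).
Proof. exact: unitXz eps_unit. Qed.

Lemma sg_eps_exp n : sg (eps ^ n) = eps ^ n.
Proof. by apply: (sg_k sgG); apply: unit_mem (eps_exp_unit n). Qed.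

Lemma mul_eps u n : is_unit Kf u -> [/\ is_unit Kf (u * eps ^ n),
  ratio (u * eps ^ n) = ratio u & u * eps ^ n * sg (u * eps ^ n) = u * sg u * eps ^ (n * 2)].
Proof.
move=> uu; have eu := eps_exp_unit n; have ek := unit_kK eu; split.
- exact: unitM.
- by rewrite ratioM ?unit_mem // (ratio_k (unit_mem eu)) ?mulr1 //; case: eu.
- by rewrite rmorphM /= sg_eps_exp -exprz_exp; ring.
Qed.

Lemma normalize_norm u : is_unit Kf u -> exists n : int,
  u * eps ^ n * sg (u * eps ^ n) = 1 \/ u * eps ^ n * sg (u * eps ^ n) = eps.
Proof.
move=> uu; have [n nE] := unit_norm uu; exists (- (n %/ 2)%Z).
have [_ _ ->] := mul_eps (- (n %/ 2)%Z) uu; rewrite nE -expfzDr ?eps0 //.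
have [->|->] : n + - (n %/ 2)%Z * 2 = 0 \/ n + - (n %/ 2)%Z * 2 = 1 by clear; lia.
  by left; rewrite expr0z.
by right; rewrite expr1z.
Qed.

(** A power of eps brings the norm to 1 or eps without changing the ratio. By [coord_bound], the
    ratios in (1, M] are then those of finitely many quadruples. *)
Lemma minimal_unit : exists u0, [/\ is_unit Kf u0, 1 < ratio u0 &
  forall u, is_unit Kf u -> 1 < ratio u -> ratio u0 <= ratio u].
Proof.
have [u1 u1u u1r] := exists_unit_ratio.
set M := ratio u1 in u1r; pose E := re eps.
have E1 : 1 <= E by apply: ltW; apply: re_eps.
have M1 : 1 <= M by apply: ltW.
pose B := Num.Def.archi_bound (3 + E + M * E).
have BE : 3 + E + M * E < B%:R.
  have E0 := le_trans ler01 E1; have M0 := le_trans ler01 M1.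
  exact: archi_boundP (addr_ge0 (addr_ge0 (ler0n _ 3) E0) (mulr_ge0 M0 E0)).
pose rng : seq int := [seq i%:Z - B%:Z | i <- seq.iota 0 (2 * B).+1].
have rngP (x : int) : `|x%:~R : algR| <= 3 + E + M * E -> x \in rng.
  move=> xb; have : `|x| <= B%:Z.
    by rewrite -(ler_int algR) intr_norm; apply: le_trans xb (ltW BE).
  move=> h; apply/mapP; exists `|(x + B%:Z)%R|%N; last by clear -h; lia.
  by rewrite mem_iota; clear -h; lia.
pose pr := [seq (x, y) | x <- rng, y <- rng].
pose qs := [seq (x, y) | x <- pr, y <- pr].
pose zz (q : (int * int) * (int * int)) := zK q.1.1 q.1.2 q.2.1 q.2.2.
pose nn (q : (int * int) * (int * int)) :=
  X q.1.1 q.1.2 q.2.1 q.2.2 * X q.1.1 q.1.2 q.2.1 q.2.2 -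
  p%:Z * (Y q.1.1 q.1.2 q.2.1 q.2.2 * Y q.1.1 q.1.2 q.2.1 q.2.2).
pose s := [seq q <- qs | (nn q == 1) && (1 < ratio (zz q))].
have sP u : is_unit Kf u -> 1 < ratio u -> ratio u <= M ->
    exists2 q, q \in s & ratio (zz q) = ratio u.
  move=> uu ur uM; have [n hn] := normalize_norm uu.
  have [vu vr vN] := mul_eps n uu; set v := u * eps ^ n in hn vu vr vN.
  have [c [d [e [f [vE h]]]]] := unit_zK p_prime p_mod iota r4 sgG sgr vu.
  exists ((c, d), (e, f)); last by rewrite /zz /= -vE.
  rewrite mem_filter /nn /zz /= h eqxx -vE vr ur /=.
  have NE : v * sg v = zk (X c d e f) (Y c d e f).
    by rewrite vE (sg_zK r4 sgG sgr) (zK_normE r4).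
  have nb : 1 <= (X c d e f)%:~R + (Y c d e f)%:~R * rho ^+ 2 <= E.
    rewrite -re_zk -NE; case: hn => ->; first by rewrite re1 lexx E1.
    by rewrite lexx E1.
  have v0 : 0 < `|ev c d (- e) (- f)|.
    rewrite normr_gt0 -re_zK -(sg_zK r4 sgG sgr) -vE re_neq0 ?sg_K ?unit_mem //.
    by rewrite fmorph_eq0; case: vu.
  have rb : `|ev c d (- e) (- f)| <= `|ev c d e f| <= M * `|ev c d (- e) (- f)|.
    apply/andP; split; last by rewrite -ler_pdivrMr // -ratio_zK -vE vr.
    by rewrite -[leLHS]mul1r -ler_pdivlMr // -ratio_zK -vE vr ltW.
  have [hc hd he hf] := coord_bound rho_gt1 rho4 E1 M1 h nb rb.
  by rewrite /qs /pr; apply: allpairs_f; apply: allpairs_f; apply: rngP.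
have [q1 q1s _] := sP u1 u1u u1r (lexx M).
have [q qin qm] := seq_min (fun q => ratio (zz q)) q1s.
move: (qin); rewrite mem_filter => /andP[/andP[/eqP qN qr] _].
exists (zz q); split=> //; first exact: (zK_unit r4 qN).
move=> u uu ur; case: (lerP (ratio u) M) => uM.
  by have [q' q's <-] := sP u uu ur uM; apply: qm.
apply: le_trans (ltW uM); have [q' q's e] := sP u1 u1u u1r (lexx M).
by apply: le_trans (qm _ q's) _; rewrite e.
Qed.

(** Here u is sg u or - sg u. In the first case u lies in k; in the second u = B r, and p would
    divide its norm 1. *)
Lemma ratio1_unit u : is_unit Kf u -> ratio u = 1 -> exists (b : bool) (n : int), u = (-1) ^+ b * eps ^ n.
Proof.
move=> uu; have uK := unit_mem uu; have u0 : u != 0 by case: uu.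
have [c [d [e [f [uE h]]]]] := unit_zK p_prime p_mod iota r4 sgG sgr uu.
have s0 : `|re (sg u)| != 0 by rewrite normr_eq0 re_neq0 ?sg_K // fmorph_eq0.
move/(congr1 (fun x => x * `|re (sg u)|)); rewrite /ratio divfK // mul1r.
move/eqP; rewrite eqr_norm2 => /orP[] /eqP.
  move/(re_inj uK (sg_K uK)) => su; have : zK c d e f = zK c d (- e) (- f).
    by rewrite -(sg_zK r4 sgG sgr) -uE.
  case/(zK_inj p_prime iota r4) => _ _ e1 e2.
  have uk : is_unit kf u.
    apply: unit_Kk => //; rewrite uE; have -> : e = 0 by clear -e1; lia.
    have -> : f = 0 by clear -e2; lia.
    by rewrite -zK_zk; apply: (proj1 (zk_int r4 c d)).
  by case: eps_fund => _ _ /(_ u uk).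
rewrite -reN ?sg_K // => /(re_inj uK); rewrite rpredN sg_K // => /(_ isT) su.
have : zK c d e f = zK (- c) (- d) e f.
  by rewrite -uE su uE (sg_zK r4 sgG sgr) /root_int /sqrt_int; ring.
case/(zK_inj p_prime iota r4) => c1 d1 _ _; exfalso.
have c0 : c = 0 by clear -c1; lia.
have d0 : d = 0 by clear -d1; lia.
have : (p%:Z %| 1)%Z.
  apply/dvdzP; exists (4 * p%:Z * (e * f) * (e * f) - (Y c d e f * Y c d e f)).
  by apply: etrans (esym h) _; rewrite /normX /normY c0 d0; ring.
by rewrite dvdzE /= dvdn1 => /eqP p1; move: p_mod; rewrite p1.
Qed.

(** * Descent for units of norm 1, then the trace and the congruence *)

Section Pi.
Variables a b : int.
Hypotheses (a0 : 0 < a) (b0 : 0 < b) (ab2 : a * a - p%:Z * (b * b) = 2).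
Hypothesis epsE : eps = zk (a * a - 1) (a * b).
Local Notation pi := (zk a b).

Lemma pi_sqr : pi ^+ 2 = 2 * eps.
Proof.
rewrite epsE expr2 (zkM r4); have -> : p%:Z * (b * b) = a * a - 2 by clear -ab2; lia.
by rewrite /sqrt_int; ring.
Qed.

Lemma two0 : 2 != 0 :> L.
Proof. by rewrite -[2]/((2 : int)%:~R) (intL_eq0 iota). Qed.

Lemma pi0 : pi != 0.
Proof. have : pi ^+ 2 != 0 by rewrite pi_sqr mulf_neq0 ?two0 ?eps0.
by rewrite expf_eq0. Qed.

Lemma zk_real_pos (c d n : int) : 0 < n -> c * c - p%:Z * (d * d) = n ->
  0 < c%:~R + d%:~R * rho ^+ 2 -> 0 < c.
Proof.
move=> n0 cn; rewrite -(ltr0z algR) => h.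
have e : (c%:~R + d%:~R * rho ^+ 2) * (c%:~R - d%:~R * rho ^+ 2) = n%:~R :> algR.
  by rewrite -cn; ring: rho4.
have : 0 < c%:~R - d%:~R * rho ^+ 2 :> algR by rewrite -(pmulr_rgt0 _ h) e ltr0z.
by lra.
Qed.

(** An element z of k whose norm is a square x3^2 is a square up to a rational factor, since z^2 - 2
    x1 z + x3^2 = 0. *)
Lemma norm_sqr_complete (x1 x2 x3 : int) : x1 * x1 - p%:Z * (x2 * x2) = x3 * x3 ->
  (2 * x1 + 2 * x3)%:~R * zk x1 x2 = (zk x1 x2 + x3%:~R) ^+ 2.
Proof.
move=> /(congr1 (fun n : int => n%:~R : L)).
rewrite /sqrt_int !(rmorphM, rmorphB, rmorphD) /= -[p%:Z%:~R]/(p%:R) -r4 => h.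
apply/eqP; rewrite -subr_eq0; apply/eqP.
transitivity (x1%:~R * x1%:~R - r ^+ 4 * (x2%:~R * x2%:~R) - x3%:~R * x3%:~R : L); first by ring.
by rewrite h subrr.
Qed.

Lemma descent_rational u : is_unit Kf u -> u * sg u = 1 -> 0 < re u ->
  exists (i : bool) (T : nat) v, [/\ (0 < T)%N, v \in Kf & u * T%:R * pi ^+ i = v ^+ 2].
Proof.
move=> uu uN u0; have [c [d [e [f [uE h]]]]] := unit_zK p_prime p_mod iota r4 sgG sgr uu.
have [E1 E2] : X c d e f = 1 /\ Y c d e f = 0.
  apply: (zk_inj p_prime iota r4); rewrite -(zK_normE r4) -(sg_zK r4 sgG sgr) -uE uN /sqrt_int; ring.
have s0 : 0 < re (sg u).
  by rewrite -(pmulr_rgt0 _ u0) -reM ?sg_K ?unit_mem // uN re1.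
set th := zk (c + 1) d.
have uth : u * (2 * th) = (1 + u) ^+ 2.
  have tr : u + sg u = 2 * zk c d by rewrite uE (sg_zK r4 sgG sgr) /root_int /sqrt_int; ring.
  have -> : 2 * th = u + sg u + 2 by rewrite tr /th /sqrt_int; ring.
  by rewrite !mulrDr uN; ring.
have A0 : 0 < c%:~R + d%:~R * rho ^+ 2 :> algR.
  rewrite -re_zk -(pmulr_rgt0 _ (ltr0n _ 2 : 0 < 2%:R)).
  have -> : 2%:R * re (zk c d) = re u + re (sg u).
    rewrite -reD ?sg_K ?unit_mem // uE (sg_zK r4 sgG sgr).
    have -> : zK c d e f + zK c d (- e) (- f) = zk c d + zk c d by rewrite /root_int /sqrt_int; ring.
    by rewrite [RHS]reD ?zk_K // mulr_natl mulr2n.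
  exact: addr_gt0.
have a1 : -1 <= c%:~R - d%:~R * rho ^+ 2 :> algR.
  have := norm_conj rho4 c d e f; rewrite E1 E2 mulr0z mul0r subr0 mulr1z.
  have := mulr_ge0 (sqr_ge0 rho) (sqr_ge0 (e%:~R - f%:~R * rho ^+ 2)).
  exact: sqr_le1_ge.
(* The conjugates 1 + A and 1 + A' of theta are positive and nonnegative, as A > 0 and A'^2 <= 1;
   the norm is not 0 because sqrt p is irrational. *)
have P0 : 0 < (c + 1) * (c + 1) - p%:Z * (d * d).
  rewrite lt_def; apply/andP; split.
    apply/eqP => /subr0_eq/(sqr_irrational p_prime)[c1 d0].
    move: A0; rewrite d0 mul0r addr0 ltr0z; clear -c1; lia.
  rewrite -(ler0z algR).
  have -> : ((c + 1) * (c + 1) - p%:Z * (d * d))%:~R =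
    (1 + (c%:~R + d%:~R * rho ^+ 2)) * (1 + (c%:~R - d%:~R * rho ^+ 2)) :> algR by ring: rho4.
  by apply: mulr_ge0; lra.
have c10 : 0 < c + 1.
  apply: (zk_real_pos P0 (erefl _)); rewrite rmorphD /=; lra.
have [s hs [m m0 PE]] := theta_norm p_prime p_mod E1 E2 P0.
have th0 : th != 0.
  apply/eqP => /(zk_eq0 p_prime iota r4)[h1 h2]; move: c10; rewrite h1; clear; lia.
have thK : th \in Kf by apply: zk_K.
have uK := unit_mem uu.
case/orP: hs => /eqP sE; rewrite sE in PE.
  exists false, (absz (2 * (2 * (c + 1) + 2 * m))), ((1 + u) * (th + m%:~R) / th); split.
  - by rewrite absz_gt0; clear -c10 m0; lia.
  - by rewrite rpredM ?rpredV // rpredM // rpredD // ?rpred1 // rpred_int.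
  have -> : (absz (2 * (2 * (c + 1) + 2 * m)))%:R = 2 * (2 * (c + 1) + 2 * m)%:~R :> L.
    rewrite -[_%:R]/((absz (2 * (2 * (c + 1) + 2 * m)))%:Z%:~R) gez0_abs ?rmorphM //.
    by clear -c10 m0; lia.
  have tE : (2 * (c + 1) + 2 * m)%:~R * th = (th + m%:~R) ^+ 2.
    by apply: norm_sqr_complete; rewrite PE mul1r.
  rewrite expr0 mulr1 !exprMn exprVn -uth -tE; field; exact: th0.
(* When the norm of theta is 2 m^2, that of pi theta is (2 m)^2, and the same completion of the
   square applies to it. *)
set y := zk (a * (c + 1) + p%:Z * (b * d)) (a * d + b * (c + 1)).
have yE : y = pi * th by rewrite /y /th (zkM r4).
have y0 : y != 0 by rewrite yE mulf_neq0 ?pi0.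
set g := a * (c + 1) + p%:Z * (b * d).
have yN : g * g - p%:Z * ((a * d + b * (c + 1)) * (a * d + b * (c + 1))) = (2 * m) * (2 * m).
  have -> : g * g - p%:Z * ((a * d + b * (c + 1)) * (a * d + b * (c + 1))) =
    (a * a - p%:Z * (b * b)) * ((c + 1) * (c + 1) - p%:Z * (d * d)) by rewrite /g; ring.
  by rewrite ab2 PE; ring.
have g0 : 0 < g.
  have m20 : 0 < 2 * m * (2 * m) by clear -m0; nia.
  apply: (zk_real_pos m20 yN); rewrite -re_zk -/y yE reM ?zk_K // !re_zk.
  have bb : 0 <= b%:~R * rho ^+ 2 by rewrite mulr_ge0 ?sqr_ge0 // ler0z ltW.
  have aa : 0 < a%:~R :> algR by rewrite ltr0z.
  by apply: mulr_gt0; rewrite ?rmorphD /=; lra.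
exists true, (absz (2 * (2 * g + 2 * (2 * m)))), ((1 + u) * (y + (2 * m)%:~R) / th); split.
- by rewrite absz_gt0; clear -g0 m0; lia.
- have yK : y \in Kf by apply: zk_K.
  by rewrite rpredM ?rpredV // rpredM // rpredD // ?rpred1 // rpred_int.
have -> : (absz (2 * (2 * g + 2 * (2 * m))))%:R = 2 * (2 * g + 2 * (2 * m))%:~R :> L.
  rewrite -[_%:R]/((absz (2 * (2 * g + 2 * (2 * m))))%:Z%:~R) gez0_abs ?rmorphM //.
  by clear -g0 m0; lia.
have tE : (2 * g + 2 * (2 * m))%:~R * y = (y + (2 * m)%:~R) ^+ 2.
  exact: norm_sqr_complete.
rewrite expr1 !exprMn exprVn -uth -tE yE; field; exact: th0.
Qed.

Lemma zK_sqr c d e f : zK c d e f ^+ 2 =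
  zK (c * c + p%:Z * (d * d) + 2 * (p%:Z * (e * f))) (2 * (c * d) + e * e + p%:Z * (f * f))
     (2 * (c * e + p%:Z * (d * f))) (2 * (c * f + d * e)).
Proof. rewrite /root_int /sqrt_int; ring: r4. Qed.

Lemma prime_dvd_sqr_k (l : nat) (g h : int) : prime l -> l != 2%N -> l != p ->
  (l%:Z %| g * g + p%:Z * (h * h))%Z -> (l%:Z %| 2 * (g * h))%Z ->
  (l%:Z %| g)%Z /\ (l%:Z %| h)%Z.
Proof.
move=> pl l2 lp d1; rewrite !Euclid_dvdz // [(_ %| 2)%Z]dvdzE dvdn_prime2 // (negbTE l2) /=.
have lpN : (l%:Z %| p%:Z)%Z = false by rewrite dvdzE /= dvdn_prime2 // (negbTE lp).
have gh : (l%:Z %| g)%Z = (l%:Z %| h)%Z.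
  apply/idP/idP => dl.
    have : (l%:Z %| p%:Z * (h * h))%Z.
      have -> : p%:Z * (h * h) = g * g + p%:Z * (h * h) - g * g by ring.
      by rewrite rpredB // dvdz_mulr.
    by rewrite !Euclid_dvdz // lpN orbb.
  have : (l%:Z %| g * g)%Z.
    have -> : g * g = g * g + p%:Z * (h * h) - p%:Z * (h * h) by ring.
    by rewrite rpredB // !dvdz_mull.
  by rewrite Euclid_dvdz // orbb.
by rewrite gh orbb => dl.
Qed.

(* As [l] is unramified in [Kf], an integer whose square is divisible by [l] is
   divisible by [l]; with [v = A + B r], the sum and the difference of the
   components [A^2 + w B^2] and [A^2 - w B^2] recover [A^2] and [w B^2]. *)
Lemma prime_dvd_sqr_K (l : nat) (c d e f : int) : prime l -> l != 2%N -> l != p ->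
  (l%:Z %| (c * c + p%:Z * (d * d)) + 2 * (p%:Z * (e * f)))%Z ->
  (l%:Z %| 2 * (c * d) + e * e + p%:Z * (f * f))%Z ->
  (l%:Z %| 2 * (c * e + p%:Z * (d * f)))%Z -> (l%:Z %| 2 * (c * f + d * e))%Z ->
  [/\ (l%:Z %| c)%Z, (l%:Z %| d)%Z, (l%:Z %| e)%Z & (l%:Z %| f)%Z].
Proof.
move=> pl l2 lp; set S1 := _ + _; set S2 := _ + p%:Z * (f * f).
set T1 := 2 * (_ + p%:Z * _); set T2 := 2 * (c * f + _) => dS1 dS2 dT1 dT2.
have l2' : (l%:Z %| 2)%Z = false by rewrite dvdzE /= dvdn_prime2 // (negbTE l2).
have lpN : (l%:Z %| p%:Z)%Z = false by rewrite dvdzE /= dvdn_prime2 // (negbTE lp).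
(* The square of N(v) is N(v^2), which l divides. *)
have [dX dY] : (l%:Z %| X c d e f)%Z /\ (l%:Z %| Y c d e f)%Z.
  apply: prime_dvd_sqr_k => //.
    have -> : X c d e f * X c d e f + p%:Z * (Y c d e f * Y c d e f) =
      S1 * S1 + p%:Z * (S2 * S2) - 2 * p%:Z * (T1 * T2).
      by rewrite /normX /normY /S1 /S2 /T1 /T2; ring.
    apply: rpredB; last exact/dvdz_mull/dvdz_mulr.
    by apply: rpredD; [apply: dvdz_mulr | apply/dvdz_mull/dvdz_mulr].
  have -> : 2 * (X c d e f * Y c d e f) = 2 * (S1 * S2) - (T1 * T1 + p%:Z * (T2 * T2)).
    by rewrite /normX /normY /S1 /S2 /T1 /T2; ring.
  apply: rpredB; first exact/dvdz_mull/dvdz_mulr.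
  by apply: rpredD; [apply: dvdz_mulr | apply/dvdz_mull/dvdz_mulr].
have half x : (l%:Z %| 2 * x)%Z -> (l%:Z %| x)%Z by rewrite Euclid_dvdz // l2'.
have [dc dd] : (l%:Z %| c)%Z /\ (l%:Z %| d)%Z.
  apply: prime_dvd_sqr_k => //; apply: half.
    have -> : 2 * (c * c + p%:Z * (d * d)) = S1 + X c d e f by rewrite /normX /S1; ring.
    by rewrite rpredD.
  have -> : 2 * (2 * (c * d)) = S2 + Y c d e f by rewrite /normY /S2; ring.
  by rewrite rpredD.
have [df de] : (l%:Z %| e)%Z /\ (l%:Z %| f)%Z.
  apply: prime_dvd_sqr_k => //.
    have -> : e * e + p%:Z * (f * f) = S2 - 2 * (c * d) by rewrite /S2; ring.
    by apply: rpredB => //; apply/dvdz_mull/dvdz_mulr.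
  have : (l%:Z %| p%:Z * (2 * (e * f)))%Z.
    have -> : p%:Z * (2 * (e * f)) = S1 - (c * c + p%:Z * (d * d)) by rewrite /S1; ring.
    by apply: rpredB => //; apply: rpredD; [apply: dvdz_mulr | apply/dvdz_mull/dvdz_mulr].
  by rewrite Euclid_dvdz // lpN.
by [].
Qed.

(** In u T pi^i = v^2 the integer T is reduced to 1 or 2. If i = 0, then 2 = pi^2 / eps absorbs the
    rest. If i = 1, the norm of v is s' pi, whose first coordinate s' a would be a square mod p,
    against [jac_pi]. *)
Lemma unit_descent u : is_unit Kf u -> u * sg u = 1 -> 0 < re u ->
  exists v (j : int), is_unit Kf v /\ u = eps ^ j * v ^+ 2.
Proof.
move=> uu uN u0; have [i [T [v [T0 vK uv]]]] := descent_rational uu uN u0.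
have uK := unit_mem uu; have un0 : u != 0 by case: uu.
have KI := integers_K p_prime p_mod iota r4 sgG sgr.
have [a' [b' [piE nab]]] : exists a' b', pi ^+ i = zk a' b' /\
    (a' * a' - p%:Z * (b' * b') = 1 \/ a' * a' - p%:Z * (b' * b') = 2).
  case: (i); first by exists a, b; split; [rewrite expr1 | right].
  exists 1, 0; split; last by left; ring.
  by rewrite expr0 /sqrt_int; ring.
have [s [m [Tsm m0 sf _]]] := sqfree_part T0.
have s0 : (0 < s)%N by case: s Tsm {sf} => // e; rewrite e in T0.
have mL0 : m%:R != 0 :> L by rewrite -[m%:R]/(m%:Z%:~R) (intL_eq0 iota) -lt0n.
set v1 := v / m%:R.
have v1K : v1 \in Kf by rewrite rpred_div ?rpred_nat.
have uv1 : u * s%:R * pi ^+ i = v1 ^+ 2.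
  by rewrite /v1 exprMn exprVn -uv Tsm !natrM; field.
(* Another prime l of s would divide v1, so l^2 would divide s pi^i. The norm of pi^i is 1 or 2,
   hence l^2 would divide s itself. *)
have s4 : s \in [:: 1; 2; p; 2 * p]%N.
  apply: sqfree_in2 => // l pl ls; case: (eqVneq l 2%N) => [->|l2]; first by left.
  case: (eqVneq l p) => [->|lp]; first by right.
  exfalso; case/dvdnP: ls => s1 sE.
  have /KI[g1 [g2 [g3 [g4 gE]]]] : ring_of_integers Kf (u * (zk s1 0 * pi ^+ i)).
    apply: integersM; first by case: uu.
    by rewrite piE (zkM r4) zK_zk; apply: (zK_integer r4).
  have v1E : v1 ^+ 2 = zK (l%:Z * g1) (l%:Z * g2) (l%:Z * g3) (l%:Z * g4).
    have -> : zK (l%:Z * g1) (l%:Z * g2) (l%:Z * g3) (l%:Z * g4) = l%:R * zK g1 g2 g3 g4.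
      by rewrite /root_int /sqrt_int -[l%:R]/(l%:Z%:~R); ring.
    rewrite -gE -uv1 sE natrM /sqrt_int -[s1%:R]/(s1%:Z%:~R); ring.
  have /KI[c [d [e [f vE]]]] : ring_of_integers Kf v1.
    by apply: integers_sqrt => //; rewrite v1E; apply: (zK_integer r4).
  move: (v1E); rewrite vE zK_sqr => /(zK_inj p_prime iota r4)[e1 e2 e3 e4].
  have [] := @prime_dvd_sqr_K l c d e f pl l2 lp; rewrite ?e1 ?e2 ?e3 ?e4 ?dvdz_mulr //.
  move=> /dvdzP[c1 cE] /dvdzP[d1 dE] /dvdzP[f1 fE] /dvdzP[h1 hE].
  set v2 := zK c1 d1 f1 h1.
  have v1v2 : v1 = l%:R * v2.
    by rewrite vE cE dE fE hE /v2 /root_int /sqrt_int -[l%:R]/(l%:Z%:~R); ring.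
  have lL0 : l%:R != 0 :> L by rewrite -[l%:R]/(l%:Z%:~R) (intL_eq0 iota) -lt0n prime_gt0.
  have /KI[q1 [q2 [q3 [q4 qE]]]] : ring_of_integers Kf (u^-1 * v2 ^+ 2).
    by apply: integersM; [case: uu | rewrite zK_sqr; apply: (zK_integer r4)].
  have : zk s1 0 * zk a' b' = l%:R * (u^-1 * v2 ^+ 2).
    apply: (mulfI lL0); apply: (mulfI un0).
    transitivity (v1 ^+ 2); first by rewrite -uv1 -piE sE natrM /sqrt_int -[s1%:R]/(s1%:Z%:~R); ring.
    by rewrite v1v2; field.
  have -> : l%:R * (u^-1 * v2 ^+ 2) = zK (l%:Z * q1) (l%:Z * q2) (l%:Z * q3) (l%:Z * q4).
    by rewrite qE /root_int /sqrt_int -[l%:R]/(l%:Z%:~R); ring.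
  rewrite (zkM r4) zK_zk => /(zK_inj p_prime iota r4)[z1 z2 _ _].
  have : (l%:Z %| s1%:Z * (a' * a' - p%:Z * (b' * b')))%Z.
    apply/dvdzP; exists (a' * q1 - p%:Z * b' * q2).
    have -> : (a' * q1 - p%:Z * b' * q2) * l%:Z = a' * (l%:Z * q1) - p%:Z * b' * (l%:Z * q2) by ring.
    by rewrite -z1 -z2; ring.
  have -> : (l%:Z %| s1%:Z * (a' * a' - p%:Z * (b' * b')))%Z = (l%:Z %| s1%:Z)%Z.
    rewrite Euclid_dvdz //; case: nab => ->; rewrite [X in _ || X]dvdzE /=.
      by rewrite dvdn1 gtn_eqF ?prime_gt1 // orbF.
    by rewrite dvdn_prime2 // (negbTE l2) orbF.
  rewrite dvdzE /= => ls1; have := sf l pl.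
  by rewrite sE dvdn_mul.
(* p = w^2 is a square in K. *)
have [s' [v' [hs' v'K uv']]] : exists (s' : nat) v', [/\ s' = 1%N \/ s' = 2%N, v' \in Kf &
    u * s'%:R * pi ^+ i = v' ^+ 2].
  have w0 : w != 0.
    by apply: contraNneq (w_irrational p_prime iota r4) => ->; apply: rpred0.
  have wpE : (v1 / w) ^+ 2 * p%:R = v1 ^+ 2.
    by rewrite exprMn exprVn -r4 -[4%N]/(2 * 2)%N exprM divfK // expf_neq0.
  have p0 : p%:R != 0 :> L by rewrite -r4 -[4%N]/(2 * 2)%N exprM expf_neq0.
  have vwK : v1 / w \in Kf by rewrite rpred_div // kK // w_k.
  move: s4; rewrite !inE => /or4P[] /eqP sE.
  - by exists 1%N, v1; split; [left | | rewrite -uv1 sE].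
  - by exists 2%N, v1; split; [right | | rewrite -uv1 sE].
  - exists 1%N, (v1 / w); split; [by left | by [] |].
    by apply: (mulIf p0); rewrite wpE -uv1 sE; ring.
  - exists 2%N, (v1 / w); split; [by right | by [] |].
    by apply: (mulIf p0); rewrite wpE -uv1 sE natrM; ring.
have su K0 : K0 \in Kf -> forall j : int, u = eps ^ j * K0 ^+ 2 -> is_unit Kf K0.
  move=> K0K j e; apply: unit_sqrt => //.
  have -> : K0 ^+ 2 = eps ^ (- j) * u by rewrite e mulrA -expfzDr ?eps0 // addNr expr0z mul1r.
  by apply: unitM => //; apply: unit_kK; apply: eps_exp_unit.
case: (i) piE uv' => piE uv'; last first.
  rewrite expr0 mulr1 in uv'; case: hs' => sE; rewrite sE in uv'.
    have e : u = eps ^ 0 * v' ^+ 2 by rewrite expr0z mul1r -uv' mulr1.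
    by exists v', 0; split => //; apply: su e.
  have e : u = eps ^ 1 * (v' / pi) ^+ 2.
    rewrite expr1z exprMn exprVn pi_sqr -uv'; have := eps0; have := two0 => h1 h2; field.
    by apply/andP.
  by exists (v' / pi), 1; split => //; apply: su e; rewrite rpred_div ?zk_K.
exfalso; rewrite expr1 in uv'.
have s'0 : (0 < s')%N by case: hs' => ->.
have /KI[c [d [e [f vE]]]] : ring_of_integers Kf v'.
  apply: integers_sqrt => //; rewrite -uv'; apply: integersM; last by rewrite zK_zk; apply: (zK_integer r4).
  apply: integersM; first by case: uu.
  by have -> : s'%:R = zK s' 0 0 0 by [rewrite /root_int /sqrt_int -[s'%:R]/(s'%:Z%:~R); ring]; apply: (zK_integer r4).
have NE : v' * sg v' = zk (X c d e f) (Y c d e f) by rewrite vE (sg_zK r4 sgG sgr) (zK_normE r4).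
have spi : s'%:R * pi = zk (s'%:Z * a) (s'%:Z * b).
  by rewrite /sqrt_int -[s'%:R]/(s'%:Z%:~R); ring.
have sgpi : sg (s'%:R * pi) = s'%:R * pi.
  by rewrite spi; apply: (sg_k sgG); apply: (proj1 (zk_int r4 _ _)).
have N2 : (v' * sg v') ^+ 2 = (s'%:R * pi) ^+ 2.
  rewrite exprMn -rmorphXn -uv' -mulrA rmorphM /= sgpi.
  have -> : u * (s'%:R * pi) * (sg u * (s'%:R * pi)) = (u * sg u) * (s'%:R * pi) ^+ 2 by ring.
  by rewrite uN mul1r.
(* The sign of N(v') is again read off under s |-> - rho^2, where pi, of norm 2, stays positive. *)
have XE : X c d e f = s'%:Z * a.
  move/eqP: N2; rewrite eqf_sqr => /orP[] /eqP; rewrite NE spi.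
    by case/(zk_inj p_prime iota r4).
  have -> : - zk (s'%:Z * a) (s'%:Z * b) = zk (- (s'%:Z * a)) (- (s'%:Z * b)) by rewrite /sqrt_int; ring.
  case/(zk_inj p_prime iota r4) => X1 Y1; exfalso.
  have : 0 <= (X c d e f)%:~R - (Y c d e f)%:~R * rho ^+ 2.
    by rewrite (norm_conj rho4) addr_ge0 ?sqr_ge0 // mulr_ge0 ?sqr_ge0.
  have := re_zk a b; rewrite X1 Y1.
  have ab : (a%:~R + b%:~R * rho ^+ 2) * (a%:~R - b%:~R * rho ^+ 2) = 2 :> algR.
    transitivity ((a * a - p%:Z * (b * b))%:~R : algR); last by rewrite ab2.
    by ring: rho4.
  have aR : 0 < a%:~R :> algR by rewrite ltr0z.
  have bR : 0 <= b%:~R * rho ^+ 2 by rewrite mulr_ge0 ?sqr_ge0 // ler0z ltW.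
  have abp : 0 < a%:~R + b%:~R * rho ^+ 2 :> algR by rewrite ltr_wpDr.
  have abm : 0 < a%:~R - b%:~R * rho ^+ 2 :> algR by rewrite -(pmulr_rgt0 _ abp) ab ltr0n.
  have sR : 0 < s'%:Z%:~R :> algR by rewrite ltr0z.
  have := mulr_gt0 sR abm; rewrite !rmorphN !rmorphM /=; lra.
have op : odd p by move: p_mod; clear; lia.
have aN : ~~ (p%:Z %| s'%:Z * a)%Z.
  have p2 : ~~ (p %| 2)%N by apply/negP => /dvdn_leq; move: p_mod; clear; lia.
  rewrite Euclid_dvdz // negb_or; apply/andP; split.
    by rewrite dvdzE /=; case: hs' => -> //; rewrite dvdn1; apply/eqP => p1; move: p_mod; rewrite p1.
  apply: contra p2 => pa; have : (p%:Z %| a * a - p%:Z * (b * b))%Z by rewrite rpredB ?dvdz_mulr.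
  by rewrite ab2 dvdzE.
have dc : (p%:Z %| s'%:Z * a * (1 * 1) - c * c)%Z.
  by apply/dvdzP; exists (d * d - 2 * (e * f)); rewrite mulr1 -XE /normX; ring.
have cp : coprimez c p.
  have := coprimez_mod dc; rewrite coprimezMl [coprimez (1 * 1) _]coprime1n andbT.
  by rewrite [coprimez (c * c) _]coprimezMl andbb prime_coprimez // aN => <-.
have := jac_eq0 op cp dc; move: aN; rewrite -prime_coprimez // coprimezMl => /andP[sc ac].
rewrite jacM // (jac_pi p_prime p_mod ab2 a0) addbT.
by case: hs' => ->; rewrite ?jac1 // jac2 //; move: p_mod; clear; lia.
Qed.

Lemma minimal_generator : exists eta, [/\ is_unit Kf eta, 0 < re eta, eta * sg eta = eps,
  1 < ratio eta & forall u, is_unit Kf u -> 1 < ratio u -> ratio eta <= ratio u].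
Proof.
have [u0 [u0u u0r u0min]] := minimal_unit.
have [n nE] := normalize_norm u0u.
have [vu vr vN] := mul_eps n u0u; set v := u0 * eps ^ n in vu vr nE vN.
have vK := unit_mem vu.
have [y [yu yr y0 yN]] : exists y, [/\ is_unit Kf y, ratio y = ratio u0, 0 < re y &
    y * sg y = v * sg v].
  have : re v != 0 by apply: (re_neq0 vK); case: vu.
  rewrite neq_lt => /orP[] h; last by exists v.
  exists (- v); split.
  - exact: unitN.
  - by rewrite ratioN.
  - by rewrite reN ?oppr_gt0.
  - by rewrite rmorphN mulrNN.
case: nE => e; last by exists y; split; rewrite ?yr // yN.
exfalso; have [x [j [xu yE]]] := unit_descent yu (etrans yN e) y0.
have xK := unit_mem xu.
have xr : ratio x ^+ 2 = ratio u0.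
  rewrite -yr yE ratioM ?rpredX ?(kK (unit_mem (eps_exp_unit j))) //.
  by rewrite (ratio_k (unit_mem (eps_exp_unit j))) ?mul1r ?ratioX //; case: (eps_exp_unit j).
have x0 : 0 < ratio x by apply: ratio_gt0 => //; case: xu.
have x1 : 1 < ratio x by rewrite -[1 < _](@ltr_pXn2r _ 2) ?nnegrE ?ler01 ?ltW // expr1n xr.
by have := u0min x xu x1; rewrite -xr expr2 leNgt ltr_pMr // x1.
Qed.

(** Dividing by eta keeps a ratio above 1 at least 1, by minimality, and Bernoulli's inequality
    bounds the number of divisions. *)
Lemma ratio_power eta u : is_unit Kf eta -> 1 < ratio eta ->
  (forall u, is_unit Kf u -> 1 < ratio u -> ratio eta <= ratio u) ->
  is_unit Kf u -> exists m : int, ratio u = ratio eta ^ m.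
Proof.
move=> eu er emin; set g := ratio eta in er emin *.
have g0 : 0 < g by apply: lt_trans er.
have eK := unit_mem eu.
have ge1 n v : is_unit Kf v -> 1 <= ratio v -> ratio v < g ^+ n ->
    exists m : nat, ratio v = g ^+ m.
  elim: n v => [|n IH] v vu v1 vn.
    by move: vn; rewrite expr0 ltNge v1.
  move: v1; rewrite le_eqVlt => /orP[/eqP <-|v1]; first by exists 0%N.
  have vK := unit_mem vu.
  have rE : ratio (v * eta^-1) = ratio v / g by rewrite ratioM ?rpredV // ratioV.
  have [||| m mE] := IH (v * eta^-1).
  - by apply: unitM => //; apply: unitV.
  - by rewrite rE ler_pdivlMr // mul1r emin.
  - by rewrite rE ltr_pdivrMr // -exprSr.
  by exists m.+1; rewrite exprSr -mE rE divfK // gt_eqF.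
have bnd x : 0 <= x -> exists n, x < g ^+ n.
  move=> x0; have g1 : 0 < g - 1 by rewrite subr_gt0.
  have x0' : 0 <= x / (g - 1) by rewrite divr_ge0 // ltW.
  exists (Num.Def.archi_bound (x / (g - 1))).
  apply: lt_le_trans (bernoulli _ (ltW er)); have := archi_boundP x0'.
  by rewrite ltr_pdivrMr // => /lt_le_trans; apply; rewrite lerDr ler01.
have ge1' v : is_unit Kf v -> 1 <= ratio v -> exists m : nat, ratio v = g ^+ m.
  by move=> vu v1; have [n vn] := bnd _ (le_trans ler01 v1); apply: (ge1 n).
move=> uu; have uK := unit_mem uu; case: (lerP 1 (ratio u)) => u1.
  by have [m mE] := ge1' u uu u1; exists m%:Z.
have u0 : 0 < ratio u by apply: ratio_gt0 => //; case: uu.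
have [|m mE] := ge1' _ (unitV uu).
  by rewrite ratioV // invf_ge1 // ltW.
by exists (- m%:Z); rewrite -exprnN -mE ratioV // invrK.
Qed.

Lemma unit_generated eta u : is_unit Kf eta -> 1 < ratio eta ->
  (forall u, is_unit Kf u -> 1 < ratio u -> ratio eta <= ratio u) ->
  is_unit Kf u <-> exists m n l : int, u = eta ^ m * eps ^ n * (-1) ^ l.
Proof.
move=> eu er emin; split=> [uu|[m [n [l ->]]]]; last first.
  apply: unitM; last exact/unitXz/unitN/unit1.
  by apply: unitM; [apply: unitXz | apply/unit_kK/eps_exp_unit].
have [m mE] := ratio_power eu er emin uu.
have eK := unit_mem eu; have en0 : eta != 0 by case: eu.
have emu := unitXz m eu; have emK := unit_mem emu.
have rX : ratio (eta ^ m) = ratio eta ^ m.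
  case: (m) => j; rewrite ?NegzE -?exprnP -?exprnN ?ratioX //.
  by rewrite ratioV ?ratioX ?rpredX.
have [||b' [n uE]] := @ratio1_unit (u * (eta ^ m)^-1).
- by apply: unitM => //; apply: unitV.
- rewrite ratioM ?rpredV ?unit_mem // ratioV // rX mE divff //.
  by rewrite expfz_neq0 // gt_eqF // (lt_trans ltr01).
exists m, n, b'%:Z; apply: (mulIf (_ : (eta ^ m)^-1 != 0)); first by rewrite invr_eq0 expfz_neq0.
rewrite uE -exprnP; move: (expfz_neq0 m en0) => h; field; exact: h.
Qed.

(** sigma(r)^2 is a nonnegative square root of p, so sigma(r) is the image of r or of - r. *)
Lemma real_embedding_zK (sigma : {rmorphism subvs_of Kf -> algC}) c d e f :
  real_embedding sigma ->
  sigma (vsproj Kf (zK c d e f)) = iota (zK c d e f) \/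
  sigma (vsproj Kf (zK c d e f)) = iota (sg (zK c d e f)).
Proof.
move=> sR; set R := vsproj Kf r.
have rK : r \in Kf by apply: memv_adjoin.
have vE : vsproj Kf (zK c d e f) = c%:~R + d%:~R * R ^+ 2 + (e%:~R + f%:~R * R ^+ 2) * R.
  apply: val_inj; rewrite /= vsprojK ?zK_K //.
  by rewrite !(rmorphD, rmorphM, rmorphXn, rmorph_int) /= vsprojK.
have t4 : sigma R ^+ 4 = iota r ^+ 4.
  rewrite -!rmorphXn r4 rmorph_nat; have -> : R ^+ 4 = p%:R; last by rewrite rmorph_nat.
  by apply: val_inj; rewrite [LHS]rmorphXn [RHS]rmorph_nat /= vsprojK.
have t0 : 0 <= sigma R ^+ 2 by rewrite real_exprn_even_ge0 ?sR.
have s0 : 0 < iota r ^+ 2 by rewrite exprn_gt0.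
have : sigma R ^+ 2 = iota r ^+ 2.
  by apply/eqP; rewrite -(@eqrXn2 _ 2 (sigma R ^+ 2) (iota r ^+ 2) isT t0 (ltW s0)) -!exprM t4.
move/eqP; rewrite vE eqf_sqr => /orP[] /eqP tE; [left | right].
  by rewrite /root_int /sqrt_int !(rmorphD, rmorphM, rmorphXn, rmorph_int) /= tE.
rewrite (sg_zK r4 sgG sgr) /root_int /sqrt_int !(rmorphD, rmorphM, rmorphXn, rmorph_int) /= tE.
by ring.
Qed.

Lemma norm_sgn u : is_unit Kf u -> u * sg u = eps -> 0 < re u -> 0 < re (sg u).
Proof.
move=> uu uN u0; rewrite -(pmulr_rgt0 _ u0) -reM ?sg_K ?unit_mem // uN.
exact: re_eps_gt0.
Qed.

Lemma totally_positive_unit u : is_unit Kf u -> u * sg u = eps -> 0 < re u ->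
  totally_positive Kf u.
Proof.
move=> uu uN u0 sigma sR; have s0 := norm_sgn uu uN u0; have uK := unit_mem uu.
have [c [d [e [f [uE _]]]]] := unit_zK p_prime p_mod iota r4 sgG sgr uu.
have iu : 0 < iota u by rewrite -val_re.
have is0 : 0 < iota (sg u) by rewrite -val_re ?sg_K.
by move: iu is0; rewrite uE; case: (real_embedding_zK c d e f sR) => ->.
Qed.

Lemma unit_coord u : is_unit Kf u -> u * sg u = eps -> exists c d e f,
  [/\ u = zK c d e f, X c d e f = a * a - 1 & Y c d e f = a * b].
Proof.
move=> uu uN; have [c [d [e [f [uE _]]]]] := unit_zK p_prime p_mod iota r4 sgG sgr uu.
exists c, d, e, f.
have /(zk_inj p_prime iota r4)[h1 h2] : zk (X c d e f) (Y c d e f) = zk (a * a - 1) (a * b).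
  by rewrite -(zK_normE r4) -(sg_zK r4 sgG sgr) -uE uN.
by [].
Qed.

(** A is the mean of two positive numbers with product eps > 1, so A > 1, while its conjugate A'
    satisfies A'^2 <= 1 / eps < 1. Now 2 c = A + A' and 2 d s = A - A'. *)
Lemma unit_coord_pos c d e f : 0 < re (zK c d e f) ->
  X c d e f = a * a - 1 -> Y c d e f = a * b -> 0 < c /\ 0 < d.
Proof.
rewrite re_zK => u0 E1 E2.
have eE : re eps = (a * a - 1)%:~R + (a * b)%:~R * rho ^+ 2 by rewrite epsE re_zk.
have uN := ev_norm rho4 c d e f; rewrite E1 E2 -eE in uN.
have A' := norm_conj rho4 c d e f; rewrite E1 E2 in A'.
have eN : re eps * ((a * a - 1)%:~R - (a * b)%:~R * rho ^+ 2) = 1.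
  transitivity (((a * a - 1) * (a * a - 1) - a * a * (p%:Z * (b * b)))%:~R : algR).
    by rewrite eE; ring: rho4.
  have -> : p%:Z * (b * b) = a * a - 2 by move: ab2; clear; lia.
  by have -> : (a * a - 1) * (a * a - 1) - a * a * (a * a - 2) = 1 by ring.
have e1 := re_eps; have r2 : 0 < rho ^+ 2 by rewrite exprn_gt0 // rho_gt0.
have s2 := sqr_ge0 (e%:~R - f%:~R * rho ^+ 2).
have A2 : (c%:~R - d%:~R * rho ^+ 2) ^+ 2 < 1.
  have h : (a * a - 1)%:~R - (a * b)%:~R * rho ^+ 2 < 1.
    by rewrite -(ltr_pM2l re_eps_gt0) eN mulr1.
  by have := mulr_ge0 (ltW r2) s2; lra.
have v0 : 0 < ev c d (- e) (- f) by rewrite -(pmulr_rgt0 _ u0) uN re_eps_gt0.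
have A1 : 1 < c%:~R + d%:~R * rho ^+ 2.
  have AE : 2 * (c%:~R + d%:~R * rho ^+ 2) = ev c d e f + ev c d (- e) (- f).
    by rewrite /root_eval; ring.
  by apply: mean_gt1 AE => //; rewrite uN.
set A := _ + _ in A1; set B := _ - _ in A2.
have [B1 B2] : -1 < B /\ B < 1 by apply/andP; rewrite -ltr_norml -(@ltr_pXn2r _ 2) ?nnegrE // expr1n real_normK ?num_real.
split; rewrite -(ltr0z algR).
  by rewrite /A /B in A1 B1; lra.
by rewrite -(pmulr_lgt0 _ r2); rewrite /A /B in A1 B2; lra.
Qed.

Lemma congr_pos u : is_unit Kf u -> u * sg u = eps -> 0 < re u -> congr_mod Kf r u (-1).
Proof.
move=> uu uN u0; have [c [d [e [f [uE E1 E2]]]]] := unit_coord uu uN.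
rewrite uE in u0; have [c0 d0] := unit_coord_pos u0 E1 E2.
have jc := jac_c p_prime p_mod ab2 E1 E2 c0 d0.
have op : odd p by move: p_mod; clear; lia.
have : (p%:Z %| (c - 1) * (c + 1))%Z.
  have -> : (c - 1) * (c + 1) = c * c - 1 by ring.
  exact: (c_sqr_mod_p p_prime p_mod ab2 E1 E2).
rewrite Euclid_dvdz // => /orP[/jac_mod|/dvdzP[k kE]]; first by rewrite jc jac1.
(* u + 1 = k r^4 + d r^2 + e r + f r^3, divided by r. *)
exists (zK e f d k); first exact: (zK_integer r4).
have cE : c = k * p%:Z - 1 by rewrite -kE; ring.
by rewrite uE cE /root_int /sqrt_int !(rmorphB, rmorphM) /= -[p%:Z%:~R]/(p%:R) -r4; ring.
Qed.

Lemma pi_dvd (g h : int) : ((g + h) %% 2)%Z = 0 ->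
  exists2 y, ring_of_integers kf y & zk g h = pi * y.
Proof.
move=> gh; have [oa ob] := pi_odd p_prime p_mod ab2.
have [a1 aE] : exists m, a = 2 * m + 1 by exists (a %/ 2)%Z; move: oa; clear; lia.
have [b1 bE] : exists m, b = 2 * m + 1 by exists (b %/ 2)%Z; move: ob; clear; lia.
have [p1 pE] : exists m, p%:Z = 2 * m + 1.
  by exists (p%:Z %/ 2)%Z; move: p_mod; clear; lia.
have [h1 hE] : exists m, h = 2 * m - g by exists ((g + h) %/ 2)%Z; move: gh; clear; lia.
set Q := 2 * (p1 * b1) + p1 + b1.
(* u + v s is (g + h s)(a - b s) / 2, the quotient by pi; it is integral because a, b and p are
   odd. *)
set u := g * a1 + g - h1 * (2 * Q + 1) + Q * g.
set v := h1 * (2 * a1 + 1) - g * a1 - g - b1 * g.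
have uE : 2 * u = g * a - p%:Z * (b * h) by rewrite /u /Q pE bE aE hE; ring.
have vE : 2 * v = h * a - b * g by rewrite /v bE aE hE; ring.
exists (zk u v); first exact: (zk_int r4).
rewrite (zkM r4); congr (sqrt_int _ _ _).
  have : 2 * (a * u + p%:Z * (b * v)) = 2 * g.
    transitivity (a * (2 * u) + p%:Z * b * (2 * v)); first by ring.
    by rewrite uE vE -[in RHS]ab2; ring.
  by clear; lia.
have : 2 * (a * v + b * u) = 2 * h.
  transitivity (a * (2 * v) + b * (2 * u)); first by ring.
  by rewrite uE vE -[in RHS]ab2; ring.
by clear; lia.
Qed.

(** So q is generated by pi: q contains pi^2 = 2 eps, and an element g + h s of q with g + h odd
    differs from 1 by a multiple of pi, which would put 1 in q. *)
Lemma prime_above2 (q : L -> Prop) : prime_ideal_above kf 2 q ->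
  q pi /\ forall x, q x -> exists2 y, ring_of_integers kf y & x = pi * y.
Proof.
case=> -[qI [q0 qD qM] q1 qP] q2.
have piI : ring_of_integers kf pi by apply: (zk_int r4).
have qpi : q pi.
  have epsI : ring_of_integers kf eps by case: eps_unit.
  by case: (qP pi pi piI piI) => //; rewrite -expr2 pi_sqr mulrC; apply: qM.
split=> // x qx; have /(integers_k p_prime p_mod iota r4)[g [h xE]] := qI _ qx.
have [gh|gh] : ((g + h) %% 2)%Z = 0 \/ ((g - 1 + h) %% 2)%Z = 0 by clear; lia.
  by rewrite xE; apply: pi_dvd.
case: q1; have [y yI yE] := pi_dvd gh.
have -> : 1 = x + (- 1 * y) * pi.
  by rewrite -mulrA [y * _]mulrC -yE xE /sqrt_int; ring.
apply: qD => //; apply: qM => //; apply: integersM => //.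
exact/integersN/integers1.
Qed.

(** The trace is 2 (c + d s), with 2 = pi^2 / eps. One more factor pi divides c + d s as c + d is
    even; a second one would make c even. *)
Lemma trace_valuation (q : L -> Prop) u : prime_ideal_above kf 2 q ->
  is_unit Kf u -> u * sg u = eps -> valuation_eq kf q (u + sg u) 3.
Proof.
move=> qq uu uN; have [qpi qpiP] := prime_above2 qq.
have [c [d [e [f [uE E1 E2]]]]] := unit_coord uu uN.
have [co do_] := cd_odd p_prime p_mod ab2 E1 E2.
have tE : u + sg u = 2 * zk c d by rewrite uE (sg_zK r4 sgG sgr) /root_int /sqrt_int; ring.
have epsVI : ring_of_integers kf eps^-1 by case: eps_unit.
rewrite tE; split.
  have [y yI yE] : exists2 y, ring_of_integers kf y & zk c d = pi * y.
    by apply: pi_dvd; move: co do_; clear; lia.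
  exists 1%N, (fun=> eps^-1 * y), (fun _ _ => pi); split=> [_|_ _|]; [exact: integersM | exact: qpi |].
  rewrite big_ord1 prodr_const card_ord yE (_ : pi ^+ 3 = 2 * eps * pi).
    by have := eps0 => h; field.
  by rewrite -pi_sqr exprSr.
move=> [m [A [F [AI Fq sE]]]].
have [y yI yE] : exists2 y, ring_of_integers kf y & 2 * zk c d = pi ^+ 4 * y.
  rewrite sE; elim/big_ind: _ => [|x1 x2 [y1 y1I ->] [y2 y2I ->]|i _].
  - by exists 0; rewrite ?mulr0 //; split; [apply: rpred0 | apply: integral0].
  - by exists (y1 + y2); [apply: integersD | rewrite mulrDr].
  rewrite !big_ord_recl big_ord0 mulr1.
  have [z1 z1I ->] := qpiP _ (Fq i ord0).
  have [z2 z2I ->] := qpiP _ (Fq i (lift ord0 ord0)).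
  have [z3 z3I ->] := qpiP _ (Fq i (lift ord0 (lift ord0 ord0))).
  have [z4 z4I ->] := qpiP _ (Fq i (lift ord0 (lift ord0 (lift ord0 ord0)))).
  exists (A i * (z1 * (z2 * (z3 * z4)))); last by ring.
  by do !apply: integersM.
have /(integers_k p_prime p_mod iota r4)[g [h gE]] : ring_of_integers kf (eps ^+ 2 * y).
  by apply: integersM => //; rewrite expr2; apply: integersM; case: eps_unit.
have : zk c d = zk (2 * g) (2 * h).
  apply: (mulfI two0); rewrite yE -[4%N]/(2 * 2)%N exprM pi_sqr exprMn -mulrA gE.
  by rewrite /sqrt_int; ring.
by case/(zk_inj p_prime iota r4) => cE _; move: co; rewrite cE; clear; lia.
Qed.

End Pi.

End Eps.
End Main.

Unset Implicit Arguments.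
Set Strict Implicit.

Unset Implicit Arguments.
Set Strict Implicit.

(* iota r is the positive real fourth root of p, so K = Q(p^(1/4)) and
   k = Q(sqrt p), with sqrt p = r ^+ 2. *)
Theorem theorem1p2 (p : nat) (p_prime : prime p) (p_mod : p = 7 %[mod 16])
    (L : splittingFieldType rat) (iota : {rmorphism L -> algC}) (r : L)
    (r_pow4 : r ^+ 4 = p%:R) (r_pos : 0 < iota r)
    (k K : {subfield L})
    (k_def : k = <<1; r ^+ 2>>%AS) (K_def : K = <<1; r>>%AS)
    (eps : L) (eps_fund : fundamental_unit iota k eps) :
  (exists eta : L,
     [/\ is_unit K eta,
         totally_positive K eta,
         galNorm k K eta = eps
       & forall u : L, is_unit K u <->
           exists a b c : int, u = eta ^ a * eps ^ b * (-1) ^ c])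
  /\
  (forall eta' : L, is_unit K eta' -> galNorm k K eta' = eps ->
     (forall q : L -> Prop, prime_ideal_above k 2 q ->
        valuation_eq k q (galTrace k K eta') 3)
     /\ exists2 s : int, common_sign K eta' s
                       & congr_mod K r eta' (- s%:~R)).
Proof.
subst k K.
have [sg [sgG sgr sgN sgT]] := gal_Kk p_prime iota r_pow4.
have [a [b [a0 b0 ab2 epsE]]] := eps_pi p_prime p_mod r_pow4 r_pos sgG sgr eps_fund.
rewrite -ltz_nat in a0; rewrite -ltz_nat in b0.
split.
  have [eta [eu e0 eN er emin]] :=
    minimal_generator p_prime p_mod r_pow4 r_pos sgG sgr eps_fund a0 b0 ab2 epsE.
  exists eta; split=> //; last by move=> u; apply: (unit_generated p_prime p_mod r_pow4 r_pos sgG sgr eps_fund _ eu er emin).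
    exact: (totally_positive_unit p_prime p_mod r_pow4 r_pos sgG sgr eps_fund eu eN e0).
  by rewrite sgN.
move=> u uu; rewrite sgN sgT => uN; split.
  by move=> q qq; exact: (trace_valuation p_prime p_mod r_pow4 sgG sgr eps_fund ab2 epsE qq uu uN).
have uK := unit_mem uu; have un0 : u != 0 by case: uu.
have := re_neq0 r_pos uK un0; rewrite neq_lt => /orP[] u0; last first.
  exists 1; first by left; split=> //; apply: (totally_positive_unit p_prime p_mod r_pow4 r_pos sgG sgr eps_fund uu uN u0).
  exact: (congr_pos p_prime p_mod r_pow4 r_pos sgG sgr eps_fund ab2 epsE uu uN u0).
(* A negative eta' is handled through its opposite, which has the same norm; the sign and the
   congruence change together. *)
have vu := unitN uu.
have vN : - u * sg (- u) = eps by rewrite rmorphN mulrNN.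
have v0 : 0 < re iota (- u) by rewrite (reN r_pos) ?oppr_gt0.
exists (-1).
  right; split=> // sigma sR; rewrite -oppr_gt0 -rmorphN -linearN /=.
  exact: (totally_positive_unit p_prime p_mod r_pow4 r_pos sgG sgr eps_fund vu vN v0).
have [z zI zE] := congr_pos p_prime p_mod r_pow4 r_pos sgG sgr eps_fund ab2 epsE vu vN v0.
exists (- z); first exact: integersN.
by rewrite mulrN -zE opprB; ring.
Qed.
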